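(* Let $K$ be a field and let $\Lambda=K\mathcal{Q}/I$ be a $(D,A)$-stacked monomial algebra with $D>2$, $A>1$ and $D\neq 2A$. Let $\Delta$, $I_\Delta\subseteq K\Delta$ and $\mathcal{H}_\Delta\subseteq K\Delta$ be as defined in the context. Then $\mathcal{H}_\Delta$ is a minimal generating set for the ideal $I_\Delta$ of $K\Delta$.
   Context: Setting. $\mathcal{Q}$ is a finite quiver (paths read left to right; a path $p$ starts at $s(p)$, ends at $t(p)$, has length $\ell(p)$), $I$ an admissible ideal generated by paths, $\Lambda=K\mathcal{Q}/I$ finite-dimensional, with the length grading $\Lambda=\Lambda_0\oplus\Lambda_1\oplus\cdots$ and graded radical $\mathfrak{r}=\Lambda_1\oplus\Lambda_2\oplus\cdots$. $\Lambda$ is a $(D,A)$-stacked monomial algebra ($D\geqslant 2,A\geqslant 1$ integers) if, for all $0\leqslant n\leqslant\operatorname{gldim}\Lambda$, the $n$th projective in a minimal graded projective resolution of the right $\Lambda$-module $\Lambda_0\cong\Lambda/\mathfrak{r}$ is generated in degree $\delta(n)$, with $\delta(0)=0$, $\delta(1)=1$, $\delta(n)=\frac n2D$ for $n\geqslant2$ even, $\delta(n)=\frac{n-1}2D+A$ for $n\geqslant3$ odd. Overlaps. A path $q$ overlaps a path $p$ with overlap $pu$ if there are paths $u,v$ with $pu=vq$ and $1\leqslant\ell(u)<\ell(q)$ ($\ell(v)=0$ allowed). Let $\mathcal{R}^0$ be the set of vertices, $\mathcal{R}^1$ the set of arrows of $\mathcal{Q}$, and $\mathcal{R}^2$ the minimal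 generating set of paths for $I$. For $n\geqslant3$, $\mathcal{R}^n$ is the set of all paths $R^n=R^{n-1}u$ such that $R^{n-1}\in\mathcal{R}^{n-1}$, $R^{n-1}=R^{n-2}p$ with $R^{n-2}\in\mathcal{R}^{n-2}$ and $p$ a path, some $R^2\in\mathcal{R}^2$ overlaps $p$ with overlap $pu$, and no proper prefix of $pu$ is an overlap of an element of $\mathcal{R}^2$ with $p$. Basis of Ext. The minimal graded projective resolution of $\Lambda_0$ has $P^n=\bigoplus_{R^n\in\mathcal{R}^n}t(R^n)\Lambda$ with $d^n:t(R^n)\mapsto t(R^{n-1})p$ where $R^n=R^{n-1}p$. Listing $\mathcal{R}^n=\{R^n_i\}$, let $f^n=\{f^n_i\}$ be the basis of $\operatorname{Ext}^n_\Lambda(\Lambda_0,\Lambda_0)$ with $f^n_i:P^n\to\Lambda_0$, $t(R^n_i)\mapsto t(R^n_i)+\mathfrak{r}$, $t(R^n_j)\mapsto0$ for $j\neq i$. Products in the Ext algebra (right modules, maps composed right to left) satisfy: $f^m_jf^n_i\neq0$ if and only if $R^n_iR^m_j=R^{n+m}_k\in\mathcal{R}^{n+m}$ for some $k$, and then $f^m_jf^n_i=f^{n+m}_k$. Quiver $\Delta$ and ideal $I_\Delta$. $\Delta$ has vertex set $f^0$ and arrow set $f^1\cup f^2\cup f^3$; an arrow $f^n_i$ corresponding to $R^n_i$ from $e$ to $e'$ in $\mathcal{Q}$ satisfies $f^n_i=f^0_{e'}f^n_if^0_e$, i.e. in $\Delta$ it goes from (the vertex corresponding to) $e'$ to $e$,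 paths in $\Delta$ being read left to right. $I_\Delta$ is the ideal of $K\Delta$ generated by the paths $f^{n_1}_{i_1}\cdots f^{n_r}_{i_r}$ for which $R^{n_r}_{i_r}\cdots R^{n_1}_{i_1}\notin\mathcal{R}^{n_1+\cdots+n_r}$, and by the elements $f^{n_1}_{i_1}\cdots f^{n_r}_{i_r}-f^{m_1}_{j_1}\cdots f^{m_s}_{j_s}$ for which $R^{n_r}_{i_r}\cdots R^{n_1}_{i_1}=R^{m_s}_{j_s}\cdots R^{m_1}_{j_1}$ as paths in $K\mathcal{Q}$ and $n_1+\cdots+n_r=m_1+\cdots+m_s$ (all $n_i,m_i\in\{1,2,3\}$). (By a theorem of Green and Zacharia, the Ext algebra of $\Lambda$ is isomorphic to $K\Delta/I_\Delta$.) The set $\mathcal{H}_\Delta$. It is known that if $bc\neq0$ in $\operatorname{Ext}^5_\Lambda(\Lambda_0,\Lambda_0)$ ($b\in f^2,c\in f^3$) then $bc=c'b'$ there for some $b'\in f^2,c'\in f^3$. $\mathcal{H}_\Delta$ consists of all (composable) paths in $K\Delta$ of the form $aa',ab,ba,ac,ca,cc'$, together with: $bb'$ whenever $bb'=0$ in $\operatorname{Ext}^4_\Lambda(\Lambda_0,\Lambda_0)$; $bc$ whenever $bc=0$ in $\operatorname{Ext}^5_\Lambda(\Lambda_0,\Lambda_0)$; $cb$ whenever $cb=0$ in $\operatorname{Ext}^5_\Lambda(\Lambda_0,\Lambda_0)$; and $bc-c'b'$ whenever $bc\neq0$ and $bc=c'b'$ in $\operatorname{Ext}^5_\Lambda(\Lambda_0,\Lambda_0)$;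 for all $a,a'\in f^1$, $b,b'\in f^2$, $c,c'\in f^3$. *)

(* Defs.v *)
From HB Require Import structures.
From mathcomp Require Import all_boot all_order all_algebra.
From mathcomp Require Import mathcomp_extra boolp classical_sets.
From mathcomp Require Import finmap.
From mathcomp Require Import monalg.

Set Implicit Arguments.
Unset Strict Implicit.
Unset Printing Implicit Defensive.

Import GRing.Theory.
Import Quotient.
Local Open Scope quotient_scope.
Local Open Scope classical_set_scope.
Local Open Scope ring_scope.

Definition is_ideal (R : pzRingType) (J : set R) : Prop :=
  [/\ J 0,
      forall x y, J x -> J y -> J (x + y),
      forall a x, J x -> J (a * x)
    & forall a x, J x -> J (x * a)].

Record ideal (R : pzRingType) := Ideal {
  ideal_set :> set R;
  idealP : is_ideal ideal_set
}.

Definition ideal_gen (R : pzRingType) (S : set R) : set R :=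
  [set x | forall J : set R, is_ideal J -> S `<=` J -> J x].

Definition ideal_pow (R : pzRingType) (J : set R) (m : nat) : set R :=
  ideal_gen [set x | exists y : 'I_m -> R,
                       (forall i, J (y i)) /\ x = \prod_(i < m) y i].

(* Minimality is with respect to inclusion. *)
Definition minimal_generating_set (R : pzRingType) (S J : set R) : Prop :=
  ideal_gen S = J /\ forall T, T `<=` S -> ideal_gen T = J -> T = S.

Section QuotientRing.
Variables (R : pzRingType) (J : ideal R).

Definition in_ideal : pred R := fun x => `[< ideal_set J x >].

Fact in_ideal_zmod_closed : zmod_closed in_ideal.
Proof.
have [J0 JD JM _] := idealP J.
split=> [|x y /asboolP Jx /asboolP Jy]; apply/asboolP => //.
by apply: JD => //; rewrite -mulN1r; apply: JM.
Qed.

HB.instance Definition _ :=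
  GRing.isZmodClosed.Build R in_ideal in_ideal_zmod_closed.

Let in_idealZ : zmodClosed R := GRing.ZmodClosed.clone R in_ideal _.

Definition quotring : Type := {quot in_idealZ}.

HB.instance Definition _ := Choice.on quotring.
HB.instance Definition _ := GRing.Zmodule.on quotring.

Definition qpi (x : R) : quotring := \pi_({quot in_idealZ}) x.
Definition qrepr (x : quotring) : R := repr (x : {quot in_idealZ}).

Lemma qreprK x : qpi (qrepr x) = x.
Proof. exact: reprK. Qed.

Lemma qpi_eqP x y : qpi x = qpi y <-> ideal_set J (x - y).
Proof.
have H : in_ideal (x - y) = (qpi x == qpi y) by apply: (idealrBE in_idealZ).
by split=> [/eqP|Jxy]; [rewrite -H => /asboolP | apply/eqP; rewrite -H; apply/asboolP].
Qed.

Definition quot_one : quotring := qpi 1.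
Definition quot_mul (x y : quotring) : quotring := qpi (qrepr x * qrepr y).

Lemma qpiM_subproof x y : quot_mul (qpi x) (qpi y) = qpi (x * y).
Proof.
have [_ JD JM JMr] := idealP J.
apply/qpi_eqP; set x' := qrepr _; set y' := qrepr _.
have Jx : ideal_set J (x' - x) by apply/qpi_eqP; rewrite qreprK.
have Jy : ideal_set J (y' - y) by apply/qpi_eqP; rewrite qreprK.
have -> : x' * y' - x * y = (x' - x) * y' + x * (y' - y).
  by rewrite mulrBl mulrBr addrA subrK.
by apply: JD; [apply: JMr | apply: JM].
Qed.

Lemma qpi_is_zmod_morphism : zmod_morphism qpi.
Proof. by move=> x y; apply: (raddfB (\pi_({quot in_idealZ}))). Qed.

HB.instance Definition _ :=
  GRing.isZmodMorphism.Build R quotring qpi qpi_is_zmod_morphism.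

Fact quot_mulA : associative quot_mul.
Proof.
move=> x y z; rewrite -[x]qreprK -[y]qreprK -[z]qreprK.
by rewrite !qpiM_subproof mulrA.
Qed.
Fact quot_mul1 : left_id quot_one quot_mul.
Proof. by move=> x; rewrite -[x]qreprK qpiM_subproof mul1r. Qed.
Fact quot_mulr1 : right_id quot_one quot_mul.
Proof. by move=> x; rewrite -[x]qreprK qpiM_subproof mulr1. Qed.
Fact quot_mulDl : left_distributive quot_mul +%R.
Proof.
move=> x y z; rewrite -[x]qreprK -[y]qreprK -[z]qreprK.
by rewrite -raddfD !qpiM_subproof mulrDl raddfD.
Qed.
Fact quot_mulDr : right_distributive quot_mul +%R.
Proof.
move=> x y z; rewrite -[x]qreprK -[y]qreprK -[z]qreprK.
by rewrite -raddfD !qpiM_subproof mulrDr raddfD.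
Qed.

HB.instance Definition _ := GRing.Zmodule_isPzRing.Build quotring
  quot_mulA quot_mul1 quot_mulr1 quot_mulDl quot_mulDr.

Lemma qpi_is_monoid_morphism : monoid_morphism qpi.
Proof. by split=> // x y; rewrite -qpiM_subproof. Qed.

HB.instance Definition _ :=
  GRing.isMonoidMorphism.Build R quotring qpi qpi_is_monoid_morphism.

(* Right R-modules are left modules over the converse ring R^c: throughout,
   "a *: x" with a : R^c stands for the right action "x . a".  Here is the
   right R-module R/J. *)
Definition quot_scale (a : R^c) (x : quotring) : quotring := x * qpi a.

Fact quot_scaleA a b v :
  quot_scale a (quot_scale b v) = quot_scale (a * b) v.
Proof. by rewrite /quot_scale -mulrA -rmorphM. Qed.
Fact quot_scale1 : left_id 1 quot_scale.
Proof. by move=> x; rewrite /quot_scale rmorph1 mulr1. Qed.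
Fact quot_scaleDr : right_distributive quot_scale +%R.
Proof. by move=> a x y; rewrite /quot_scale mulrDl. Qed.
Fact quot_scaleDl v : {morph quot_scale^~ v : a b / a + b}.
Proof. by move=> a b; rewrite /quot_scale raddfD mulrDr. Qed.

HB.instance Definition _ := GRing.Zmodule_isLmodule.Build R^c quotring
  quot_scaleA quot_scale1 quot_scaleDr quot_scaleDl.

End QuotientRing.

(* Only the vertex set has to be finite for the path algebra to be unital. *)
Record quiver := Quiver {
  vert : finType;
  arrow : choiceType;
  qsrc : arrow -> vert;
  qtgt : arrow -> vert
}.

Section Paths.
Variable Q : quiver.

Fixpoint is_chain (v : vert Q) (s : seq (arrow Q)) : bool :=
  if s is a :: s' then (qsrc a == v) && is_chain (qtgt a) s' else true.

(* A path is its source together with its list of arrows, read left to right. *)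
Record qpath := QPath {
  path_data : vert Q * seq (arrow Q);
  _ : is_chain path_data.1 path_data.2
}.
HB.instance Definition _ := [isSub for path_data].
HB.instance Definition _ := [Choice of qpath by <:].

Definition psrc (p : qpath) : vert Q := (path_data p).1.
Definition parrows (p : qpath) : seq (arrow Q) := (path_data p).2.
Definition ptgt (p : qpath) : vert Q := last (psrc p) (map (@qtgt Q) (parrows p)).
Definition plen (p : qpath) : nat := size (parrows p).

Definition vpath (v : vert Q) : qpath := @QPath (v, [::]) isT.

Lemma is_chain_cat v s1 s2 :
  is_chain v (s1 ++ s2) =
  is_chain v s1 && is_chain (last v (map (@qtgt Q) s1)) s2.
Proof. by elim: s1 v => //= a s1 IH v; rewrite IH andbA. Qed.

Lemma pcat_subproof (p q : qpath) : ptgt p = psrc q ->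
  is_chain (psrc p) (parrows p ++ parrows q).
Proof.
rewrite is_chain_cat -/(ptgt p) => ->.
by case: p q => [[v s] /= Hp] [[w s'] /= Hq]; apply/andP.
Qed.

(* pq, if p and q are composable *)
Definition pcomp (p q : qpath) : option qpath :=
  if @eqP _ (ptgt p) (psrc q) is ReflectT e
  then Some (@QPath (psrc p, parrows p ++ parrows q) (pcat_subproof e))
  else None.

Lemma pcompP p q r :
  pcomp p q = Some r <->
  [/\ ptgt p = psrc q, psrc r = psrc p & parrows r = parrows p ++ parrows q].
Proof.
rewrite /pcomp; case: eqP => [e|ne]; split=> //; last by case.
- by case=> <-; split.
- case=> _ e1 e2; congr (Some _); apply: val_inj; case: r e1 e2 => [[v s] Hr].
  by rewrite /psrc /parrows /= => -> ->.
Qed.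

Lemma pcomp_tgt p q r : pcomp p q = Some r -> ptgt r = ptgt q.
Proof.
by case/pcompP => e e1 e2; rewrite /ptgt e1 e2 map_cat last_cat -/(ptgt p) e.
Qed.

Lemma pcomp_len p q r : pcomp p q = Some r -> plen r = (plen p + plen q)%N.
Proof. by case/pcompP => _ _ e; rewrite /plen e size_cat. Qed.

Lemma pcompA p q r :
  obind (pcomp^~ r) (pcomp p q) = obind (pcomp p) (pcomp q r).
Proof.
case Epq: (pcomp p q) => [u|]; case Eqr: (pcomp q r) => [w|] //=.
- have tu := pcomp_tgt Epq; case/pcompP: Epq => e1 e2 e3; case/pcompP: Eqr => f1 f2 f3.
  case Eur: (pcomp u r) => [x|].
    case/pcompP: Eur => g1 g2 g3; apply/esym/pcompP.
    by split; rewrite ?f2 // ?g2 // g3 e3 f3 catA.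
  move: Eur; rewrite /pcomp; case: eqP => // ne _; case: ne.
  by rewrite tu.
- have tu := pcomp_tgt Epq; rewrite /pcomp in Eqr *; case: eqP => // e.
  by move: Eqr; case: eqP => // ne; case: ne; rewrite -tu.
- case/pcompP: Eqr => f1 f2 f3; rewrite /pcomp in Epq *; case: eqP => // e.
  by move: Epq; case: eqP => // ne; case: ne; rewrite -f2.
Qed.

Lemma pcomp1p v p : pcomp (vpath v) p = if v == psrc p then Some p else None.
Proof.
case: eqP => [e|ne]; first by apply/pcompP; split.
by rewrite /pcomp; case: eqP => // e; case: ne.
Qed.

Lemma pcompp1 v p : pcomp p (vpath v) = if v == ptgt p then Some p else None.
Proof.
case: eqP => [e|ne]; first by apply/pcompP; split; rewrite ?cats0.
by rewrite /pcomp; case: eqP => // e; case: ne.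
Qed.

(* q overlaps p with overlap w = pu *)
Definition overlaps (q p w : qpath) : Prop :=
  exists u v, [/\ pcomp p u = Some w, pcomp v q = Some w
                & (1 <= plen u < plen q)%N].

Definition proper_prefix (w' w : qpath) : Prop :=
  exists u, (0 < plen u)%N /\ pcomp w' u = Some w.

End Paths.

Definition path_alg (K : fieldType) (Q : quiver) : Type := {malg K[qpath Q]}.

(* c times the basis element k of {malg G[T]}; locked for efficiency *)
HB.lock Definition mterm (T : choiceType) (G : zmodType) (c : G) (k : T) :
    {malg G[T]} := << c *g k >>.

Lemma mterm0 (T : choiceType) (G : zmodType) (k : T) :
  mterm 0 k = 0 :> {malg G[T]}.
Proof. by rewrite mterm.unlock monalgU0. Qed.

Lemma mtermD (T : choiceType) (G : zmodType) (c c' : G) (k : T) :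
  mterm (c + c') k = mterm c k + mterm c' k.
Proof. by rewrite mterm.unlock monalgUD. Qed.

Lemma mcoeff_mterm (T : choiceType) (G : zmodType) (c : G) (k k' : T) :
  (mterm c k)@_k' = c *+ (k == k').
Proof. by rewrite mterm.unlock mcoeffU. Qed.

Definition term_mul (K : fieldType) (Q : quiver) (c : K) (p q : qpath Q) :
    path_alg K Q :=
  if pcomp p q is Some r then mterm c r else 0 : {malg K[qpath Q]}.

HB.lock Definition palg_mul (K : fieldType) (Q : quiver) (x y : path_alg K Q) :
    path_alg K Q :=
  \sum_(p <- msupp x) \sum_(q <- msupp y)
     (term_mul (x@_p * y@_q) p q : {malg K[qpath Q]}).

Section PathAlgebra.
Variables (K : fieldType) (Q : quiver).
Local Notation KQ := (path_alg K Q).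
Local Notation palg_mul := (@palg_mul.body K Q).
Local Notation term_mul := (@term_mul K Q).

HB.instance Definition _ := Choice.on KQ.
HB.instance Definition _ := GRing.Zmodule.on KQ.
HB.instance Definition _ :=
  GRing.Lmodule.copy KQ ({malg K[qpath Q]} : lmodType K).

Definition pbasis (p : qpath Q) : KQ := mterm 1 p.

Definition palg_one : KQ := \sum_(v : vert Q) pbasis (vpath v).

Lemma term_mul0 p q : term_mul 0 p q = 0.
Proof. by rewrite /term_mul; case: pcomp => // r; rewrite mterm0. Qed.

Lemma term_mulD c c' p q : term_mul (c + c') p q = term_mul c p q + term_mul c' p q.
Proof. by rewrite /term_mul; case: pcomp => [r|]; rewrite ?mtermD ?addr0. Qed.

Lemma palg_mulEw (d1 d2 : {fset qpath Q}) (x y : KQ) :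
  (msupp x `<=` d1)%fset -> (msupp y `<=` d2)%fset ->
  palg_mul x y = \sum_(p <- d1) \sum_(q <- d2) term_mul (x@_p * y@_q) p q.
Proof.
move=> s1 s2; rewrite palg_mul.unlock (big_fset_incl _ s1) /=; last first.
  move=> p _ /mcoeff_outdom ->; rewrite big1 // => q _.
  by rewrite mul0r term_mul0.
apply: eq_bigr => p _; apply: (big_fset_incl _ s2) => q _ /mcoeff_outdom ->.
by rewrite mulr0 term_mul0.
Qed.

Fact palg_mulDl : left_distributive palg_mul +%R.
Proof.
move=> x y z; pose d := (msupp x `|` msupp y `|` msupp (x + y : KQ))%fset.
rewrite !(@palg_mulEw d (msupp z)) ?fsubsetUr //; last 2 first.
- by apply/fsubsetP => k; rewrite !in_fsetU => ->; rewrite orbT.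
- by apply/fsubsetP => k; rewrite !in_fsetU => ->.
rewrite -big_split; apply: eq_bigr => p _; rewrite -big_split.
by apply: eq_bigr => q _ /=; rewrite mcoeffD mulrDl term_mulD.
Qed.

Fact palg_mulDr : right_distributive palg_mul +%R.
Proof.
move=> z x y; pose d := (msupp x `|` msupp y `|` msupp (x + y : KQ))%fset.
rewrite !(@palg_mulEw (msupp z) d) ?fsubsetUr //; last 2 first.
- by apply/fsubsetP => k; rewrite !in_fsetU => ->; rewrite orbT.
- by apply/fsubsetP => k; rewrite !in_fsetU => ->.
rewrite -big_split; apply: eq_bigr => p _; rewrite -big_split.
by apply: eq_bigr => q _ /=; rewrite mcoeffD mulrDr term_mulD.
Qed.

Lemma palg_mul0l x : palg_mul 0 x = 0.
Proof. by apply: (@addrI _ (palg_mul 0 x)); rewrite -palg_mulDl !addr0. Qed.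

Lemma palg_mul0r x : palg_mul x 0 = 0.
Proof. by apply: (@addrI _ (palg_mul x 0)); rewrite -palg_mulDr !addr0. Qed.

Lemma palg_mul_suml I (r : seq I) (F : I -> KQ) y :
  palg_mul (\sum_(i <- r) F i) y = \sum_(i <- r) palg_mul (F i) y.
Proof.
by apply: (big_morph (palg_mul^~ y)) => [a b|]; rewrite ?palg_mulDl ?palg_mul0l.
Qed.

Lemma palg_mul_sumr I (r : seq I) (F : I -> KQ) y :
  palg_mul y (\sum_(i <- r) F i) = \sum_(i <- r) palg_mul y (F i).
Proof.
by apply: (big_morph (palg_mul y)) => [a b|]; rewrite ?palg_mulDr ?palg_mul0r.
Qed.

Lemma palg_mulUU c c' (p q : qpath Q) :
  palg_mul (mterm c p) (mterm c' q) = term_mul (c * c') p q.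
Proof.
rewrite (@palg_mulEw [fset p]%fset [fset q]%fset) ?mterm.unlock ?msuppU_le //.
by rewrite !big_seq_fset1 !mcoeffUU.
Qed.

Lemma palg_ind (P : KQ -> Prop) :
  P 0 -> (forall x y, P x -> P y -> P (x + y)) ->
  (forall c p, P (mterm c p)) -> forall x, P x.
Proof.
move=> P0 PD PU x; rewrite [x]monalgE; apply: big_ind => // p _.
by have := PU x@_p p; rewrite mterm.unlock.
Qed.

Fact palg_mulA : associative palg_mul.
Proof.
elim/palg_ind => [|x x' IHx IHx'|c p] y z.
- by rewrite !palg_mul0l.
- by rewrite !palg_mulDl IHx IHx'.
elim/palg_ind: y z => [|y y' IHy IHy'|c' q] z.
- by rewrite palg_mul0r !palg_mul0l palg_mul0r.
- by rewrite palg_mulDr !palg_mulDl palg_mulDr IHy IHy'.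
elim/palg_ind: z => [|z z' IHz IHz'|c'' r].
- by rewrite !palg_mul0r.
- by rewrite !palg_mulDr IHz IHz'.
rewrite (palg_mulUU c' c'' q r) (palg_mulUU c c' p q).
have := pcompA p q r; rewrite /term_mul.
case: (pcomp p q) => [u|]; case: (pcomp q r) => [w|] /=.
- by rewrite (palg_mulUU c _ p w) (palg_mulUU _ c'' u r) /term_mul mulrA => ->.
- by rewrite (palg_mulUU _ c'' u r) /term_mul => ->; rewrite palg_mul0r.
- by rewrite (palg_mulUU c _ p w) /term_mul => <-; rewrite palg_mul0l.
- by rewrite palg_mul0l palg_mul0r.
Qed.

Fact palg_mul1 : left_id palg_one palg_mul.
Proof.
elim/palg_ind => [|x y IHx IHy|c p]; first by rewrite palg_mul0r.
  by rewrite palg_mulDr IHx IHy.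
rewrite palg_mul_suml (bigD1 (psrc p)) //= big1 => [|v nv];
  rewrite palg_mulUU /term_mul pcomp1p.
- by rewrite eqxx mul1r addr0.
- by rewrite (negPf nv).
Qed.

Fact palg_mulr1 : right_id palg_one palg_mul.
Proof.
elim/palg_ind => [|x y IHx IHy|c p]; first by rewrite palg_mul0l.
  by rewrite palg_mulDl IHx IHy.
rewrite palg_mul_sumr (bigD1 (ptgt p)) //= big1 => [|v nv];
  rewrite palg_mulUU /term_mul pcompp1.
- by rewrite eqxx mulr1 addr0.
- by rewrite (negPf nv).
Qed.

HB.instance Definition _ := GRing.Zmodule_isPzRing.Build KQ
  palg_mulA palg_mul1 palg_mulr1 palg_mulDl palg_mulDr.

Definition arrow_ideal : set KQ :=
  ideal_gen [set pbasis p | p in [set p | plen p = 1%N]].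

(* KQ/I is then finite-dimensional if Q has finitely many arrows. *)
Definition admissible (I : set KQ) : Prop :=
  exists2 m, (2 <= m)%N &
    ideal_pow arrow_ideal m `<=` I /\ I `<=` ideal_pow arrow_ideal 2.

End PathAlgebra.

Section Modules.
Variables (K : fieldType) (Q : quiver) (I : ideal (path_alg K Q)).
Local Notation KQ := (path_alg K Q).
Local Notation Lam := (quotring I).

Definition Lam_deg (i : nat) : set Lam :=
  [set qpi I x | x in [set x : KQ | forall p, x@_p != 0 -> plen p = i]].

Definition rad_set : set Lam :=
  [set qpi I x | x in [set x : KQ | forall p, x@_p != 0 -> (0 < plen p)%N]].

Lemma palg_mul_supp (x y : KQ) r : (x * y)@_r != 0 ->
  exists p q, [/\ x@_p != 0, y@_q != 0 & pcomp p q = Some r].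
Proof.
move=> nz; apply: contrapT => H; move/eqP: nz; apply.
rewrite /GRing.mul /= palg_mul.unlock raddf_sum /= big1_seq // => p /= px.
rewrite raddf_sum /= big1_seq // => q /= qy.
rewrite /term_mul; case E: (pcomp p q) => [r'|]; last by rewrite mcoeff0.
rewrite mcoeff_mterm; case: eqP => [e|_]; last by rewrite mulr0n.
by case: H; exists p, q; rewrite !mcoeff_neq0 -e.
Qed.

Fact rad_is_ideal : is_ideal rad_set.
Proof.
split.
- by exists 0; [move=> p; rewrite mcoeff0 eqxx | rewrite raddf0].
- move=> _ _ [x Hx <-] [y Hy <-]; exists (x + y); last by rewrite raddfD.
  move=> p; rewrite mcoeffD => nz; case: (eqVneq x@_p 0) => [x0|/Hx //].
  by apply: Hy; move: nz; rewrite x0 add0r.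
- move=> a _ [x Hx <-]; exists (qrepr a * x); last by rewrite rmorphM /= qreprK.
  move=> r /palg_mul_supp[p [q [_ /Hx Hq /pcomp_len ->]]].
  by rewrite addn_gt0 Hq orbT.
- move=> a _ [x Hx <-]; exists (x * qrepr a); last by rewrite rmorphM /= qreprK.
  move=> r /palg_mul_supp[p [q [/Hx Hp _ /pcomp_len ->]]].
  by rewrite addn_gt0 Hp.
Qed.

Definition rad : ideal Lam := Ideal rad_is_ideal.

Definition Lam0 : lmodType Lam^c := quotring rad.

(* N-gradings of right modules over the graded algebra Lam *)
Definition is_grading (M : lmodType Lam^c) (G : nat -> set M) : Prop :=
  [/\ forall i, G i 0 /\ (forall x y, G i x -> G i y -> G i (x - y)),
      forall i j (l : Lam) x, Lam_deg j l -> G i x -> G (i + j)%N ((l : Lam^c) *: x),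
      forall x, exists N, exists2 c : nat -> M,
        forall i, G i (c i) & x = \sum_(i < N) c i
    & forall N (c : nat -> M), (forall i, G i (c i)) ->
        \sum_(i < N) c i = 0 -> forall i, (i < N)%N -> c i = 0].

(* the set of finite sums of elements x . l, with x in S and l in L *)
Definition mul_span (M : lmodType Lam^c) (S : set M) (L : set Lam) : set M :=
  [set x | exists2 s : seq (Lam * M),
     forall z, z \in s -> L z.1 /\ S z.2 &
     x = \sum_(z <- s) (z.1 : Lam^c) *: z.2].

Definition generated_in_degree (M : lmodType Lam^c) (G : nat -> set M) (i : nat) :=
  mul_span (G i) setT = setT.

Definition projective (P : lmodType Lam^c) : Prop :=
  forall (M N : lmodType Lam^c) (g : {linear M -> N}) (f : {linear P -> N}),
    (forall y, exists x, g x = y) ->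
    exists h : {linear P -> M}, forall x, g (h x) = f x.

(* sequences ... -> X 1 -> X 0 -> Lam0 of right Lam-modules *)
Record augmented := Augmented {
  term :> nat -> lmodType Lam^c;
  diff : forall n, {linear term n.+1 -> term n};
  aug : {linear term 0 -> Lam0}
}.

Definition exact_augmented (X : augmented) : Prop :=
  [/\ forall y, exists x, aug X x = y,
      forall x, aug X x = 0 <-> exists z, x = diff X 0 z
    & forall n x, diff X n x = 0 <-> exists z, x = diff X n.+1 z].

(* Lam0 is concentrated in degree 0. *)
Definition minimal_graded_projective_resolution
    (X : augmented) (G : forall n, nat -> set (X n)) : Prop :=
  [/\ exact_augmented X,
      forall n, projective (X n) /\ is_grading (G n),
      (forall n i x, G n.+1 i x -> G n i (diff X n x)) /\
      (forall i x, (0 < i)%N -> G 0%N i x -> aug X x = 0)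
    & forall n x, mul_span setT rad_set (diff X n x)].

Definition delta (D A n : nat) : nat :=
  if n == 0%N then 0%N else if n == 1%N then 1%N
  else if odd n then (n./2 * D + A)%N else (n./2 * D)%N.

(* Minimal graded projective resolutions are unique up to isomorphism.  For
   n > gldim Lam the n-th projective is zero, hence generated in any degree,
   so that n need not be bounded by gldim Lam. *)
Definition stacked (D A : nat) : Prop :=
  forall (X : augmented) (G : forall n, nat -> set (X n)),
    minimal_graded_projective_resolution G ->
    forall n, generated_in_degree (G n) (delta D A n).

End Modules.

Section Rsets.
Variables (Q : quiver) (R2 : set (qpath Q)).

Fixpoint Rset (n : nat) : set (qpath Q) :=
  match n with
  | 0 => [set p | plen p = 0%N]
  | n1.+1 => match n1 with
    | 0 => [set p | plen p = 1%N]
    | n2.+1 => match n2 with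
      | 0 => R2
      | _.+1 => [set R | exists R' R'' p u w,
          [/\ Rset n1 R' /\ pcomp R' u = Some R,
              Rset n2 R'' /\ pcomp R'' p = Some R',
              pcomp p u = Some w,
              (exists2 q, R2 q & overlaps q p w)
            & forall w', proper_prefix w' w ->
                ~ (exists2 q, R2 q & overlaps q p w')]]
      end
    end
  end.

(* R = R' p with R' in R^n; in the monomial setting, R' is unique. *)
Definition Rsplit (n : nat) (R : qpath Q) : option (qpath Q * qpath Q) :=
  if pselect (exists z, Rset n z.1 /\ pcomp z.1 z.2 = Some R) is left h
  then Some (projT1 (cid h)) else None.

Lemma RsplitP n R z :
  Rsplit n R = Some z -> Rset n z.1 /\ pcomp z.1 z.2 = Some R.
Proof. by rewrite /Rsplit; case: pselect => // h [<-]; case: cid. Qed.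

End Rsets.

Section Bardzell.
Variables (K : fieldType) (Q : quiver) (I : ideal (path_alg K Q)).
Variable R2 : set (qpath Q).
Local Notation KQ := (path_alg K Q).
Local Notation Lam := (quotring I).

Definition pclass (p : qpath Q) : Lam := qpi I (pbasis K p).

(* families (x_R) with finite support contained in R^n, and x_R in t(R) Lam *)
Definition in_Pn (n : nat) : pred {malg Lam[qpath Q]} :=
  fun x => `[< (forall R, x@_R != 0 -> Rset R2 n R) /\
               (forall R, pclass (vpath (ptgt R)) * x@_R = x@_R) >].

Fact in_Pn_zmod_closed n : zmod_closed (in_Pn n).
Proof.
split=> [|x y /asboolP[Hx Ex] /asboolP[Hy Ey]]; apply/asboolP; split=> R.
- by rewrite mcoeff0 eqxx.
- by rewrite mcoeff0 mulr0.
- rewrite mcoeffB => nz; case: (eqVneq x@_R 0) => [x0|/Hx //].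
  by apply: Hy; move: nz; rewrite x0 sub0r oppr_eq0.
- by rewrite mcoeffB mulrBr Ex Ey.
Qed.

HB.instance Definition _ n :=
  GRing.isZmodClosed.Build {malg Lam[qpath Q]} (in_Pn n) (in_Pn_zmod_closed n).

(* P^n, the direct sum of the right modules t(R) Lam, R in R^n *)
Record Pn (n : nat) : Type := MkPn {
  Pn_val : {malg Lam[qpath Q]};
  _ : Pn_val \in in_Pn n
}.
HB.instance Definition _ n := [isSub for @Pn_val n].
HB.instance Definition _ n := [Choice of Pn n by <:].
HB.instance Definition _ n := [SubChoice_isSubZmodule of Pn n by <:].

Lemma Pn_valP n (x : Pn n) :
  (forall R, (Pn_val x)@_R != 0 -> Rset R2 n R) /\
  (forall R, pclass (vpath (ptgt R)) * (Pn_val x)@_R = (Pn_val x)@_R).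
Proof. by case: x => x /= /asboolP. Qed.

Definition Pn_scale_raw (l : Lam) (x : {malg Lam[qpath Q]}) : {malg Lam[qpath Q]} :=
  [malg R in msupp x => x@_R * l].

Lemma Pn_scale_rawE l x R : (Pn_scale_raw l x)@_R = x@_R * l.
Proof. by rewrite mcoeffE; case: msuppP => // _; rewrite mul0r. Qed.

Fact Pn_scale_subproof n (l : Lam) (x : Pn n) :
  Pn_scale_raw l (Pn_val x) \in in_Pn n.
Proof.
have [Hx Ex] := Pn_valP x; apply/asboolP; split=> R; rewrite Pn_scale_rawE.
- by move=> nz; apply: Hx; apply: contraNneq nz => ->; rewrite mul0r.
- by rewrite mulrA Ex.
Qed.

Definition Pn_scale n (l : Lam^c) (x : Pn n) : Pn n :=
  MkPn (Pn_scale_subproof l x).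

Lemma Pn_eqP n (x y : Pn n) :
  (forall R, (Pn_val x)@_R = (Pn_val y)@_R) -> x = y.
Proof. by move=> H; apply: val_inj; apply/malgP. Qed.

Lemma Pn_valD n (x y : Pn n) : Pn_val (x + y) = Pn_val x + Pn_val y.
Proof. exact: (raddfD (\val : Pn n -> {malg Lam[qpath Q]})). Qed.

Lemma Pn_scaleE n (l : Lam^c) (x : Pn n) R :
  (Pn_val (Pn_scale l x))@_R = (Pn_val x)@_R * (l : Lam).
Proof. exact: Pn_scale_rawE. Qed.

Fact Pn_scaleA n a b (x : Pn n) : Pn_scale a (Pn_scale b x) = Pn_scale (a * b) x.
Proof. by apply: Pn_eqP => R; rewrite !Pn_scaleE -mulrA. Qed.
Fact Pn_scale1 n : left_id 1 (@Pn_scale n).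
Proof. by move=> x; apply: Pn_eqP => R; rewrite Pn_scaleE mulr1. Qed.
Fact Pn_scaleDr n : right_distributive (@Pn_scale n) +%R.
Proof.
move=> a x y; apply: Pn_eqP => R.
by rewrite Pn_valD mcoeffD !Pn_scaleE Pn_valD mcoeffD mulrDl.
Qed.
Fact Pn_scaleDl n (x : Pn n) : {morph (@Pn_scale n)^~ x : a b / a + b}.
Proof.
move=> a b; apply: Pn_eqP => R.
by rewrite Pn_valD mcoeffD !Pn_scaleE mulrDr.
Qed.

HB.instance Definition _ n := GRing.Zmodule_isLmodule.Build Lam^c (Pn n)
  (@Pn_scaleA n) (@Pn_scale1 n) (@Pn_scaleDr n) (@Pn_scaleDl n).

Lemma Pn_valZ n (l : Lam^c) (x : Pn n) R :
  (Pn_val (l *: x))@_R = (Pn_val x)@_R * (l : Lam).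
Proof. exact: Pn_scale_rawE. Qed.

(* t(R) . l |-> t(R') . p l, where R = R' p *)
Definition dterm (n : nat) (R : qpath Q) (l : Lam) : {malg Lam[qpath Q]} :=
  if Rsplit R2 n R is Some (R', p) then mterm (pclass p * l) R' else 0.

Definition d_raw (n : nat) (x : {malg Lam[qpath Q]}) : {malg Lam[qpath Q]} :=
  \sum_(R <- msupp x) dterm n R x@_R.

Lemma dtermD n R l l' : dterm n R (l + l') = dterm n R l + dterm n R l'.
Proof. by rewrite /dterm; case: Rsplit => [[R' p]|]; rewrite ?addr0 // mulrDr mtermD. Qed.

Lemma dterm0 n R : dterm n R 0 = 0.
Proof. by rewrite /dterm; case: Rsplit => [[R' p]|] //; rewrite mulr0 mterm0. Qed.

Lemma d_rawEw n (d : {fset qpath Q}) x : (msupp x `<=` d)%fset ->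
  d_raw n x = \sum_(R <- d) dterm n R x@_R.
Proof.
by move=> s; apply: (big_fset_incl _ s) => R _ /mcoeff_outdom ->; rewrite dterm0.
Qed.

Lemma d_rawD n x y : d_raw n (x + y) = d_raw n x + d_raw n y.
Proof.
pose d := (msupp x `|` msupp y `|` msupp (x + y))%fset.
rewrite !(@d_rawEw n d) ?fsubsetUr //; last 2 first.
- by apply/fsubsetP => k; rewrite !in_fsetU => ->; rewrite orbT.
- by apply/fsubsetP => k; rewrite !in_fsetU => ->.
by rewrite -big_split; apply: eq_bigr => R _ /=; rewrite mcoeffD dtermD.
Qed.

Lemma dtermM n R l l' : dterm n R (l * l') = Pn_scale_raw l' (dterm n R l).
Proof.
apply/malgP => S; rewrite Pn_scale_rawE /dterm.
case: Rsplit => [[R' p]|]; rewrite ?mcoeff0 ?mul0r // !mcoeff_mterm mulrA.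
by case: eqP => _; rewrite ?mulr0n ?mul0r.
Qed.

Lemma d_rawZ n l x : d_raw n (Pn_scale_raw l x) = Pn_scale_raw l (d_raw n x).
Proof.
rewrite (@d_rawEw n (msupp x)); last first.
  apply/fsubsetP => R; rewrite -!mcoeff_neq0 Pn_scale_rawE.
  by apply: contraNneq => ->; rewrite mul0r.
apply/malgP => S; rewrite Pn_scale_rawE /d_raw !raddf_sum /= mulr_suml.
by apply: eq_bigr => R _; rewrite Pn_scale_rawE dtermM Pn_scale_rawE.
Qed.

Lemma pclassM p q : pclass p * pclass q = oapp pclass 0 (pcomp p q).
Proof.
rewrite /pclass -rmorphM /GRing.mul /= palg_mulUU mulr1 /term_mul.
by case: pcomp => //=; rewrite raddf0.
Qed.

Fact d_subproof n (x : Pn n.+1) : d_raw n (Pn_val x) \in in_Pn n.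
Proof.
have [Hx Ex] := Pn_valP x.
rewrite /d_raw; apply: rpred_sum => R _; rewrite /dterm.
case E: Rsplit => [[R' p]|]; last by rewrite rpred0.
have [/= HR' /pcompP[e _ _]] := RsplitP E.
apply/asboolP; split=> S; rewrite mcoeff_mterm; case: (R' =P S) => [<-|_];
  rewrite ?mulr0n ?mulr1n ?eqxx ?mulr0 //.
by rewrite mulrA pclassM pcomp1p e eqxx.
Qed.

Definition dn n (x : Pn n.+1) : Pn n := MkPn (d_subproof x).

Fact dn_is_linear n : linear (@dn n).
Proof.
move=> a x y; apply: val_inj.
rewrite -[LHS]/(d_raw n (Pn_val (a *: x + y))) -[RHS]/(Pn_val (a *: dn x + dn y)).
rewrite !Pn_valD d_rawD; congr (_ + _).
exact: d_rawZ.
Qed.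
HB.instance Definition _ n :=
  GRing.isLinear.Build Lam^c (Pn n.+1) (Pn n) _ (@dn n) (@dn_is_linear n).

(* The element f^n_R, R in R^n, of Hom(P^n, Lam0): it sends t(R) to t(R) + rad,
   and t(S) to 0 for S <> R in R^n. *)
Definition fn n (R : qpath Q) (x : Pn n) : Lam0 I := qpi (rad I) (Pn_val x)@_R.

Fact fn_is_linear n R : linear (@fn n R).
Proof.
move=> a x y; rewrite /fn Pn_valD mcoeffD raddfD; congr (_ + _).
by rewrite Pn_valZ; exact: (rmorphM (qpi (rad I))).
Qed.
HB.instance Definition _ n R :=
  GRing.isLinear.Build Lam^c (Pn n) (Lam0 I) _ (@fn n R) (@fn_is_linear n R).

Definition augn (x : Pn 0) : Lam0 I :=
  \sum_(v : vert Q) fn (vpath v) x.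

Fact augn_is_linear : linear augn.
Proof.
move=> a x y; rewrite /augn scaler_sumr -big_split.
by apply: eq_bigr => v _; rewrite linearP.
Qed.
HB.instance Definition _ :=
  GRing.isLinear.Build Lam^c (Pn 0) (Lam0 I) _ augn augn_is_linear.

Definition bardzell : augmented I :=
  @Augmented K Q I (fun n => Pn n : lmodType Lam^c) (fun n => @dn n) augn.

End Bardzell.

Section Ext.
Variables (K : fieldType) (Q : quiver) (I : ideal (path_alg K Q)).
Variable X : augmented I.
Local Notation L0 := (Lam0 I).

(* Ext^n(Lam0, Lam0) is the n-th cohomology of Hom(X, Lam0); its elements are
   represented as cosets of the group of coboundaries. *)
Definition coboundary (n : nat) : set (X n -> L0) :=
  match n with
  | 0 => [set h | forall x, h x = 0]
  | n'.+1 => [set h | exists g : {linear X n' -> L0},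
                        forall x, h x = g (diff X n' x)]
  end.

Definition lifts_to n (f : X n -> L0) (phi : forall k, {linear X (k + n)%N -> X k}) :=
  (forall x, aug X (phi 0%N x) = f x) /\
  (forall k (x : X (k + n).+1),
     diff X k (phi k.+1 x) = phi k (diff X (k + n)%N x)).

(* The product gf in Ext^(m+n) of the classes of g and f (maps are composed from
   right to left): the class of the composition of g with the m-th component of a
   chain map lifting f. *)
Definition ext_mul (m n : nat) (g : X m -> L0) (f : X n -> L0) :
    set (X (m + n)%N -> L0) :=
  [set h | exists2 phi : (forall k, {linear X (k + n)%N -> X k}),
     lifts_to f phi &
     coboundary (fun x => h x - g (phi m x))].

End Ext.

Section Delta.
Variables (Q : quiver) (R2 : set (qpath Q)).

(* The vertex set f^0 of Delta is identified with that of Q. *)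
Definition is_Delta_arrow : pred (nat * qpath Q) :=
  fun z => (1 <= z.1 <= 3)%N && `[< Rset R2 z.1 z.2 >].

(* the arrow (n, R) is f^n_R *)
Record Delta_arrow : Type := DeltaArrow {
  darrow :> nat * qpath Q;
  _ : is_Delta_arrow darrow
}.
HB.instance Definition _ := [isSub for darrow].
HB.instance Definition _ := [Choice of Delta_arrow by <:].

Definition Delta : quiver :=
  @Quiver (vert Q) Delta_arrow (fun a => ptgt a.2) (fun a => psrc a.2).

(* w = f^{n_1}_{R_1} ... f^{n_r}_{R_r}, for s = [:: (n_1, R_1); ...; (n_r, R_r)] *)
Definition Delta_word (w : qpath Delta) (s : seq (nat * qpath Q)) : Prop :=
  map darrow (parrows w) = s.

Definition Delta_deg (w : qpath Delta) : nat :=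
  sumn [seq (darrow a).1 | a <- parrows w].

(* the path R_r ... R_1 of Q, for w as above *)
Definition Delta_path (w : qpath Delta) : option (qpath Q) :=
  foldl (fun acc (a : Delta_arrow) => obind (pcomp a.2) acc)
        (Some (vpath (psrc w : vert Q))) (parrows w).

Variable K : fieldType.
Local Notation KD := (path_alg K Delta).

Definition I_Delta_monomials : set KD :=
  [set x | exists w, [/\ x = pbasis K w, (0 < plen w)%N &
     ~ exists2 p, Delta_path w = Some p & Rset R2 (Delta_deg w) p]].

Definition I_Delta_binomials : set KD :=
  [set x | exists w w', [/\ x = pbasis K w - pbasis K w',
     (0 < plen w)%N /\ (0 < plen w')%N,
     (exists2 p, Delta_path w = Some p & Delta_path w' = Some p)
   & Delta_deg w = Delta_deg w']].

Definition I_Delta : set KD :=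
  ideal_gen (I_Delta_monomials `|` I_Delta_binomials).

Variable I : ideal (path_alg K Q).

(* the product f^m_S f^n_R in Ext^(m+n)(Lam0, Lam0) *)
Definition fmul (m n : nat) (S R : qpath Q) :=
  @ext_mul K Q I (bardzell I R2) m n (@fn K Q I R2 m S) (@fn K Q I R2 n R).

Definition ext0 (n : nat) := @coboundary K Q I (bardzell I R2) n.

Arguments fmul m n S R _ : clear implicits.
Arguments ext0 n _ : clear implicits.

(* Arrows a, b, c are those of degree 1, 2, 3; a pair (m, n) gives the degrees of
   the two factors of a quadratic path. *)
Definition H_quadratic : set KD :=
  [set x | exists w S R, x = pbasis K w /\
     exists2 mn, mn \in [:: (1, 1); (1, 2); (2, 1); (1, 3); (3, 1); (3, 3)]%N &
       Delta_word w [:: (mn.1, S); (mn.2, R)]].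

Definition H_vanishing : set KD :=
  [set x | exists w S R, x = pbasis K w /\
     exists2 mn, mn \in [:: (2, 2); (2, 3); (3, 2)]%N &
       Delta_word w [:: (mn.1, S); (mn.2, R)] /\
       fmul mn.1 mn.2 S R = ext0 (mn.1 + mn.2)%N].

Definition H_commutation : set KD :=
  [set x | exists w w' b c c' b', [/\ x = pbasis K w - pbasis K w',
     Delta_word w [:: (2, b); (3, c)]%N,
     Delta_word w' [:: (3, c'); (2, b')]%N,
     fmul 2 3 b c <> ext0 5
   & fmul 2 3 b c = fmul 3 2 c' b' :> set (Pn I R2 5 -> Lam0 I)]].

Definition H_Delta : set KD := H_quadratic `|` H_vanishing `|` H_commutation.

End Delta.

Arguments I_Delta {Q} R2 K _.
Arguments H_Delta {Q} R2 {K} I _.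

(* Main.v *)
From HB Require Import structures.
From mathcomp Require Import all_boot all_order all_algebra.
From mathcomp Require Import mathcomp_extra boolp classical_sets.
From mathcomp Require Import finmap monalg zify.
Require Import Defs.

(** Bardzell's complex is a minimal graded projective resolution of [Lam0] for
    any monomial [I]: on the basis [t(R) q] the differential preserves the path
    [R q], so exactness is a combinatorial statement about prefixes of paths.
    Applied to it, the stacked hypothesis says that every element of [R^n] has
    length [delta n].  The cochain [f^n_R] lifts to the chain map sending
    [t(T)] to [t(S) q] if [T = R S q] with [S] in [R^k], and to [0] otherwise,
    so [f^m_S f^n_R] is [f^(m+n)_(RS)] or [0] according to whether [RS] lies in
    [R^(m+n)].

    In a stacked algebra, two elements of [R^2] occurring in a path at positions
    [i < j < i + D], with none in between, satisfy [j = i + A].  If [R^4] is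
    nonempty this gives [A | D] and [3 A <= D], and then, for [n >= 4], a path of
    length [delta n] is in [R^n] iff it has an element of [R^2] at every multiple
    of [A] up to [delta n - D].  So a word in [f^1, f^2, f^3] all of whose
    consecutive products are nonzero has no factor [f^1], and the relations
    [bc = c'b'] bring it to the form [b...b] or [cb...b], which is determined by
    its path, unless it contains two factors [f^3]; in that case they can be
    brought together and [cc' = 0] applies.  Minimality holds because the
    elements of H_Delta are supported on pairwise disjoint sets of words of
    length two. *)

Set Implicit Arguments.
Unset Strict Implicit.
Unset Printing Implicit Defensive.

Import GRing.Theory.
Local Open Scope classical_set_scope.
Local Open Scope ring_scope.

(** * Paths and associated sequences *)

(** Since [stacked] speaks of all minimal graded projective resolutions, it gives information only
    once one of them is exhibited; this is why Bardzell's complex has to be proved exact and graded.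
    The product in Ext is a set of cochains coming from arbitrary lifts, so the explicit lift must
    be completed by independence of the lift. The three numerical hypotheses stop lengths from
    adding up in the wrong degrees: [delta 1 + delta 1 = delta 2] would mean [D = 2],
    [delta 1 + delta 2 = delta 3] would mean [A = 1], and [delta 3 + delta 3 = delta 6] would mean
    [D = 2 * A]. The last one also turns [A < D] and [A %| D] into [3 * A <= D]. These bounds make
    [delta] superadditive, and this is what allows prefixes to be compared by length when the lift
    is checked to be a chain map. *)

Section Subpaths.
Variable Q : quiver.
Implicit Types p q r P : qpath Q.

Lemma qpath_eq p q : psrc p = psrc q -> parrows p = parrows q -> p = q.
Proof.
by case: p q => [[v s] Hp] [[w s'] Hq]; rewrite /psrc /parrows /= => e1 e2;
  apply: val_inj; rewrite /= e1 e2.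
Qed.

Lemma qpath_chain p : is_chain (psrc p) (parrows p).
Proof. by case: p. Qed.

Lemma psrc_arrows p a s : parrows p = a :: s -> psrc p = qsrc a.
Proof. by move=> e; have := qpath_chain p; rewrite e /= => /andP[/eqP]. Qed.

Lemma qpath_eq_arrows p q :
  parrows p = parrows q -> (0 < plen p)%N -> p = q.
Proof.
move=> e; rewrite /plen; case Ep: (parrows p) => [//|a s] _.
by apply: qpath_eq => //; rewrite (psrc_arrows Ep); rewrite e in Ep; rewrite (psrc_arrows Ep).
Qed.

Fact ptake_subproof i p : is_chain (psrc p) (take i (parrows p)).
Proof.
by have := qpath_chain p; rewrite -{1}(cat_take_drop i (parrows p)) is_chain_cat => /andP[].
Qed.

Definition ptake i p : qpath Q := @QPath Q (psrc p, take i (parrows p)) (ptake_subproof i p).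

Fact pdrop_subproof i p :
  is_chain (last (psrc p) (map (@qtgt Q) (take i (parrows p)))) (drop i (parrows p)).
Proof.
by have := qpath_chain p; rewrite -{1}(cat_take_drop i (parrows p)) is_chain_cat => /andP[].
Qed.

Definition pdrop i p : qpath Q :=
  @QPath Q (last (psrc p) (map (@qtgt Q) (take i (parrows p))), drop i (parrows p))
    (pdrop_subproof i p).

Lemma pcomp_takedrop i p : pcomp (ptake i p) (pdrop i p) = Some p.
Proof. by apply/pcompP; split=> //; rewrite /parrows /= cat_take_drop. Qed.

Lemma pcomp_ex p q : ptgt p = psrc q -> exists r, pcomp p q = Some r.
Proof. by rewrite /pcomp; case: eqP => // e _; eexists. Qed.

Lemma pcomp_ptake p q r : pcomp p q = Some r -> p = ptake (plen p) r.
Proof.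
case/pcompP => _ e1 e2; apply: qpath_eq => //.
by rewrite /parrows /= -/(parrows r) e2 take_size_cat.
Qed.

Lemma pcomp_pdrop p q r : pcomp p q = Some r -> q = pdrop (plen p) r.
Proof.
case/pcompP => e e1 e2; apply: qpath_eq;
  rewrite /parrows /psrc /= -/(parrows r) -/(psrc r) -/(psrc q) -/(parrows q) e2.
  by rewrite take_size_cat // e1.
by rewrite drop_size_cat.
Qed.

Lemma arrows_ptake i p : parrows (ptake i p) = take i (parrows p).
Proof. by []. Qed.

Lemma arrows_pdrop i p : parrows (pdrop i p) = drop i (parrows p).
Proof. by []. Qed.

Lemma plen_ptake i p : (i <= plen p)%N -> plen (ptake i p) = i.
Proof. by move=> h; rewrite /plen arrows_ptake size_takel. Qed.

Lemma plen_pdrop i p : plen (pdrop i p) = (plen p - i)%N.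
Proof. by rewrite /plen arrows_pdrop size_drop. Qed.

Lemma ptake_ptake i j p : (i <= j)%N -> ptake i (ptake j p) = ptake i p.
Proof. by move=> h; apply: qpath_eq => //; rewrite !arrows_ptake take_takel. Qed.

Lemma ptake_plen p : ptake (plen p) p = p.
Proof. by apply: qpath_eq => //; rewrite arrows_ptake take_size. Qed.

Lemma pcomp_inj p q q' r : pcomp p q = Some r -> pcomp p q' = Some r -> q = q'.
Proof. by move=> /pcomp_pdrop -> /pcomp_pdrop ->. Qed.

Lemma pcomp_takedrop2 i j p : (i <= j)%N ->
  pcomp (ptake i p) (pdrop i (ptake j p)) = Some (ptake j p).
Proof. by move=> h; rewrite -(ptake_ptake p h) pcomp_takedrop. Qed.

Lemma ptgt_cat v (s1 s2 : seq (arrow Q)) :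
  last v (map (@qtgt Q) (s1 ++ s2)) = last (last v (map (@qtgt Q) s1)) (map (@qtgt Q) s2).
Proof. by rewrite map_cat last_cat. Qed.

Lemma drop_take_cat (T : Type) i j (s : seq T) : (i <= j)%N ->
  drop i s = drop i (take j s) ++ drop j s.
Proof.
have [h1|h1] := leqP (size s) j; first by rewrite take_oversize // [drop j s]drop_oversize // cats0.
rewrite leq_eqVlt => /orP[/eqP->|h].
  by rewrite [drop j (take _ _)]drop_oversize // size_takel // ltnW.
by rewrite -[in LHS](cat_take_drop j s) drop_cat size_takel ?h // ltnW.
Qed.

Lemma pcomp_dropdrop i j p : (i <= j)%N ->
  pcomp (pdrop i (ptake j p)) (pdrop j p) = Some (pdrop i p).
Proof.
move=> h; have e : take i (take j (parrows p)) = take i (parrows p) by rewrite take_takel.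
apply/pcompP; split.
- by rewrite /ptgt /psrc /parrows /= -ptgt_cat cat_take_drop.
- by rewrite /psrc /parrows /= e.
- by rewrite !arrows_pdrop arrows_ptake -drop_take_cat.
Qed.

End Subpaths.

Lemma prefix_drop_take (T : eqType) i j k (s : seq T) : (k <= j)%N ->
  prefix (drop i (take k s)) (drop i (take j s)).
Proof.
move=> h; have [hi|hi] := leqP i k.
  by rewrite -(take_takel _ h) -(subnK hi) -take_drop prefix_take.
by rewrite drop_oversize ?prefix0s // size_take; case: ifP; lia.
Qed.

Lemma suffix_suffix_le (T : eqType) (s1 s2 s : seq T) :
  suffix s1 s -> suffix s2 s -> (size s1 <= size s2)%N -> suffix s1 s2.
Proof.
move=> /suffixP[t1 e1] /suffixP[t2 e2] h; rewrite suffixE.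
have sz := congr1 size e1; rewrite e2 !size_cat in sz.
have : drop (size t1) s = s1 by rewrite e1 drop_size_cat.
rewrite e2 drop_cat; case: ifP => h1; first by lia.
by move=> e; apply/eqP; rewrite -[RHS]e; congr drop; lia.
Qed.

(** Used at a minimal [k], where it turns an occurrence into one that ends exactly at [k]. *)
Lemma infix_drop_take (T : eqType) (x s : seq T) i k : (i <= k <= size s)%N ->
  infix x (drop i (take k s)) -> suffix x (drop i (take k s)) \/
  exists k', (k' < k)%N /\ infix x (drop i (take k' s)).
Proof.
move=> h /infixP[s1 [s2 e]]; have sz := congr1 size e.
rewrite !size_cat size_drop size_takel // in sz; last by lia.
have [/size0nil s20|s2n] := posnP (size s2).
  by left; rewrite e s20 cats0 suffix_suffix.
right; exists (size (s1 ++ x) + i)%N; rewrite size_cat; split; first by lia.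
rewrite -take_drop -size_cat.
have -> : take (size (s1 ++ x)) (drop i s) = s1 ++ x.
  have h1 : (size (s1 ++ x) + i <= k)%N by rewrite size_cat; lia.
  rewrite take_drop -(take_takel _ h1) -take_drop e catA take_size_cat //.
exact: suffixW (suffix_suffix _ _).
Qed.

Lemma suffix_drop_take (T : eqType) (x s : seq T) i j k :
  (i <= j)%N -> (k <= size s)%N -> (size x <= k - j)%N ->
  suffix x (drop i (take k s)) -> infix x (drop j s).
Proof.
move=> hij hk hx sx; have sj : suffix (drop j (take k s)) (drop i (take k s)).
  by rewrite -(subnK hij) -drop_drop suffix_drop.
apply: infix_trans (suffixW (suffix_suffix_le sx sj _)) _.
  by rewrite size_drop size_takel.
by rewrite -{2}[s]take_size; apply/prefixW/prefix_drop_take.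
Qed.

Lemma plen_infix_drop (Q : quiver) (q R : qpath Q) i :
  infix (parrows q) (drop i (parrows R)) -> (plen q <= plen R - i)%N.
Proof. by move=> h; rewrite -plen_pdrop; apply: size_subseq; apply: infixW. Qed.

(** * Associated paths described by cut positions *)

Section Associated.
Variables (Q : quiver) (R2 : set (qpath Q)).
Implicit Types (p q r P R : qpath Q) (s : seq (arrow Q)).

Definition hasrel s : Prop := exists2 q, R2 q & infix (parrows q) s.

Lemma hasrel_infix s1 s2 : infix s1 s2 -> hasrel s1 -> hasrel s2.
Proof. by move=> h [q Rq h']; exists q => //; apply: infix_trans h' h. Qed.

(** Two cut positions replace the paths quantified in [Rset]: [i] and [j] end the prefixes in
    R^(n+1) and R^(n+2), and the overlap occupies the arrows from [i] on. The bound [j < k] is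
    strict because an overlap has [1 <= plen u]. *)
Lemma RsetSSS n R : Rset R2 n.+3 R <-> exists i j,
  [/\ (i <= j < plen R)%N, Rset R2 n.+2 (ptake j R), Rset R2 n.+1 (ptake i R),
      (exists q, [/\ R2 q, suffix (parrows q) (drop i (parrows R)) & (plen R - j < plen q)%N])
    & forall k, (j < k < plen R)%N -> forall q, R2 q ->
        suffix (parrows q) (drop i (take k (parrows R))) -> (plen q <= k - j)%N].
Proof.
split.
- case=> R' [R'' [p [u [w [[HR' cR'] [HR'' cR''] cw [q Rq [u' [v [c1 c2 h]]]] min]]]]].
  have l1 := pcomp_len cR'; have l2 := pcomp_len cR''; have l3 := pcomp_len cw.
  have eu := pcomp_inj cw c1; subst u'.
  have eR' := pcomp_ptake cR'; have eR'' := pcomp_ptake cR''.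
  have ew : parrows w = drop (plen R'') (parrows R).
    case/pcompP: (cR') => _ _ ->; case/pcompP: (cR'') => _ _ ->; case/pcompP: (cw) => _ _ ->.
    by rewrite -catA drop_size_cat.
  exists (plen R''), (plen R'); split.
  + by lia.
  + by rewrite -eR'.
  + by rewrite eR' ptake_ptake ?plen_ptake in eR''; rewrite -?eR'' //; lia.
  + exists q; split => //; last by lia.
    by rewrite -ew; case/pcompP: c2 => _ _ ->; apply: suffix_suffix.
  + move=> k hk q' Rq' suf; rewrite leqNgt; apply/negP => hq'.
    pose w' := ptake (k - plen R'')%N w.
    have ew' : parrows w' = drop (plen R'') (take k (parrows R)).
      by rewrite arrows_ptake ew take_drop subnK //; lia.
    have pw : parrows w = parrows p ++ parrows u by case/pcompP: cw.
    apply: (min w').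
      exists (pdrop (k - plen R'')%N w); split; last exact: pcomp_takedrop.
      by rewrite plen_pdrop; lia.
    exists q' => //; have lw' : plen w' = (k - plen R'')%N by rewrite plen_ptake //; lia.
    exists (pdrop (plen p) w'), (ptake (plen w' - plen q')%N w'); split.
    * have := pcomp_takedrop (plen p) w'; rewrite {1}/w' ptake_ptake; last by lia.
      by rewrite -(pcomp_ptake cw).
    * have := pcomp_takedrop (plen w' - plen q')%N w'.
      suff -> : pdrop (plen w' - plen q')%N w' = q' by [].
      apply/esym/qpath_eq_arrows; last by lia.
      by move: suf; rewrite -ew' suffixE => /eqP <-.
    * by rewrite plen_pdrop lw'; lia.
- case=> i [j [hij HRj HRi [q [Rq suf hq]] min]].
  exists (ptake j R), (ptake i R), (pdrop i (ptake j R)), (pdrop j R), (pdrop i R).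
  have leqw : (plen q <= plen (pdrop i R))%N by apply: size_subseq; exact: infixW (suffixW suf).
  split.
  + by split => //; apply: pcomp_takedrop.
  + by split => //; apply: pcomp_takedrop2; lia.
  + by apply: pcomp_dropdrop; lia.
  + exists q => //; exists (pdrop j R), (ptake (plen (pdrop i R) - plen q)%N (pdrop i R)); split.
    * by apply: pcomp_dropdrop; lia.
    * have := pcomp_takedrop (plen (pdrop i R) - plen q)%N (pdrop i R).
      suff -> : pdrop (plen (pdrop i R) - plen q)%N (pdrop i R) = q by [].
      apply/esym/qpath_eq_arrows; last by lia.
      by move: suf; rewrite suffixE => /eqP <-.
    * by rewrite plen_pdrop; lia.
  + move=> w' [z [hz cz]] [q' Rq' [u [v [c1 c2 h]]]].
    have l1 := pcomp_len cz; have l2 := pcomp_len c1; have l3 := pcomp_len c2.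
    rewrite !plen_pdrop plen_ptake in l1 l2; last by lia.
    have ew' : parrows w' = drop i (take (plen w' + i)%N (parrows R)).
      by rewrite -take_drop; case/pcompP: cz => _ _; rewrite arrows_pdrop => ->; rewrite take_size_cat.
    have suf' : suffix (parrows q') (drop i (take (plen w' + i)%N (parrows R))).
      by rewrite -ew'; case/pcompP: c2 => _ _ ->; apply: suffix_suffix.
    have := min (plen w' + i)%N _ q' Rq' suf'; lia.
Qed.

Hypothesis R2len : forall q, R2 q -> (2 <= plen q)%N.
Hypothesis R2anti : forall q q', R2 q -> R2 q' ->
  infix (parrows q) (parrows q') -> q = q'.

(** By induction the two elements share their prefixes in R^(n-1) and R^(n-2), so the relation
    ending the shorter one would violate the minimality of the longer one. *)
Lemma Rset_anti n P k l : (k <= plen P)%N -> (l <= plen P)%N ->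
  Rset R2 n (ptake k P) -> Rset R2 n (ptake l P) -> k = l.
Proof.
have [m] := ubnP n; elim: m n P k l => // m IH n P k l hm.
wlog: k l / (k <= l)%N => [hw | hkl].
  by case/orP: (leq_total k l) => h h1 h2 h3 h4; [|apply/esym]; apply: hw.
move=> hk hl.
case: n hm => [|[|[|n]]] hm.
- by rewrite /= !plen_ptake // => -> ->.
- by rewrite /= !plen_ptake // => -> ->.
- rewrite /= => H1 H2; have := R2anti H1 H2; rewrite !arrows_ptake.
  rewrite -(take_takel _ hkl) infix_take => /(_ isT) /(congr1 (@plen Q)).
  by rewrite !plen_ptake.
- move=> /RsetSSS [i [j [hij Hj Hi [q [Rq suf hq]] min]]].
  move=> /RsetSSS [i' [j' [hij' Hj' Hi' _ min']]].
  rewrite plen_ptake // in hij hq; rewrite plen_ptake // in hij'.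
  rewrite ptake_ptake in Hj; last by lia.
  rewrite ptake_ptake in Hi; last by lia.
  rewrite ptake_ptake in Hj'; last by lia.
  rewrite ptake_ptake in Hi'; last by lia.
  rewrite plen_ptake // in min'.
  have ej : j = j' by apply: (IH n.+2 P) => //; lia.
  have ei : i = i' by apply: (IH n.+1 P) => //; lia.
  subst j' i'; apply/eqP; rewrite eqn_leq hkl /= leqNgt; apply/negP => hlt.
  have := min' k _ q Rq; rewrite arrows_ptake take_takel; last by lia.
  by move: suf; rewrite arrows_ptake => suf /(_ _ suf); lia.
Qed.

Lemma Rset_prefix_eq n R R' p p' P : Rset R2 n R -> Rset R2 n R' ->
  pcomp R p = Some P -> pcomp R' p' = Some P -> R = R' /\ p = p'.
Proof.
move=> H H' c c'; have l := pcomp_len c; have l' := pcomp_len c'.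
have e := pcomp_ptake c; have e' := pcomp_ptake c'.
suff E : R = R' by split=> //; subst R'; apply: pcomp_inj c c'.
rewrite e e' in H H' *; congr (ptake _ _); apply: (Rset_anti _ _ H H'); lia.
Qed.

(** For [n > 0] the last factor is a proper suffix of a relation, and no relation contains
    another. *)
Lemma Rset_step n R : Rset R2 n.+1 R -> exists i,
  [/\ (i < plen R)%N, Rset R2 n (ptake i R) & ~ hasrel (drop i (parrows R))].
Proof.
case: n => [|[|n]].
- move=> H; have h : plen R = 1%N := H.
  exists 0%N; rewrite h; split=> //; first by rewrite /= plen_ptake.
  case=> q /R2len hq /plen_infix_drop; lia.
- move=> H; have h := R2len H; exists 1%N; split; first by lia.
    by rewrite /= plen_ptake //; lia.
  case=> q Rq hq; have e := R2anti Rq H (infix_trans hq (infix_drop _ _)); subst q.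
  by move/plen_infix_drop: hq; lia.
- move=> /RsetSSS [i [j [hij Hj Hi [q [Rq suf hq]] min]]].
  exists j; split => //; first by lia.
  case=> q' Rq' hq'.
  have hs : suffix (drop j (parrows R)) (parrows q).
    have sd : suffix (drop j (parrows R)) (drop i (parrows R)).
      by rewrite -(subnK (_ : i <= j)%N) -?drop_drop ?suffix_drop //; lia.
    apply: suffix_suffix_le sd suf _.
    by rewrite -arrows_pdrop -/(plen (pdrop j R)) plen_pdrop -/(plen q); lia.
  have e := R2anti Rq' Rq (infix_trans hq' (suffixW hs)); subst q'.
  by move/plen_infix_drop: hq'; lia.
Qed.

Lemma Rset_step2 n R : Rset R2 n.+2 R -> exists i j,
  [/\ (i <= j < plen R)%N, Rset R2 n (ptake i R), Rset R2 n.+1 (ptake j R)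
    & hasrel (drop i (parrows R))].
Proof.
case: n => [|n].
- move=> H; have h := R2len H; exists 0%N, 1%N; split; first by lia.
  + by rewrite /= plen_ptake.
  + by rewrite /= plen_ptake //; lia.
  + by rewrite drop0; exists R => //; apply: infix_refl.
- move=> /RsetSSS [i [j [hij Hj Hi [q [Rq suf hq]] min]]].
  by exists i, j; split => //; exists q => //; apply: suffixW.
Qed.

(** The combinatorial core of exactness: it supplies the next associated path inside [P]. Its end is
    the least [k] at which a relation starting at or after [i] is completed. *)
Lemma Rset_grow n P i j : (i <= j <= plen P)%N ->
  Rset R2 n (ptake i P) -> Rset R2 n.+1 (ptake j P) ->
  hasrel (drop i (parrows P)) -> ~ hasrel (drop j (parrows P)) ->
  exists k, (j < k <= plen P)%N /\ Rset R2 n.+2 (ptake k P).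
Proof.
move=> hij Hi Hj hi hj.
case: n Hi Hj => [|n] Hi Hj.
- move: Hi Hj; rewrite /= !plen_ptake; try by lia.
  move=> ei ej; subst i j; rewrite drop0 in hi.
  case: hi => q Rq hq; have hq2 := R2len Rq.
  have pre : prefix (parrows q) (parrows P).
    move: hq hj; case: (parrows P) => [|a s].
      by rewrite infixs0 => /eqP h; rewrite /plen h in hq2.
    rewrite drop1 infix_consl => /orP[//|h] []; by exists q.
  have lq : (plen q <= plen P)%N by exact: size_subseq (infixW (prefixW pre)).
  exists (plen q); split; first by lia.
  suff -> : ptake (plen q) P = q by [].
  apply/esym/qpath_eq_arrows; last by lia.
  by rewrite arrows_ptake; move: pre; rewrite prefixE => /eqP.
- have [i' [hi' Hi'' nr]] := Rset_step Hj.
  rewrite plen_ptake in hi'; last by lia.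
  (* The cut given by [Rset_step] is [i] itself, so [nr] says that the arrows between [i] and [j]
     contain no relation. *)
  have ei' : i' = i.
    apply: (Rset_anti _ _ _ Hi); [| |move: Hi''; rewrite ptake_ptake //]; lia.
  subst i'; rewrite arrows_ptake in nr.
  pose T k := `[< hasrel (drop i (take k (parrows P))) >].
  have exT : exists k, T k by exists (plen P); apply/asboolP; rewrite take_size.
  have [k /asboolP Tk mink] := ex_minnP exT.
  have hkP : (k <= plen P)%N by apply: mink; apply/asboolP; rewrite take_size.
  have hjk : (j < k)%N.
    rewrite ltnNge; apply/negP => h; apply: nr; apply: hasrel_infix Tk.
    exact: prefixW (prefix_drop_take _ _ h).
  exists k; split; first by lia.
  have [q Rq hq] := Tk.
  have suf : suffix (parrows q) (drop i (take k (parrows P))).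
    have [|//|[k' [hk' hq']]] := infix_drop_take _ hq; first by rewrite -/(plen P); lia.
    have Tk' : T k' by apply/asboolP; exists q.
    by have := mink _ Tk'; lia.
  apply/RsetSSS; exists i, j; rewrite plen_ptake //; split.
  + by lia.
  + by rewrite ptake_ptake //; lia.
  + by rewrite ptake_ptake //; lia.
  (* Were [q] no longer than [k - j], it would lie after [j], against [hj]. *)
  + exists q; split => //; rewrite ltnNge; apply/negP => h; apply: hj; exists q => //.
    by apply: (suffix_drop_take _ _ h suf) => //; lia.
  + move=> k' hk' q' Rq'; rewrite take_takel; last by lia.
    move=> /suffixW hq'; have : T k' by apply/asboolP; exists q'.
    by move/mink; lia.
Qed.

End Associated.

(** * Monomial ideals of path algebras *)

Section IdealGen.
Variable R : pzRingType.
Implicit Types S J : set R.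

Lemma ideal_gen_is_ideal S : is_ideal (ideal_gen S).
Proof.
split=> [J [] //|x y hx hy J HJ SJ|a x hx J HJ SJ|a x hx J HJ SJ]; have [_ h1 h2 h3] := HJ.
- by apply: h1; [apply: hx | apply: hy].
- by apply: h2; apply: hx.
- by apply: h3; apply: hx.
Qed.

Lemma sub_ideal_gen S : S `<=` ideal_gen S.
Proof. by move=> x Sx J _; apply. Qed.

Lemma ideal_gen_min S J : is_ideal J -> S `<=` J -> ideal_gen S `<=` J.
Proof. by move=> HJ SJ x; apply. Qed.

Lemma ideal_sum J (T : Type) (r : seq T) (P : pred T) (F : T -> R) :
  is_ideal J -> (forall i, P i -> J (F i)) -> J (\sum_(i <- r | P i) F i).
Proof. by case=> J0 JD _ _ H; apply: big_ind. Qed.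

Lemma idealN J x : is_ideal J -> J x -> J (- x).
Proof. by case=> _ _ h _ Jx; rewrite -mulN1r; apply: h. Qed.

Lemma idealB J x y : is_ideal J -> J x -> J y -> J (x - y).
Proof. by move=> HJ Jx Jy; case: (HJ) => _ h _ _; apply: h => //; apply: idealN. Qed.

End IdealGen.

Section PathAlgebraBasis.
Variables (K : fieldType) (Q : quiver).
Local Notation KQ := (path_alg K Q).
Implicit Types (x y : KQ) (p q r w : qpath Q).

Lemma mtermM (c c' : K) p q :
  (mterm c p : KQ) * (mterm c' q : KQ) = term_mul (c * c') p q.
Proof. exact: palg_mulUU. Qed.

Lemma mterm_pcomp (c c' : K) p q w : pcomp p q = Some w ->
  (mterm c p : KQ) * (mterm c' q : KQ) = mterm (c * c') w.
Proof. by rewrite mtermM /term_mul => ->. Qed.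

Lemma pbasisM p q w : pcomp p q = Some w -> pbasis K p * pbasis K q = pbasis K w.
Proof. by move=> h; rewrite /pbasis (mterm_pcomp _ _ h) mulr1. Qed.

Lemma mcoeff_pbasis p q : (pbasis K p)@_q = (p == q)%:R.
Proof. by rewrite mcoeff_mterm. Qed.

Lemma mcoeff_pbasis_neq0 p q : (pbasis K p)@_q != 0 -> p = q.
Proof. by rewrite mcoeff_pbasis; have [//|_] := eqVneq p q; rewrite eqxx. Qed.

Lemma pbasis_inj : injective (@pbasis K Q).
Proof.
move=> p q /(congr1 (fun x : KQ => x@_p)); rewrite !mcoeff_pbasis eqxx.
by case: eqP => // _ /eqP; rewrite oner_eq0.
Qed.

Lemma malg_mterm x : x = \sum_(p <- msupp x) (mterm x@_p p : KQ).
Proof. by rewrite [LHS]monalgE; apply: eq_bigr => p _; rewrite mterm.unlock. Qed.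

Lemma mcoeff_pbasisM p q w y : pcomp p q = Some w -> (pbasis K p * y)@_w = y@_q.
Proof.
move=> h; elim/palg_ind: y => [|x y IHx IHy|c r].
- by rewrite mulr0 !mcoeff0.
- by rewrite mulrDr !mcoeffD IHx IHy.
- rewrite mtermM /term_mul mul1r; case E: (pcomp p r) => [w'|].
    rewrite !mcoeff_mterm; congr (_ *+ _); congr nat_of_bool.
    apply/eqP/eqP => [e|e]; first by apply: pcomp_inj h; rewrite -e.
    by move: E; rewrite e h => -[].
  rewrite mcoeff0 mcoeff_mterm; case: eqP => // e.
  by rewrite e h in E.
Qed.

Definition palg_filter (P : pred (qpath Q)) x : KQ :=
  \sum_(p <- msupp x | P p) (mterm x@_p p : KQ).

Lemma mcoeff_filter P x p : (palg_filter P x)@_p = if P p then x@_p else 0.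
Proof.
rewrite /palg_filter raddf_sum /=.
have [Pp|nPp] := boolP (P p); last first.
  rewrite big1 // => q Pq; rewrite mcoeff_mterm; case: eqP => // e.
  by rewrite -e Pq in nPp.
have [px|npx] := boolP (p \in msupp x); last first.
  rewrite (mcoeff_outdom npx) big1_seq // => q /andP[_ qx]; rewrite mcoeff_mterm.
  by case: eqP => // e; rewrite -e qx in npx.
rewrite (big_rem p) //= Pp mcoeff_mterm eqxx mulr1n big1_seq ?addr0 // => q /andP[_].
rewrite mem_rem_uniq ?fset_uniq // inE => /andP[nqp _].
by rewrite mcoeff_mterm (negPf nqp).
Qed.

Lemma psrc_mull v y q : (pbasis K (vpath v) * y)@_q != 0 -> psrc q = v.
Proof.
case/palg_mul_supp => p [r [hp _ /pcompP[_ -> _]]].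
by rewrite -(mcoeff_pbasis_neq0 hp).
Qed.

Lemma palg_1E : 1 = \sum_(v : vert Q) pbasis K (vpath v) :> KQ.
Proof. by []. Qed.

Lemma is_ideal_supp (P : set (qpath Q)) :
  (forall p q w, pcomp p q = Some w -> P p \/ P q -> P w) ->
  is_ideal [set x : KQ | forall p, x@_p != 0 -> P p].
Proof.
move=> HP; split.
- by move=> p; rewrite mcoeff0 eqxx.
- move=> x y Hx Hy p; rewrite mcoeffD => nz; case: (eqVneq x@_p 0) => [x0|/Hx //].
  by apply: Hy; move: nz; rewrite x0 add0r.
- by move=> a x Hx r /palg_mul_supp[p [q [_ /Hx Hq /HP]]]; apply; right.
- by move=> a x Hx r /palg_mul_supp[p [q [/Hx Hp _ /HP]]]; apply; left.
Qed.

End PathAlgebraBasis.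

Section MonomialIdeal.
Variables (K : fieldType) (Q : quiver) (I : set (path_alg K Q)).
Variable R2 : set (qpath Q).
Local Notation KQ := (path_alg K Q).

Lemma infix_pcomp3 (q p : qpath Q) : (0 < plen q)%N -> infix (parrows q) (parrows p) ->
  exists a b c, pcomp a q = Some b /\ pcomp b c = Some p.
Proof.
move=> hq /infixP[s1 [s2 e]].
pose i := size s1; pose j := (i + plen q)%N.
have eq : q = pdrop i (ptake j p).
  apply: qpath_eq_arrows => //; rewrite arrows_pdrop arrows_ptake e catA.
  by rewrite take_size_cat ?size_cat // drop_size_cat.
exists (ptake i p), (ptake j p), (pdrop j p); split; last exact: pcomp_takedrop.
by rewrite {1}eq; apply: pcomp_takedrop2; rewrite /j; lia.
Qed.

Lemma arrow_ideal_pos (x : KQ) : arrow_ideal x -> forall p, x@_p != 0 -> (1 <= plen p)%N.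
Proof.
apply: (ideal_gen_min (is_ideal_supp _ _)) => [p q w /pcomp_len ->|].
  by case; lia.
move=> _ [p hp <-] q; move=> /mcoeff_pbasis_neq0 <-.
by rewrite hp.
Qed.

Lemma arrow_ideal2_len (x : KQ) : ideal_pow (@arrow_ideal K Q) 2 x ->
  forall p, x@_p != 0 -> (2 <= plen p)%N.
Proof.
apply: (ideal_gen_min (is_ideal_supp _ _)) => [p q w /pcomp_len ->|].
  by case; lia.
move=> _ [y [hy ->]] r; rewrite big_ord_recl big_ord1.
case/palg_mul_supp => p [q [hp hq /pcomp_len ->]].
by have := arrow_ideal_pos (hy _) hp; have := arrow_ideal_pos (hy _) hq; lia.
Qed.

Lemma admissible_len q : admissible I -> image R2 (@pbasis K Q) `<=` I ->
  R2 q -> (2 <= plen q)%N.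
Proof.
case=> m _ [_ h] RI Rq; apply: (@arrow_ideal2_len (pbasis K q)).
  by apply: h; apply: RI; exists q.
by rewrite mcoeff_pbasis eqxx oner_eq0.
Qed.

Hypothesis R2len : forall q, R2 q -> (2 <= plen q)%N.

Lemma ideal_gen_hasrel p (c : K) (J : set KQ) :
  is_ideal J -> image R2 (@pbasis K Q) `<=` J -> hasrel R2 (parrows p) -> J (mterm c p).
Proof.
move=> [_ _ Jl Jr] RJ [q Rq /infix_pcomp3[|a [b [d [h1 h2]]]]].
  by have := R2len Rq; lia.
have -> : (mterm c p : KQ) = (mterm c a : KQ) * pbasis K q * pbasis K d.
  by rewrite /pbasis (mterm_pcomp _ _ h1) (mterm_pcomp _ _ h2) !mulr1.
by apply: Jr; apply: Jl; apply: RJ; exists q.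
Qed.

Lemma monomial_idealE : ideal_gen (image R2 (@pbasis K Q)) = I ->
  forall x, I x <-> forall p, x@_p != 0 -> hasrel R2 (parrows p).
Proof.
move=> <- x; split=> [|H].
  apply: (ideal_gen_min (is_ideal_supp _ _)) => [p q w /pcompP[_ _ ->]|].
    by case; apply: hasrel_infix; [apply: prefix_infix | apply: suffix_infix].
  move=> _ [q Rq <-] p; move=> /mcoeff_pbasis_neq0 <-.
  by exists q => //; apply: infix_refl.
rewrite [x]malg_mterm big_seq; apply: ideal_sum => [|p px].
  exact: ideal_gen_is_ideal.
apply: ideal_gen_hasrel; [exact: ideal_gen_is_ideal | exact: sub_ideal_gen|].
by apply: H; rewrite mcoeff_neq0.
Qed.

(** A relation containing another one lies in the ideal generated by the rest, so it could be
    dropped from the generating set. *)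
Lemma minimal_anti q q' :
  minimal_generating_set (image R2 (@pbasis K Q)) I ->
  R2 q -> R2 q' -> infix (parrows q) (parrows q') -> q = q'.
Proof.
move=> [genI minI] Rq Rq' hqq'; apply: contrapT => ne.
pose S := image (R2 `\ q') (@pbasis K Q).
have SR : S `<=` image R2 (@pbasis K Q) by move=> _ [r [Rr _] <-]; exists r.
have : S = image R2 (@pbasis K Q).
  apply: minI => //; rewrite -genI; apply/seteqP; split; apply: ideal_gen_min;
    try exact: ideal_gen_is_ideal.
    by move=> x /SR; apply: sub_ideal_gen.
  move=> _ [r Rr <-]; have [->|nr] := eqVneq r q'; last first.
    by apply: sub_ideal_gen; exists r => //; split => //; apply/eqP.
  have [|a [b [d [h1 h2]]]] := infix_pcomp3 _ hqq'; first by have := R2len Rq; lia.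
  rewrite -(pbasisM K h2) -(pbasisM K h1).
  have [_ _ Jl Jr] := ideal_gen_is_ideal S.
  by apply: Jr; apply: Jl; apply: sub_ideal_gen; exists q.
move=> e; have : (image R2 (@pbasis K Q)) (pbasis K q') by exists q'.
by rewrite -e => -[r [_ nr] /pbasis_inj].
Qed.

End MonomialIdeal.

(** * Bardzell's resolution *)

Section Resolution.
Variables (K : fieldType) (Q : quiver) (I : ideal (path_alg K Q)).
Variable R2 : set (qpath Q).
Local Notation KQ := (path_alg K Q).
Local Notation Lam := (quotring I).
Local Notation Pn := (Pn I R2).
Local Notation e_ v := (pclass I (vpath v)).
Implicit Types (R S T P p q u w : qpath Q) (l : Lam) (n i j k : nat).

Lemma Pn_valD_coeff n (x y : Pn n) R : (Pn_val (x + y))@_R = (Pn_val x)@_R + (Pn_val y)@_R.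
Proof. by rewrite Pn_valD mcoeffD. Qed.

Lemma Pn_val0 n R : (Pn_val (0 : Pn n))@_R = 0.
Proof. by rewrite -(scale0r (0 : Pn n)) Pn_valZ mulr0. Qed.

Lemma Pn_val_sum n (J : Type) (r : seq J) (P : pred J) (F : J -> Pn n) R :
  (Pn_val (\sum_(i <- r | P i) F i))@_R = \sum_(i <- r | P i) (Pn_val (F i))@_R.
Proof.
apply: (big_morph (fun x : Pn n => (Pn_val x)@_R)) => [x y|]; first exact: Pn_valD_coeff.
exact: Pn_val0.
Qed.

Lemma Pn_supp n (x : Pn n) R : R \in msupp (Pn_val x) -> Rset R2 n R.
Proof. by move=> xR; apply: (proj1 (Pn_valP x)); rewrite mcoeff_neq0. Qed.

Fact gen_subproof n R l : Rset R2 n R -> mterm (e_ (ptgt R) * l) R \in in_Pn R2 n.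
Proof.
move=> HR; apply/asboolP; split=> S; rewrite mcoeff_mterm.
  by case: (R =P S) => [<- //|_]; rewrite mulr0n eqxx.
case: (R =P S) => [<-|_]; last by rewrite mulr0n mulr0.
by rewrite mulr1n mulrA pclassM pcomp1p eqxx.
Qed.

(* The element t(R) l of P^n; it is 0 unless R is in R^n. *)
Definition gen n R l : Pn n :=
  if pselect (Rset R2 n R) is left h then MkPn (gen_subproof l h) else 0.

Lemma gen_coeff n R l S : Rset R2 n R ->
  (Pn_val (gen n R l))@_S = (e_ (ptgt R) * l) *+ (R == S).
Proof. by rewrite /gen; case: pselect => // h _; rewrite mcoeff_mterm. Qed.

Lemma gen_out n R l : ~ Rset R2 n R -> gen n R l = 0.
Proof. by rewrite /gen; case: pselect. Qed.

Lemma genD n R l l' : gen n R (l + l') = gen n R l + gen n R l'.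
Proof.
rewrite /gen; case: pselect => h; last by rewrite addr0.
by apply: Pn_eqP => S; rewrite Pn_valD_coeff !mcoeff_mterm mulrDr mulrnDl.
Qed.

Lemma gen0 n R : gen n R 0 = 0.
Proof. by apply: (addrI (gen n R 0)); rewrite -genD !addr0. Qed.

Lemma gen_sum n R (J : Type) (r : seq J) (F : J -> Lam) :
  gen n R (\sum_(i <- r) F i) = \sum_(i <- r) gen n R (F i).
Proof. by apply: big_morph => [l l'|]; rewrite ?genD ?gen0. Qed.

Lemma gen_scale n R l l' : (l' : Lam^c) *: gen n R l = gen n R (l * l').
Proof.
rewrite /gen; case: pselect => h; last by rewrite scaler0.
by apply: Pn_eqP => S; rewrite Pn_valZ !mcoeff_mterm; case: eqP => _;
  rewrite ?mulr1n ?mulr0n ?mul0r // mulrA.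
Qed.

Lemma Pn_gen_sum n (x : Pn n) : x = \sum_(R <- msupp (Pn_val x)) gen n R (Pn_val x)@_R.
Proof.
apply: Pn_eqP => S; rewrite Pn_val_sum.
have [xS|nxS] := boolP (S \in msupp (Pn_val x)); last first.
  rewrite (mcoeff_outdom nxS) big1_seq // => R /andP[_ xR].
  rewrite gen_coeff; last exact: Pn_supp xR.
  by case: eqP => // e; rewrite -e xR in nxS.
rewrite (big_rem S) //= gen_coeff; last exact: Pn_supp xS.
rewrite eqxx mulr1n (proj2 (Pn_valP x)) big1_seq ?addr0 // => R /andP[_].
rewrite mem_rem_uniq ?fset_uniq // inE => /andP[nRS xR].
by rewrite gen_coeff; [rewrite (negPf nRS) | exact: Pn_supp xR].
Qed.

Section LinearExtension.
Variables (n : nat) (M : lmodType Lam^c) (m : qpath Q -> M).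

(** P^n need not be free on R^n, but its coefficients satisfy [t(R) x_R = x_R], so [m] may be
    arbitrary: only [m R . t(R)] matters. *)
Definition Pn_ext (x : Pn n) : M :=
  \sum_(R <- msupp (Pn_val x)) ((Pn_val x)@_R : Lam^c) *: m R.

Lemma Pn_extEw (d : {fset qpath Q}) (x : Pn n) : (msupp (Pn_val x) `<=` d)%fset ->
  Pn_ext x = \sum_(R <- d) ((Pn_val x)@_R : Lam^c) *: m R.
Proof.
move=> s; apply: (big_fset_incl _ s) => R _ /mcoeff_outdom ->.
by rewrite (scale0r (m R)).
Qed.

Fact Pn_ext_is_linear : linear Pn_ext.
Proof.
move=> a x y.
pose d := (msupp (Pn_val x) `|` msupp (Pn_val y) `|` msupp (Pn_val (a *: x + y)%R))%fset.
rewrite !(@Pn_extEw d) ?fsubsetUr //; last 2 first.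
- by apply/fsubsetP => k; rewrite !in_fsetU => ->; rewrite orbT.
- by apply/fsubsetP => k; rewrite !in_fsetU => ->.
rewrite scaler_sumr -big_split; apply: eq_bigr => R _ /=.
rewrite mcoeffD Pn_scale_rawE scalerA -(scalerDl (m R)).
by [].
Qed.
HB.instance Definition _ :=
  GRing.isLinear.Build Lam^c (Pn n) M _ Pn_ext Pn_ext_is_linear.

Lemma Pn_ext_gen R l : Rset R2 n R ->
  Pn_ext (gen n R l) = ((e_ (ptgt R) * l) : Lam^c) *: m R.
Proof.
move=> HR; rewrite (@Pn_extEw [fset R]%fset).
  by rewrite big_seq_fset1 gen_coeff // eqxx mulr1n.
apply/fsubsetP => S; rewrite -mcoeff_neq0 gen_coeff // inE.
by case: (R =P S) => [->|_]; rewrite ?eqxx.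
Qed.

End LinearExtension.

Lemma Pn_linear_ext n (M : lmodType Lam^c) (f g : {linear Pn n -> M}) :
  (forall R, Rset R2 n R -> f (gen n R 1) = g (gen n R 1)) -> forall x, f x = g x.
Proof.
move=> H x; rewrite (Pn_gen_sum x) !raddf_sum; apply: eq_big_seq => R xR /=.
rewrite -[_@_R]mul1r -gen_scale !linearZ /= H //; exact: Pn_supp xR.
Qed.

(** Stronger than projectivity: [g] only has to hit the image of [f]. The homotopies below are
    lifted through differentials, which need not be onto. *)
Lemma Pn_lift n (M N : lmodType Lam^c) (f : {linear Pn n -> N}) (g : {linear M -> N}) :
  (forall x, exists y, g y = f x) ->
  exists h : {linear Pn n -> M}, forall x, g (h x) = f x.
Proof.
move=> H; pose m R : M := projT1 (cid (H (gen n R 1))).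
have mE R : g (m R) = f (gen n R 1) by rewrite /m; case: cid.
exists (Pn_ext m : {linear _ -> _}) => x; rewrite [in RHS](Pn_gen_sum x).
rewrite /= /Pn_ext !raddf_sum; apply: eq_bigr => R _ /=.
by rewrite linearZ /= mE -[in RHS](mul1r (_@_R)) -gen_scale linearZ.
Qed.

Lemma Pn_projective n : projective (Pn n : lmodType Lam^c).
Proof. by move=> M N g f H; apply: Pn_lift => x; apply: H. Qed.

End Resolution.

(** * Exactness, path by path *)

Section Exactness.
Variables (K : fieldType) (Q : quiver) (I : ideal (path_alg K Q)).
Variable R2 : set (qpath Q).
Local Notation KQ := (path_alg K Q).
Local Notation Lam := (quotring I).
Local Notation Pn := (Pn I R2).
Local Notation e_ v := (pclass I (vpath v)).
Local Notation gen := (@gen K Q I R2).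
Implicit Types (R S T P p q u w : qpath Q) (l : Lam) (n i j k : nat).

Hypothesis IE : forall x, ideal_set I x <-> forall p, x@_p != 0 -> hasrel R2 (parrows p).
Hypothesis R2len : forall q, R2 q -> (2 <= plen q)%N.
Hypothesis R2anti : forall q q', R2 q -> R2 q' ->
  infix (parrows q) (parrows q') -> q = q'.

Lemma qpi0P (x : KQ) : qpi I x = 0 <-> ideal_set I x.
Proof. by rewrite -(raddf0 (qpi I)) qpi_eqP subr0. Qed.

Lemma hasrel_len (s : seq (arrow Q)) : hasrel R2 s -> (2 <= size s)%N.
Proof. by case=> q /R2len h /infixW/size_subseq; apply: leq_trans. Qed.

Lemma pclass_eq0 p : hasrel R2 (parrows p) -> pclass I p = 0.
Proof. by move=> h; apply/qpi0P/IE => q /mcoeff_pbasis_neq0 <-. Qed.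

Lemma pclass_tgt p : pclass I p * e_ (ptgt p) = pclass I p.
Proof. by rewrite pclassM pcompp1 eqxx. Qed.

Lemma pclass_src p : e_ (psrc p) * pclass I p = pclass I p.
Proof. by rewrite pclassM pcomp1p eqxx. Qed.

Lemma Rset_split n R : Rset R2 n.+1 R -> exists R' p,
  [/\ Rset R2 n R', pcomp R' p = Some R, (0 < plen p)%N & ~ hasrel R2 (parrows p)].
Proof.
move=> /(Rset_step R2len R2anti)[i [h1 h2 h3]]; exists (ptake i R), (pdrop i R).
by split=> //; [apply: pcomp_takedrop | rewrite plen_pdrop; lia].
Qed.

(** Uniqueness of prefixes in R^n forces the choice made in [Rsplit]. *)
Lemma Rsplit_eq n R R' p : Rset R2 n R' -> pcomp R' p = Some R ->
  Rsplit R2 n R = Some (R', p).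
Proof.
move=> HR' c; case E: (Rsplit R2 n R) => [z|]; last first.
  by move: E; rewrite /Rsplit; case: pselect => // -[]; exists (R', p).
have [Hz cz] := RsplitP E; have [e1 e2] := Rset_prefix_eq R2anti HR' Hz c cz.
by rewrite e1 e2; case: z {E Hz cz e1 e2}.
Qed.

Lemma dn_gen n R R' p l : Rset R2 n.+1 R -> Rset R2 n R' -> pcomp R' p = Some R ->
  dn (gen n.+1 R l) = gen n R' (pclass I p * l).
Proof.
move=> HR HR' c; apply: Pn_eqP => S; rewrite gen_coeff //.
rewrite -[Pn_val (dn _)]/(d_raw R2 n (Pn_val (gen n.+1 R l))).
have tR := pcomp_tgt c; have /pcompP[sp _ _] := c.
rewrite (@d_rawEw _ _ _ _ n [fset R]%fset); last first.
  apply/fsubsetP => T; rewrite -mcoeff_neq0 gen_coeff // inE.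
  by case: (R =P T) => [->|_]; rewrite ?eqxx.
rewrite big_seq_fset1 gen_coeff // eqxx mulr1n /dterm (Rsplit_eq HR' c) mcoeff_mterm.
by rewrite !mulrA tR pclass_tgt sp pclass_src.
Qed.

Lemma dn_gen_sum n (x : Pn n.+1) :
  dn x = \sum_(R <- msupp (Pn_val x)) dn (gen n.+1 R (Pn_val x)@_R).
Proof. by rewrite {1}(Pn_gen_sum x) raddf_sum. Qed.

Lemma dn_rad n (x : Pn n.+1) : mul_span (setT : set (Pn n)) (@rad_set K Q I) (dn x).
Proof.
have H R : exists z : Lam * Pn n, R \in msupp (Pn_val x) ->
    rad_set z.1 /\ dn (gen n.+1 R (Pn_val x)@_R) = (z.1 : Lam^c) *: z.2.
  have [/Pn_supp HR|_] := boolP (R \in msupp (Pn_val x)); last by exists (0, 0).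
  have [R' [p [HR' c hp _]]] := Rset_split HR.
  exists (pclass I p * (Pn_val x)@_R, gen n R' 1) => _.
  rewrite (dn_gen _ HR HR' c) gen_scale mul1r; split => //.
  have [_ _ _ hr] := @rad_is_ideal K Q I; apply: hr; exists (pbasis K p) => //.
  by move=> q /mcoeff_pbasis_neq0 <-.
have [f Hf] := boolp.choice H.
exists [seq f R | R <- msupp (Pn_val x)].
  by move=> _ /mapP[R hR ->]; split => //; have [] := Hf R hR.
rewrite big_map dn_gen_sum; apply: eq_big_seq => R hR.
by have [_] := Hf R hR.
Qed.

Lemma rad_span0 (M : lmodType Lam^c) (f : {linear M -> Lam0 I}) y :
  mul_span setT (@rad_set K Q I) y -> f y = 0.
Proof.
case=> s hs ->; rewrite raddf_sum big_seq big1 // => z /hs[hz _].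
rewrite /= linearZ /= -[RHS](mulr0 (f z.2)); congr (_ * _).
by apply/eqP; rewrite -(raddf0 (qpi (rad I))); apply/eqP/qpi_eqP; rewrite subr0.
Qed.

Lemma dn_dn n (x : Pn n.+2) : dn (dn x) = 0.
Proof.
rewrite (dn_gen_sum x) raddf_sum big_seq big1 // => R /Pn_supp HR /=.
have [i [j [hij Hi Hj rel]]] := Rset_step2 R2len HR.
have c : pcomp (ptake i R) (pdrop i (ptake j R)) = Some (ptake j R).
  by apply: pcomp_takedrop2; lia.
rewrite (dn_gen _ HR Hj (pcomp_takedrop j R)) (dn_gen _ Hj Hi c).
rewrite mulrA pclassM pcomp_dropdrop /=; last by lia.
by rewrite pclass_eq0 ?mul0r ?gen0.
Qed.

Lemma augn_gen S l : Rset R2 0 S -> augn (gen 0%N S l) = qpi (rad I) (e_ (ptgt S) * l).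
Proof.
move=> HS; have eS : S = vpath (psrc S) by apply: qpath_eq => //; apply: size0nil.
rewrite /augn (bigD1 (psrc S)) //= -eS {1}/fn gen_coeff // eqxx mulr1n big1 ?addr0 //.
move=> v nv; rewrite /fn gen_coeff //; case: eqP => [e|_].
  by rewrite e /psrc /= eqxx in nv.
by rewrite mulr0n raddf0.
Qed.

Lemma augn_dn (x : Pn 1) : augn (dn x) = 0.
Proof. exact: (rad_span0 _ (dn_rad x)). Qed.

(** On representatives supported on paths without relations, a nonzero coefficient cannot be
    absorbed by [I]; exactness is proved by comparing such coefficients. *)
Lemma pclass_normal v l : e_ v * l = l -> exists y,
  l = qpi I y /\ forall q, y@_q != 0 -> psrc q = v /\ ~ hasrel R2 (parrows q).
Proof.
move=> el; pose z := pbasis K (vpath v) * qrepr l.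
have lz : l = qpi I z by rewrite rmorphM /= qreprK.
exists (palg_filter (fun q => ~~ `[< hasrel R2 (parrows q) >]) z); split.
  rewrite lz; apply/qpi_eqP/IE => q; rewrite mcoeffB mcoeff_filter.
  by case: asboolP => //= _; rewrite subrr eqxx.
move=> q; rewrite mcoeff_filter; case: asboolP => [_|h] /=; first by rewrite eqxx.
by move/psrc_mull.
Qed.

Lemma gen_boundary n R q P k (c : K) : Rset R2 n R -> pcomp R q = Some P ->
  (plen R < k <= plen P)%N -> Rset R2 n.+1 (ptake k P) ->
  exists z, gen n R (qpi I (mterm c q)) = dn z.
Proof.
move=> HR cRq hk HT; exists (gen n.+1 (ptake k P) (qpi I (mterm c (pdrop k P)))).
have eR := pcomp_ptake cRq; have eq := pcomp_pdrop cRq.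
rewrite (dn_gen _ HT (R' := R) (p := pdrop (plen R) (ptake k P))) //; last first.
  by rewrite [X in pcomp X]eR; apply: pcomp_takedrop2; lia.
rewrite /pclass -rmorphM /= /pbasis (@mterm_pcomp _ _ 1 c _ _ q) ?mul1r //.
by rewrite [in RHS]eq; apply: pcomp_dropdrop; lia.
Qed.

Lemma gen_qpi n R (y : KQ) :
  gen n R (qpi I y) = \sum_(q <- msupp y) gen n R (qpi I (mterm y@_q q)).
Proof. by rewrite {1}(malg_mterm y) raddf_sum gen_sum. Qed.

Lemma boundary_sum n (J : eqType) (r : seq J) (F : J -> Pn n) :
  (forall j0 : J, j0 \in r -> exists z, F j0 = dn z) ->
  exists z, \sum_(j0 <- r) F j0 = dn z.
Proof.
move=> H; rewrite big_seq; apply: (big_ind (fun x : Pn n => exists z, x = dn z)) => //.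
- by exists 0; rewrite raddf0.
- by move=> _ _ [z ->] [z' ->]; exists (z + z'); rewrite raddfD.
Qed.

Lemma Pn_normal n (x : Pn n) : exists y : qpath Q -> KQ, forall R,
  (Pn_val x)@_R = qpi I (y R) /\
  forall q, (y R)@_q != 0 -> psrc q = ptgt R /\ ~ hasrel R2 (parrows q).
Proof.
have H R := pclass_normal (proj2 (Pn_valP x) R).
by exists (fun R => projT1 (cid (H R))) => R; case: cid.
Qed.

(** Each term is bounded separately: [t(R) q] is a boundary as soon as [R q] has a prefix in R^(n+1)
    longer than [R]. *)
Lemma cycle_boundary n (x : Pn n) (y : qpath Q -> KQ) :
  (forall R, (Pn_val x)@_R = qpi I (y R)) ->
  (forall R q, Rset R2 n R -> (y R)@_q != 0 -> exists P k,
     [/\ pcomp R q = Some P, (plen R < k <= plen P)%N & Rset R2 n.+1 (ptake k P)]) ->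
  exists z, x = dn z.
Proof.
move=> ye H; rewrite (Pn_gen_sum x); apply: boundary_sum => R /Pn_supp HR.
rewrite ye gen_qpi; apply: boundary_sum => q; rewrite -mcoeff_neq0 => hq.
have [P [k [h1 h2 h3]]] := H R q HR hq; exact: gen_boundary h1 h2 h3.
Qed.

Lemma exact_augn (x : Pn 0) : augn x = 0 -> exists z, x = dn z.
Proof.
move=> ax; have [y Hy] := Pn_normal x; apply: (@cycle_boundary _ _ y) => [R|R q HR hq].
  by case: (Hy R).
have [_ /(_ _ hq)[sq nr]] := Hy R.
have eR : R = vpath (psrc R) by apply: qpath_eq => //; apply: size0nil.
have tR : ptgt R = psrc R by rewrite {1}eR.
have [q0|q0] := posnP (plen q); last first.
  exists q, 1%N; split; first by rewrite {1}eR pcomp1p sq tR eqxx.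
    by have -> : plen R = 0%N := HR; rewrite q0.
  by rewrite /= plen_ptake.
(* For trivial [q]: [augn x = 0] puts the class of the sum of the [y (vpath v)] in the radical, but
   the coefficient of this sum at [q] is the nonzero one of [y R]. *)
have [z hz] : rad_set (qpi I (\sum_v y (vpath v))).
  have := ax; rewrite /augn; under eq_bigr do rewrite /fn (proj1 (Hy _)).
  rewrite -raddf_sum => /eqP; rewrite -(raddf0 (qpi (rad I))) => /eqP/qpi_eqP.
  by rewrite subr0 raddf_sum.
move=> /esym/qpi_eqP/IE e.
have sumq : (\sum_v y (vpath v))@_q = (y R)@_q.
  rewrite raddf_sum /= (bigD1 (psrc R)) //= -eR big1 ?addr0 // => v nv.
  apply/eqP; apply: contraNT nv => /(proj2 (Hy _))[]; rewrite sq tR => e' _.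
  by apply/eqP.
have : hasrel R2 (parrows q).
  apply: e; rewrite mcoeffB sumq; have [->|/hz] := eqVneq (z@_q) 0.
    by rewrite subr0.
  by rewrite q0.
by move/hasrel_len; rewrite -/(plen q) q0.
Qed.

(** For a path [q] in the coefficient at [R = S p], the path [w = p q] must contain a relation:
    otherwise this term alone contributes to [t(S) w] in [dn x], because [S w] has only one prefix
    in R^(n+1). [Rset_grow] then gives the longer prefix. *)
Lemma exact_dn n (x : Pn n.+1) : dn x = 0 -> exists z, x = dn z.
Proof.
move=> dx; have [y Hy] := Pn_normal x; apply: (@cycle_boundary _ _ y) => [R|R q HR hq].
  by case: (Hy R).
have [_ /(_ _ hq)[sq nr]] := Hy R.
have [S [p [HS c hp nrp]]] := Rset_split HR.
have [P cP] := pcomp_ex (esym sq); have [w cw] : exists w, pcomp p q = Some w.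
  by apply: pcomp_ex; rewrite -(pcomp_tgt c).
have cSw : pcomp S w = Some P by have := pcompA S p q; rewrite c cw /= cP => ->.
have eR := pcomp_ptake cP; have eq := pcomp_pdrop cP; have ew := pcomp_pdrop cSw.
have eS := pcomp_ptake cSw.
have lR := pcomp_len cP; have lS := pcomp_len c.
suff hw : hasrel R2 (parrows w).
  have [k [hk HT]] : exists k, (plen R < k <= plen P)%N /\ Rset R2 n.+2 (ptake k P).
    apply: (Rset_grow R2len R2anti (i := plen S)).
    - by lia.
    - by rewrite -eS.
    - by rewrite -eR.
    - by rewrite -arrows_pdrop -ew.
    - by rewrite -arrows_pdrop -eq.
  by exists P, k.
have nRx : R \in msupp (Pn_val x).
  rewrite -mcoeff_neq0 (proj1 (Hy R)); apply/negP => /eqP/qpi0P/IE/(_ q hq).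
  exact: nr.
(* A representative in KQ of what [R'] contributes to the coefficient of [dn x] at [S]; it is 0 if
   [S] is not a prefix of [R']. *)
pose F R' : KQ := if pselect (exists p', pcomp S p' = Some R') is left h
  then pbasis K (projT1 (cid h)) * y R' else 0.
have : (Pn_val (dn x))@_S = qpi I (\sum_(R' <- msupp (Pn_val x)) F R').
  rewrite dn_gen_sum Pn_val_sum raddf_sum; apply: eq_big_seq => R' /Pn_supp HR'.
  have [S' [p' [HS' c' _ _]]] := Rset_split HR'.
  rewrite (dn_gen _ HR' HS' c') gen_coeff // /F.
  case: pselect => [h|nh]; last first.
    case: eqP => [e|_]; last by rewrite mulr0n raddf0.
    by case: nh; exists p'; rewrite -e.
  case: cid => p'' /= cp''.
  have [e1 e2] := Rset_prefix_eq R2anti HS HS' cp'' c'.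
  rewrite -e1 -e2 eqxx mulr1n mulrA rmorphM /= (proj1 (Hy _)); congr (_ * _).
  by have /pcompP[-> _ _] := cp''; rewrite pclass_src.
rewrite dx Pn_val0 => /esym/qpi0P/IE; apply.
rewrite raddf_sum /= (big_rem R) //= big1_seq ?addr0.
  rewrite /F; case: pselect => [h|[]]; last by exists p.
  case: cid => p' /= cp'; rewrite (pcomp_inj cp' c).
  by rewrite (mcoeff_pbasisM _ cw).
move=> R' /andP[_]; rewrite mem_rem_uniq ?fset_uniq // inE => /andP[nR' /Pn_supp HR'].
rewrite /F; case: pselect => [h|_]; last by rewrite mcoeff0.
case: cid => p' /= cp'; apply/eqP; apply: contraNT nR' => /palg_mul_supp.
case=> p1 [q' [/mcoeff_pbasis_neq0 <- _ cw']].
have cP' : pcomp R' q' = Some P by have := pcompA S p' q'; rewrite cp' cw' /= cSw.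
by have [-> _] := Rset_prefix_eq R2anti HR HR' cP cP'.
Qed.

End Exactness.

(** * The length grading of the resolution *)

Section Grading.
Variables (K : fieldType) (Q : quiver) (I : ideal (path_alg K Q)).
Variable R2 : set (qpath Q).
Local Notation KQ := (path_alg K Q).
Local Notation Lam := (quotring I).
Local Notation Pn := (Pn I R2).
Local Notation e_ v := (pclass I (vpath v)).
Local Notation gen := (@gen K Q I R2).
Implicit Types (R S T P p q u w : qpath Q) (l : Lam) (n i j k : nat).

Hypothesis IE : forall x, ideal_set I x <-> forall p, x@_p != 0 -> hasrel R2 (parrows p).
Hypothesis R2len : forall q, R2 q -> (2 <= plen q)%N.
Hypothesis R2anti : forall q q', R2 q -> R2 q' ->
  infix (parrows q) (parrows q') -> q = q'.

(** The generator [t(R)] is placed in degree [plen R], which makes [dn] homogeneous of degree 0. *)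
Definition Pdeg n i : set (Pn n) :=
  [set x | forall R, exists2 y : KQ, (Pn_val x)@_R = qpi I y &
             forall p, y@_p != 0 -> (plen R + plen p)%N = i].

Lemma Pdeg0 n i : Pdeg i (0 : Pn n).
Proof.
move=> R; exists 0; first by rewrite Pn_val0 raddf0.
by move=> p; rewrite mcoeff0 eqxx.
Qed.

Lemma PdegB n i (x y : Pn n) : Pdeg i x -> Pdeg i y -> Pdeg i (x - y).
Proof.
move=> Hx Hy R; have [a ea ha] := Hx R; have [b eb hb] := Hy R.
exists (a - b).
  rewrite -scaleN1r Pn_valD_coeff Pn_valZ ea eb raddfB /=.
  by rewrite [_ * (-1)](_ : _ = - qpi I b) // mulrN1.
move=> p; rewrite mcoeffB; have [->|/ha //] := eqVneq (a@_p) 0.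
by rewrite sub0r oppr_eq0 => /hb.
Qed.

Lemma PdegD n i (x y : Pn n) : Pdeg i x -> Pdeg i y -> Pdeg i (x + y).
Proof.
move=> Hx Hy; rewrite -[y]opprK -[- y]sub0r.
by apply: PdegB => //; apply: PdegB => //; apply: Pdeg0.
Qed.

Lemma Pdeg_sum n i (J : eqType) (r : seq J) (F : J -> Pn n) :
  (forall z, z \in r -> Pdeg i (F z)) -> Pdeg i (\sum_(z <- r) F z).
Proof.
move=> H; rewrite big_seq; apply: big_ind => //; first exact: Pdeg0.
by move=> x y; apply: PdegD.
Qed.

Lemma Pdeg_gen n i R (y : KQ) :
  (forall p, y@_p != 0 -> (plen R + plen p)%N = i) -> Pdeg i (gen n R (qpi I y)).
Proof.
move=> H; have [HR|nHR] := pselect (Rset R2 n R); last first.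
  by rewrite gen_out //; apply: Pdeg0.
move=> S; rewrite gen_coeff //; case: (R =P S) => [<-|_]; last first.
  by exists 0 => [|p]; rewrite ?mcoeff0 ?eqxx // mulr0n raddf0.
exists (pbasis K (vpath (ptgt R)) * y); first by rewrite mulr1n rmorphM.
move=> p /palg_mul_supp[q [r [/mcoeff_pbasis_neq0 <- hr /pcomp_len ->]]].
by rewrite (H _ hr).
Qed.

Lemma Pdeg_scale n i j l (x : Pn n) :
  Lam_deg j l -> Pdeg i x -> Pdeg (i + j) ((l : Lam^c) *: x).
Proof.
move=> [z hz <-] Hx R; have [y ey hy] := Hx R.
exists (y * z); first by rewrite Pn_valZ ey rmorphM.
by move=> p /palg_mul_supp[q [r [/hy hq /hz hr /pcomp_len ->]]]; lia.
Qed.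

Lemma Pdeg_decomp n (x : Pn n) : exists N, exists2 c : nat -> Pn n,
  forall i, Pdeg i (c i) & x = \sum_(i < N) c i.
Proof.
(* Asking for the equality at every large [N'] lets two decompositions be added over a common
   bound. *)
pose dec (x : Pn n) := exists c : nat -> Pn n, (forall i, Pdeg i (c i)) /\
  exists N, forall N', (N <= N')%N -> x = \sum_(i < N') c i.
suff [c [hc [N hN]]] : dec x by exists N, c => //; apply: hN.
have dec0 : dec 0.
  exists (fun=> 0); split=> [i|]; first exact: Pdeg0.
  by exists 0%N => N' _; rewrite big1.
have decD a b : dec a -> dec b -> dec (a + b).
  move=> [c [hc [N hN]]] [d [hd [M hM]]]; exists (fun i => c i + d i).
  split=> [i|]; first by apply: PdegD.
  exists (maxn N M) => N' hN'; rewrite big_split /=.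
  by rewrite -hN -?hM //; lia.
rewrite (Pn_gen_sum x); apply: big_ind => // R _.
rewrite -[_@_R]qreprK gen_qpi; apply: big_ind => // p _.
set y := mterm _ p.
exists (fun i => if i == (plen R + plen p)%N then gen n R (qpi I y) else 0).
split=> [i|].
  case: eqP => [->|_]; last exact: Pdeg0.
  apply: Pdeg_gen => q; rewrite mcoeff_mterm; have [<- //|_] := eqVneq p q.
  by rewrite mulr0n eqxx.
exists (plen R + plen p).+1 => N' hN'.
rewrite (bigD1 (Ordinal hN')) //= eqxx big1 ?addr0 // => i /eqP ni.
by case: eqP => // e; case: ni; apply: val_inj.
Qed.

(** Different degrees have representatives with disjoint supports, and membership in [I] is decided
    path by path. *)
Lemma Pdeg_indep n N (c : nat -> Pn n) : (forall i, Pdeg i (c i)) ->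
  \sum_(i < N) c i = 0 -> forall i, (i < N)%N -> c i = 0.
Proof.
move=> hc c0 i hi; apply: Pn_eqP => R; rewrite Pn_val0.
have H j : exists y : KQ, (Pn_val (c j))@_R = qpi I y /\
    forall p, y@_p != 0 -> (plen R + plen p)%N = j.
  by have [y h1 h2] := hc j R; exists y.
have [y Hy] := boolp.choice H.
have : qpi I (\sum_(j < N) y j) = 0.
  transitivity (\sum_(j < N) (Pn_val (c j))@_R).
    by rewrite raddf_sum; apply: eq_bigr => j _; have [-> _] := Hy j.
  by rewrite -Pn_val_sum c0 Pn_val0.
move=> /qpi0P/IE e; have [-> hy] := Hy i; apply/qpi0P/IE => p hp; apply: e.
rewrite raddf_sum /= (bigD1 (Ordinal hi)) //= big1 ?addr0 // => j nj.
apply/eqP; apply: contraNT nj => /(proj2 (Hy _)); rewrite (hy _ hp) => e.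
by apply/eqP/val_inj.
Qed.

Lemma Pdeg_grading n : is_grading (@Pdeg n : nat -> set (Pn n : lmodType Lam^c)).
Proof.
split.
- by move=> i; split; [apply: Pdeg0 | move=> x y; apply: PdegB].
- by move=> i j l x; apply: Pdeg_scale.
- exact: Pdeg_decomp.
- exact: Pdeg_indep.
Qed.

Lemma Pdeg_dn n i (x : Pn n.+1) : Pdeg i x -> Pdeg i (dn x).
Proof.
move=> Hx; rewrite dn_gen_sum; apply: Pdeg_sum => R /Pn_supp HR.
have [R' [p [HR' c hp _]]] := Rset_split R2len R2anti HR.
rewrite (dn_gen R2anti _ HR HR' c); have [y -> hy] := Hx R.
rewrite /pclass -rmorphM; apply: Pdeg_gen => r.
case/palg_mul_supp => p' [q [/mcoeff_pbasis_neq0 <- /hy <- /pcomp_len ->]].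
by rewrite (pcomp_len c) addnA.
Qed.

Lemma Pdeg_augn i (x : Pn 0) : (0 < i)%N -> Pdeg i x -> augn x = 0.
Proof.
move=> hi Hx; rewrite /augn big1 // => v _; rewrite /fn.
have [y -> hy] := Hx (vpath v).
apply/eqP; rewrite -(raddf0 (qpi (rad I))); apply/eqP/qpi_eqP; rewrite subr0.
by exists y => // p /hy h; move: hi; rewrite -h.
Qed.

Lemma augn_surj (z : Lam0 I) : exists x : Pn 0, augn x = z.
Proof.
rewrite -[z]qreprK; move: (qrepr z) => l.
exists (\sum_v gen 0%N (vpath v) l); rewrite raddf_sum /=.
under eq_bigr do rewrite augn_gen //.
rewrite -raddf_sum -mulr_suml; congr qpi.
rewrite -[RHS]mul1r; congr (_ * _).
by rewrite -(rmorph1 (qpi I)) palg_1E raddf_sum.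
Qed.

Lemma bardzell_minimal :
  @minimal_graded_projective_resolution K Q I (bardzell I R2) (@Pdeg).
Proof.
split.
- split.
  + exact: augn_surj.
  + move=> x; split; first exact: exact_augn.
    by move=> [z ->]; apply: augn_dn.
  + move=> n x; split; first exact: exact_dn.
    by move=> [z ->]; apply: dn_dn.
- by move=> n; split; [apply: Pn_projective | apply: Pdeg_grading].
- by split; [exact: Pdeg_dn | exact: Pdeg_augn].
- by move=> n x; apply: dn_rad.
Qed.

(** If [plen R] were not the generating degree, the coefficient [e_ (ptgt R)] of [t(R)] would have a
    representative without the trivial path. That path would then contain a relation, but relations
    have length at least 2. *)
Lemma Rset_plen D A n R : stacked I D A -> Rset R2 n R -> plen R = delta D A n.
Proof.
move=> /(_ _ _ bardzell_minimal n) gend HR.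
have : mul_span (Pdeg (delta D A n)) setT (gen n R 1) by rewrite gend.
case=> s hs /(congr1 (fun x : Pn n => (Pn_val x)@_R)).
rewrite gen_coeff // eqxx mulr1n mulr1 Pn_val_sum => e.
apply: contrapT => ne.
have H (z : Lam * Pn n) : z \in s -> exists2 y : KQ,
    (Pn_val ((z.1 : Lam^c) *: z.2))@_R = qpi I y & y@_(vpath (ptgt R)) = 0.
  move=> /hs[_ /(_ R)[y ey hy]]; exists (y * qrepr z.1).
    by rewrite Pn_valZ ey rmorphM /= qreprK.
  apply/eqP/negP => /negP/palg_mul_supp[p [q [/hy hp _ /pcomp_len]]].
  by rewrite /plen /= -/(plen p) -/(plen q) => h; apply: ne; rewrite -hp; lia.
have [y ey y0] : exists2 y : KQ, e_ (ptgt R) = qpi I y & y@_(vpath (ptgt R)) = 0.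
  rewrite e big_seq; apply: (big_ind (fun l => exists2 y : KQ,
    l = qpi I y & y@_(vpath (ptgt R)) = 0)) => //.
    by exists 0; [rewrite raddf0 | rewrite mcoeff0].
  move=> _ _ [y -> y0] [y' -> y0']; exists (y + y'); first by rewrite raddfD.
  by rewrite mcoeffD y0 y0' addr0.
have /qpi_eqP/IE/(_ (vpath (ptgt R))) := ey.
rewrite mcoeffB y0 subr0 mcoeff_pbasis eqxx oner_eq0 => /(_ isT).
by move/(hasrel_len R2len).
Qed.

End Grading.

(** * Products in the Ext algebra *)

Section Products.
Variables (K : fieldType) (Q : quiver) (I : ideal (path_alg K Q)).
Variable R2 : set (qpath Q).
Local Notation KQ := (path_alg K Q).
Local Notation Lam := (quotring I).
Local Notation Pn := (Pn I R2).
Local Notation e_ v := (pclass I (vpath v)).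
Local Notation gen := (@gen K Q I R2).
Local Notation fn := (@fn K Q I R2).
Local Notation fnL n S := (@Defs.fn K Q I R2 n S : {linear Pn n -> Lam0 I}).
Implicit Types (R S T P p q u w : qpath Q) (l : Lam) (n i j k : nat).

Hypothesis IE : forall x, ideal_set I x <-> forall p, x@_p != 0 -> hasrel R2 (parrows p).
Hypothesis R2len : forall q, R2 q -> (2 <= plen q)%N.
Hypothesis R2anti : forall q q', R2 q -> R2 q' ->
  infix (parrows q) (parrows q') -> q = q'.

(** All differentials of Hom(P, Lam0) vanish, so a class in Ext is a single cochain and equality of
    classes is equality of maps. *)
Lemma lin_dn n (f : {linear Pn n -> Lam0 I}) (x : Pn n.+1) : f (dn x) = 0.
Proof. exact: (rad_span0 f (dn_rad R2len R2anti x)). Qed.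

(** * Independence of the lift *)

Section Uniqueness.
Variables (n : nat) (phi psi : forall k, {linear Pn (k + n)%N -> Pn k}).
Hypothesis aug_eq : forall x, augn (phi 0%N x) = augn (psi 0%N x).
Hypothesis phi_dn : forall k (x : Pn (k + n).+1), dn (phi k.+1 x) = phi k (dn x).
Hypothesis psi_dn : forall k (x : Pn (k + n).+1), dn (psi k.+1 x) = psi k (dn x).

(** The homotopy relation is kept only after applying [dn]: it then says that
    [phi k.+1 - psi k.+1 - h dn] is a cycle, and exactness yields the next [h]. Both [f] and
    [f \o h] vanish on boundaries, so [f] does not see the correction terms. *)
Lemma lift_homotopy k : exists h : {linear Pn (k + n)%N -> Pn k.+1},
  (forall x : Pn (k + n).+1,
    dn (phi k.+1 x) - dn (psi k.+1 x) = dn (h (dn x))) /\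
  (forall (f : {linear Pn k -> Lam0 I}) x, f (phi k x) = f (psi k x)).
Proof.
elim: k => [|k [h [Hh _]]].
  have [x|h Hh] := @Pn_lift _ _ I R2 n (Pn 1) (Pn 0) (phi 0%N \- psi 0%N) (@dn _ _ I R2 0).
    have [|z ez] := @exact_augn _ _ _ _ IE R2len R2anti (phi 0%N x - psi 0%N x);
      last by exists z; exact: (esym ez).
    by apply/eqP; rewrite raddfB subr_eq0; apply/eqP; apply: aug_eq.
  exists h; split=> [x|f x]; first by rewrite phi_dn psi_dn Hh.
  by apply/eqP; rewrite -subr_eq0 -raddfB -(lin_dn f (h x)) Hh.
pose g := (phi k.+1 \- psi k.+1) \- (h \o @dn _ _ I R2 (k + n)%N).
have gE y : g y = (phi k.+1 y - psi k.+1 y) - h (dn y) by [].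
have [x|h' Hh'] := @Pn_lift _ _ I R2 (k.+1 + n)%N (Pn k.+2) (Pn k.+1) g (@dn _ _ I R2 k.+1).
  have [|z ez] := @exact_dn _ _ _ _ IE R2len R2anti _ (g x); last by exists z; exact: (esym ez).
  by rewrite gE; apply/eqP; rewrite raddfB subr_eq0 raddfB; apply/eqP/Hh.
have Hg y : dn (h' y) = (phi k.+1 y - psi k.+1 y) - h (dn y) := Hh' y.
exists h'; split=> [x|f x].
  by rewrite Hg dn_dn // raddf0 subr0 phi_dn psi_dn.
have e1 : f (dn (h' x)) = 0 := lin_dn f (h' x).
have e2 : f (h (dn x)) = 0 := lin_dn (f \o h) x.
have -> : phi k.+1 x = psi k.+1 x + (h (dn x) + dn (h' x)).
  by rewrite Hg [_ - h _]addrC addNKr addrC subrK.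
have e3 : f (psi k.+1 x + (h (dn x) + dn (h' x))) =
    f (psi k.+1 x) + (f (h (dn x)) + f (dn (h' x))).
  by rewrite raddfD; congr (_ + _); apply: raddfD.
by rewrite e3 e1 e2 !addr0.
Qed.

End Uniqueness.

(** * The explicit lift of f^n_R and the products it computes *)

Section Lift.
Variables (n : nat) (R : qpath Q).
Hypothesis HR : Rset R2 n R.

Definition lift_split T S q : Prop :=
  exists2 p, pcomp R p = Some T & pcomp S q = Some p.

Definition lift_val k T : Pn k :=
  if pselect (exists z, Rset R2 k z.1 /\ lift_split T z.1 z.2) is left h
  then gen k (projT1 (cid h)).1 (pclass I (projT1 (cid h)).2) else 0.

Lemma lift_valE k T S q : Rset R2 k S -> lift_split T S q ->
  lift_val k T = gen k S (pclass I q).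
Proof.
move=> HS [p cp cS]; rewrite /lift_val; case: pselect => [h|[]]; last first.
  by exists (S, q); split => //; exists p.
case: cid => -[S' q'] /= [HS' [p' cp' cS']].
rewrite (pcomp_inj cp' cp) in cS'.
by have [-> ->] := Rset_prefix_eq R2anti HS' HS cS' cS.
Qed.

Lemma lift_val0 k T : (forall S q, Rset R2 k S -> ~ lift_split T S q) ->
  lift_val k T = 0.
Proof.
move=> H; rewrite /lift_val; case: pselect => // h.
by case: (h) => z [h1 h2]; case: (H _ _ h1 h2).
Qed.

Definition lift_map k : {linear Pn (k + n)%N -> Pn k} := Pn_ext (@lift_val k).

Lemma lift_map_gen k T l : Rset R2 (k + n) T ->
  lift_map k (gen (k + n) T l) = ((e_ (ptgt T) * l) : Lam^c) *: lift_val k T.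
Proof. exact: Pn_ext_gen. Qed.

Lemma lift_map_gen1 k T S q : Rset R2 (k + n) T -> Rset R2 k S -> lift_split T S q ->
  lift_map k (gen (k + n) T 1) = gen k S (pclass I q).
Proof.
move=> HT HS h; rewrite lift_map_gen // (lift_valE HS h) gen_scale mulr1.
by case: h => p /pcomp_tgt -> /pcomp_tgt ->; rewrite pclass_tgt.
Qed.

Lemma lift_map_gen0 k T : Rset R2 (k + n) T ->
  (forall S q, Rset R2 k S -> ~ lift_split T S q) -> lift_map k (gen (k + n) T 1) = 0.
Proof. by move=> HT h; rewrite lift_map_gen // lift_val0 // scaler0. Qed.

Lemma pcomp_vpath p : pcomp p (vpath (ptgt p)) = Some p.
Proof. by rewrite pcompp1 eqxx. Qed.

Lemma pcomp_len0 p q r : pcomp p q = Some r -> plen q = 0%N -> p = r /\ q = vpath (ptgt p).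
Proof.
move=> c q0; have /pcompP[e _ _] := c.
have eq : q = vpath (ptgt p) by apply: qpath_eq; [rewrite -e | apply: size0nil].
by split=> //; move: c; rewrite eq pcomp_vpath => -[].
Qed.

Lemma augn_lift (x : Pn n) : augn (lift_map 0 x) = fn R x.
Proof.
apply: (@Pn_linear_ext _ _ I R2 n (Lam0 I) (@augn K Q I R2 \o lift_map 0)
   (fnL n R)) => T HT.
rewrite -[LHS]/(augn (lift_map 0 (gen n T 1))) -[RHS]/(qpi (rad I) (Pn_val (gen n T 1))@_R).
rewrite gen_coeff // mulr1.
have [eT|nT] := eqVneq T R.
  subst T; rewrite mulr1n (@lift_map_gen1 0 R (vpath (ptgt R)) (vpath (ptgt R))) //.
    by rewrite augn_gen // pclass_src.
  by exists (vpath (ptgt R)); [rewrite pcomp_vpath | rewrite pcomp1p eqxx].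
rewrite mulr0n raddf0 lift_map_gen0 ?raddf0 // => S q HS [p cp _].
have [e _] := Rset_prefix_eq R2anti HR HT cp (pcomp_vpath T).
by rewrite e eqxx in nT.
Qed.

(** In the application [L] is [delta]. Superadditivity is asked only where R^(k+n) is inhabited,
    because for [delta] it rests on bounds such as [A < D], which are extracted from elements of R^3
    or R^4. *)
Variable L : nat -> nat.
Hypothesis HL : forall k S, Rset R2 k S -> plen S = L k.
Hypothesis L_superadd : forall k T, Rset R2 (k + n) T -> (L k + L n <= L (k + n))%N.

(* By superadditivity T1 is long enough to have the prefix R of T as a prefix. *)
Lemma Rset_prefix k T p T1 u : Rset R2 (k + n) T1 -> pcomp T1 u = Some T ->
  pcomp R p = Some T -> exists p1, pcomp R p1 = Some T1 /\ pcomp p1 u = Some p.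
Proof.
move=> HT1 c cR; have h : (plen R <= plen T1)%N.
  by rewrite (HL HR) (HL HT1); have := L_superadd HT1; lia.
exists (pdrop (plen R) T1); have eT1 := pcomp_ptake c.
have eR : R = ptake (plen R) T1 by rewrite eT1 ptake_ptake //; apply: pcomp_ptake cR.
split; first by rewrite {1}eR; apply: pcomp_takedrop.
by rewrite [in pdrop _ T1]eT1 (pcomp_pdrop c) (pcomp_pdrop cR) pcomp_dropdrop.
Qed.

(** Let [T = T1 u]. If [T = R S q] with [S = S' s], both sides are [t(S')] times [s q]. If there is
    no such [S], the left side is 0; when [T1 = R S' q1], the right side vanishes because [q1 u]
    contains a relation, as otherwise [S'] would extend to an element of R^(k+1) inside [T]. *)
Lemma lift_map_dn_gen k T : Rset R2 (k.+1 + n) T ->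
  dn (lift_map k.+1 (gen (k.+1 + n) T 1)) = lift_map k (dn (gen (k + n).+1 T 1)).
Proof.
move=> HT; have [T1 [u [HT1 cT hu nu]]] := Rset_split R2len R2anti (n := (k + n)%N) HT.
rewrite (dn_gen R2anti _ HT HT1 cT) mulr1.
have -> : lift_map k (gen (k + n) T1 (pclass I u)) =
    (pclass I u : Lam^c) *: lift_map k (gen (k + n) T1 1).
  by rewrite -[pclass I u]mul1r -gen_scale mul1r linearZ.
have lT := pcomp_len cT.
have [[S [q [HS h]]]|no1] := pselect (exists S q, Rset R2 k.+1 S /\ lift_split T S q).
  rewrite (lift_map_gen1 HT HS h); case: h => p cp cS.
  have [p1 [cp1 cu]] := Rset_prefix HT1 cT cp.
  have [S' [s [HS' cs hs ns]]] := Rset_split R2len R2anti HS.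
  rewrite (dn_gen R2anti _ HS HS' cs).
  have [w cw] : exists w, pcomp s q = Some w.
    by apply: pcomp_ex; case/pcompP: cS => <- _ _; rewrite (pcomp_tgt cs).
  have cS'w : pcomp S' w = Some p by have := pcompA S' s q; rewrite cs cw /= cS => ->.
  (* By superadditivity [R S'] is not longer than [T1]. *)
  have hS' : (plen S' <= plen p1)%N.
    have := pcomp_len cp1; rewrite (HL HS') (HL HR) (HL HT1); have := L_superadd HT1; lia.
  pose q1 := pdrop (plen S') p1.
  have cq1 : pcomp S' q1 = Some p1.
    rewrite {1}(_ : S' = ptake (plen S') p1) ?pcomp_takedrop // (pcomp_ptake cu) ptake_ptake //.
    exact: pcomp_ptake cS'w.
  rewrite (lift_map_gen1 HT1 HS' (q := q1)); last by exists p1.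
  rewrite gen_scale; congr gen; rewrite !pclassM cw.
  suff -> : pcomp q1 u = Some w by [].
  have [w' cw'] : exists w', pcomp q1 u = Some w'.
    by apply: pcomp_ex; case/pcompP: cu => <- _ _; rewrite (pcomp_tgt cq1).
  rewrite cw'; congr Some; apply: pcomp_inj cS'w.
  by have := pcompA S' q1 u; rewrite cq1 cw' /= cu => ->.
rewrite lift_map_gen0 ?raddf0 //; last first.
  by move=> S q HS h; apply: no1; exists S, q.
have [[S' [q1 [HS' [p1 cp1 cS']]]]|no2] :=
  pselect (exists S q, Rset R2 k S /\ lift_split T1 S q); last first.
  rewrite lift_map_gen0 ?scaler0 //.
  by move=> S q HS h; apply: no2; exists S, q.
rewrite (lift_map_gen1 HT1 HS' (q := q1)); last by exists p1.
rewrite gen_scale pclassM.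
have [w cw] : exists w, pcomp q1 u = Some w.
  by apply: pcomp_ex; rewrite -(pcomp_tgt cS') -(pcomp_tgt cp1); case/pcompP: cT.
rewrite cw /= (pclass_eq0 IE) ?gen0 //; apply: contrapT => nw.
have [p cp] : exists p, pcomp p1 u = Some p.
  by apply: pcomp_ex; rewrite -(pcomp_tgt cp1); case/pcompP: cT.
have cRp : pcomp R p = Some T by have := pcompA R p1 u; rewrite cp1 cp /= cT => ->.
have cS'w : pcomp S' w = Some p by have := pcompA S' q1 u; rewrite cS' cw /= cp => ->.
suff [i [hi Hi]] : exists i, (plen S' < i <= plen p)%N /\ Rset R2 k.+1 (ptake i p).
  apply: no1; exists (ptake i p), (pdrop i p); split => //.
  by exists p => //; apply: pcomp_takedrop.
have lp := pcomp_len cp; have lp1 := pcomp_len cp1; have lS' := pcomp_len cS'.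
have eS' := pcomp_ptake cS'w.
case: k {no1 eS'} (eS') HT HT1 HS' => [|k] eS' HT HT1 HS'.
  have S0 : plen S' = 0%N := HS'.
  by exists 1%N; split; [lia | rewrite /= plen_ptake //; lia].
have [m [j [hmj Hm Hj rel]]] := Rset_step2 R2len (n := (k + n)%N) HT.
have [i [hi Hi _]] := Rset_step R2len R2anti HS'.
apply: (Rset_grow R2len R2anti (i := i)) => //.
- by rewrite (pcomp_len cS'w); lia.
- by move: Hi; rewrite {1}eS' ptake_ptake //; lia.
- by rewrite -eS'.
- have -> : parrows p = drop (plen R) (parrows T).
    by case/pcompP: cRp => _ _ ->; rewrite drop_size_cat.
  rewrite drop_drop; apply: hasrel_infix rel.
  (* The relation from [Rset_step2] starts at [m = L (k + n)] or later, while [i = L k] and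
     [plen R = L n]: superadditivity again. *)
  have h : (i + plen R <= m)%N.
    have := HL Hi; have := HL Hm; rewrite !plen_ptake; try lia.
    by move=> -> ->; rewrite (HL HR); have := L_superadd Hm; lia.
  by rewrite -[m](subnK h) -drop_drop infix_drop.
- by rewrite -arrows_pdrop -(pcomp_pdrop cS'w).
Qed.

Lemma lift_map_dn k (x : Pn (k + n).+1) : dn (lift_map k.+1 x) = lift_map k (dn x).
Proof.
apply: (@Pn_linear_ext _ _ I R2 (k + n).+1 (Pn k) (@dn _ _ I R2 k \o lift_map k.+1)
  (lift_map k \o @dn _ _ I R2 (k + n)%N)) => T HT.
exact: lift_map_dn_gen.
Qed.

Lemma fn_lift_gen m S T : Rset R2 m S -> Rset R2 (m + n) T ->
  fn S (lift_map m (gen (m + n) T 1)) =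
  if pcomp R S == Some T then qpi (rad I) (e_ (ptgt T)) else 0.
Proof.
move=> HS HT; case: eqP => [c|nc].
  rewrite (lift_map_gen1 HT HS (q := vpath (ptgt S))); last first.
    by exists S => //; rewrite pcomp_vpath.
  by rewrite /Defs.fn gen_coeff // eqxx mulr1n (pcomp_tgt c) pclassM pcomp1p eqxx.
have [[S' [q [HS' h]]]|no] := pselect (exists S q, Rset R2 m S /\ lift_split T S q); last first.
  rewrite lift_map_gen0 ?raddf0 // => S' q HS' h; apply: no; exists S', q; split => //.
rewrite (lift_map_gen1 HT HS' h) /Defs.fn gen_coeff //.
case: eqP => [e|_]; last by rewrite mulr0n raddf0.
(* Here [S' = S] while [T] is not [R S], so [q] is nontrivial and [t(S) q] goes to 0 in [Lam0]. *)
have hq : (0 < plen q)%N.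
  rewrite lt0n; apply/eqP => q0; case: h => p cp cq; apply: nc.
  by have [e' _] := pcomp_len0 cq q0; rewrite -e e'.
apply/eqP; rewrite -(raddf0 (qpi (rad I))); apply/eqP/qpi_eqP; rewrite subr0 mulr1n.
have [_ _ hl _] := @rad_is_ideal K Q I; apply: hl; exists (pbasis K q) => //.
by move=> r /mcoeff_pbasis_neq0 <-.
Qed.

Lemma fn_lift m S (x : Pn (m + n)) : Rset R2 m S ->
  fn S (lift_map m x) =
  if pcomp R S is Some T then
    if `[< Rset R2 (m + n) T >] then fn T x else 0
  else 0.
Proof.
move=> HS.
have H (f : {linear Pn (m + n) -> Lam0 I}) : (forall T, Rset R2 (m + n) T ->
    fn S (lift_map m (gen (m + n) T 1)) = f (gen (m + n) T 1)) ->
    fn S (lift_map m x) = f x.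
  move=> hT; apply: (@Pn_linear_ext _ _ I R2 (m + n)%N (Lam0 I)
    (fnL m S \o lift_map m) f) => T HT.
  exact: hT.
have H0 : (forall T, Rset R2 (m + n) T -> pcomp R S <> Some T) ->
    fn S (lift_map m x) = 0.
  move=> no; pose z : {linear Pn (m + n) -> Lam0 I} := Pn_ext (fun=> 0).
  have Z y : z y = 0 by rewrite /z /= /Pn_ext big1 // => ? _; rewrite scaler0.
  rewrite (H z) ?Z // => T HT; rewrite fn_lift_gen // Z.
  by case: eqP => [/(no _ HT)//|_].
case c : (pcomp R S) => [W|]; last by apply: H0 => T _; rewrite c.
case: asboolP => [HW|nW]; last by apply: H0 => T HT; rewrite c => -[e]; apply: nW; rewrite e.
apply: (H (fnL (m + n)%N W)) => T HT.
rewrite fn_lift_gen // c -[RHS]/(qpi (rad I) (Pn_val (gen (m + n) T 1))@_W).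
rewrite gen_coeff // mulr1 eq_sym -[Some T == Some W]/(T == W).
by case: eqP => [->|_]; rewrite ?mulr1n ?mulr0n ?raddf0.
Qed.

Lemma bardzell_coboundary0 m (h : Pn m -> Lam0 I) :
  @coboundary K Q I (bardzell I R2) m h <-> forall x, h x = 0.
Proof.
case: m h => [//|m] h; split=> [[g hg] x|h0].
  by rewrite hg; apply: lin_dn.
exists (Pn_ext (fun=> 0) : {linear Pn m -> Lam0 I}) => x.
by rewrite h0 /= /Pn_ext big1 // => ? _; rewrite scaler0.
Qed.

(** Independence of the lift gives one inclusion, its existence the other. The path is [R S], in the
    order opposite to that of the product. *)
Lemma fmulE m S : Rset R2 m S ->
  @fmul Q R2 K I m n S R = [set h | forall x : Pn (m + n), h x =
    if pcomp R S is Some T then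
      if `[< Rset R2 (m + n) T >] then fn T x else 0
    else 0].
Proof.
move=> HS; apply/seteqP; split=> h.
  case=> phi [ap dp] /bardzell_coboundary0 hb x.
  have /eqP := hb x; rewrite subr_eq0 => /eqP ->; rewrite -fn_lift //.
  have [|||g [_ hg]] := @lift_homotopy n phi lift_map _ _ _ m.
  - by move=> y; rewrite augn_lift; apply: ap.
  - by move=> k y; apply: dp.
  - exact: lift_map_dn.
  - exact: (hg (fnL m S)).
move=> hx; exists lift_map.
  by split; [apply: augn_lift | move=> k x; apply: lift_map_dn].
by apply/bardzell_coboundary0 => x; rewrite hx fn_lift // subrr.
Qed.

Lemma fn_neq0 m W : Rset R2 m W -> fn W (gen m W 1) <> 0.
Proof.
move=> HW; rewrite -[fn W _]/(qpi (rad I) (Pn_val (gen m W 1))@_W) gen_coeff // eqxx mulr1n mulr1.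
rewrite -(raddf0 (qpi (rad I))) => /qpi_eqP; rewrite subr0 => -[x hx /qpi_eqP/IE h].
have := h (vpath (ptgt W)); rewrite mcoeffB mcoeff_pbasis eqxx.
have -> : x@_(vpath (ptgt W)) = 0.
  by apply/eqP/negP => /negP/hx.
by rewrite sub0r oppr_eq0 oner_eq0 => /(_ isT)/(hasrel_len R2len).
Qed.

Lemma fn_gen0 m W T : T <> W -> fn W (gen m T 1) = 0.
Proof.
move=> ne; have [HT|nT] := pselect (Rset R2 m T); last by rewrite gen_out // raddf0.
rewrite -[fn W _]/(qpi (rad I) (Pn_val (gen m T 1))@_W) gen_coeff //.
by move/eqP/negPf: ne => ->; rewrite mulr0n raddf0.
Qed.

Lemma ext0E m : @ext0 Q R2 K I m = [set h | forall x : Pn m, h x = 0].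
Proof. by apply/seteqP; split=> h /bardzell_coboundary0. Qed.

Lemma fmul_eq0 m S : Rset R2 m S -> @fmul Q R2 K I m n S R = @ext0 Q R2 K I (m + n)
  <-> ~ exists2 T, pcomp R S = Some T & Rset R2 (m + n) T.
Proof.
move=> HS; rewrite fmulE // ext0E; split=> [e [T c HT]|no].
  have /seteqP[_ /(_ (fun=> 0) (fun=> erefl)) /(_ (gen (m + n) T 1))] := e.
  by rewrite c; case: asboolP => // _ /esym; apply: fn_neq0.
have E x : (if pcomp R S is Some T then
      if `[< Rset R2 (m + n) T >] then @Defs.fn K Q I R2 (m + n) T x else 0 else 0) = 0.
  by case c: (pcomp R S) => [T|] //; case: asboolP => // HT; case: no; exists T.
by apply/seteqP; split=> h hx x; have := hx x; rewrite E.
Qed.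

Lemma fmul_val m S T : Rset R2 m S -> pcomp R S = Some T -> Rset R2 (m + n) T ->
  @fmul Q R2 K I m n S R = [set h | forall x : Pn (m + n), h x = fn T x].
Proof. by move=> HS c HT; rewrite fmulE // c; case: asboolP. Qed.

End Lift.

Lemma fn_set_inj n T T' : Rset R2 n T ->
  [set h | forall x : Pn n, h x = fn T x] = [set h | forall x : Pn n, h x = fn T' x] ->
  T = T'.
Proof.
move=> HT /seteqP[/(_ (fn T) (fun=> erefl)) /(_ (gen n T 1)) e _].
by apply: contrapT => ne; apply: (fn_neq0 HT); rewrite e fn_gen0.
Qed.

End Products.

(** * Overlaps in stacked algebras *)

Section DeltaArith.
Local Open Scope nat_scope.
Variables D A : nat.
Local Notation delta := (delta D A).

Lemma deltaS4 n : delta n.+4 = D + delta n.+2.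
Proof. by rewrite /delta /= !negbK; case: ifP => _; lia. Qed.

Lemma delta_step n : A <= D ->
  delta n.+3 = delta n.+2 + A \/ delta n.+3 = delta n.+2 + (D - A).
Proof.
move=> hA; rewrite /delta /= !negbK uphalf_half.
by case: (odd n) => /=; [right | left]; lia.
Qed.

Lemma delta_dvd n : A %| D -> A %| delta n.+2.
Proof.
move=> h; rewrite /delta /=; case: ifP => _; last by rewrite dvdn_mull.
by rewrite dvdn_add // dvdn_mull.
Qed.

(** Above degree 1, twice [delta n] is [n * D] with a defect [D - 2 * A] in odd degrees.
    Superadditivity then becomes subadditivity of parity. *)
Lemma delta_double n : 2 * A <= D -> 1 < n ->
  (delta n).*2 + odd n * (D - 2 * A) = n * D.
Proof.
case: n => [|[|n]] // hA _; rewrite /delta /= !negbK.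
by have := odd_double_half n; case: (odd n) => /= e; rewrite -[in RHS]e; lia.
Qed.

Lemma delta_superadd k n : 2 < D -> 1 < A -> (3 <= k + n -> A < D) ->
  (4 <= k + n -> 3 * A <= D) -> delta k + delta n <= delta (k + n).
Proof.
move=> hD hA h3 h4.
have [hk|hk] := ltnP (k + n) 4.
  by case: k n hk h3 {h4} => [|[|[|[|k]]]] [|[|[|[|n]]]] //= _ h3; rewrite /delta /=; lia.
have {}h3 := h3 (ltnW hk); have {}h4 := h4 hk; have hA2 : 2 * A <= D by lia.
have ekn := @delta_double (k + n) hA2 (ltn_trans (isT : 1 < 3) hk).
rewrite oddD mulnDl in ekn.
have d0 : delta 0 = 0 by []; have d1 : delta 1 = 1 by [].
have [k1|k1] := ltnP 1 k; have [n1|n1] := ltnP 1 n.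
- have ek := delta_double hA2 k1; have en := delta_double hA2 n1.
  by move: ek en ekn; case: (odd k); case: (odd n) => /=; lia.
- have en : n = 0 \/ n = 1 by lia.
  case: en => en; subst n; first by rewrite d0 !addn0.
  by have ek := delta_double hA2 k1; move: ek ekn; rewrite d1 /=; case: (odd k) => /=; lia.
- have ek : k = 0 \/ k = 1 by lia.
  case: ek => ek; subst k; first by rewrite d0 !add0n.
  by have en := delta_double hA2 n1; move: en ekn; rewrite d1 /=; case: (odd n) => /=; lia.
- by lia.
Qed.

(** The three numbers count the factors of each degree in a word; the equation says that its path
    has the length required by its total degree. *)
Lemma delta_count n1 n2 n3 : 2 < D -> 1 < A ->
  (4 <= n1 + n2 * 2 + n3 * 3 -> 3 * A <= D) ->
  n1 + n2 * D + n3 * (D + A) = delta (n1 + n2 * 2 + n3 * 3) ->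
  (n1 = 0 /\ n3 <= 1) \/ (n1 = 1 /\ n2 = 0 /\ n3 = 0).
Proof.
move=> hD hA h e.
have [hN|hN] := ltnP (n1 + n2 * 2 + n3 * 3) 4.
  have [h2 h3] : n2 <= 1 /\ n3 <= 1 by lia.
  case: n2 h2 hN e {h} => [|[|//]] _; case: n3 h3 => [|[|//]] _ => hN e.
  - by case: n1 hN e => [|[|[|[|n1]]]] //= _; rewrite /delta /=; lia.
  - by left; lia.
  - by case: n1 hN e => [|[|[|[|n1]]]] //= _; rewrite /delta /=; lia.
  - by lia.
have {}h := h hN; have hA2 : 2 * A <= D by lia.
have := delta_double hA2 (ltn_trans (isT : 1 < 3) hN); rewrite -e.
have -> : odd (n1 + n2 * 2 + n3 * 3) = odd (n1 + n3).
  by rewrite !oddD !oddM /= andbF andbT addbF.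
have [E [hE EA]] : exists E, D - 2 * A = E /\ D = E + 2 * A by exists (D - 2 * A); lia.
rewrite hE EA => e2.
(* [E] is positive. Each factor of degree 1 leaves an excess [E + 2 * A - 2 > E] over the term
   [n1 * 2], so [n1 = 0]; what remains is [n3 = odd n3]. *)
have e3 : n1 * (E + 2 * A) + n3 * E = odd (n1 + n3) * E + n1 * 2 by lia.
have hE2 : 2 * A > 2 by lia.
have E0 : 0 < E by lia.
left; case: n1 e3 {e e2 hN} => [|n1] e3; last by case: (odd _) e3 => /=; nia.
by split=> //; rewrite leqNgt; apply/negP => h3; case: (odd _) e3 => /=; nia.
Qed.

Lemma delta_bc n2 n3 : n3 <= 1 -> 0 < n2 + n3 ->
  n2 * D + n3 * (D + A) = delta (n2 * 2 + n3 * 3).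
Proof.
case: n3 => [|[|//]] _ h.
  case: n2 h => [//|n2] _; rewrite !mul0n !addn0 muln2 doubleS /delta /= odd_double /=.
  by rewrite doubleK; lia.
case: n2 h => [|n2] _; first by rewrite /delta /=; lia.
rewrite muln2 addn3 doubleS /delta /= odd_double /= uphalf_half odd_double doubleK; lia.
Qed.

End DeltaArith.

(** * Positions of relations in associated paths *)

Section Stacked.
Local Open Scope nat_scope.
Variables (Q : quiver) (R2 : set (qpath Q)) (D A : nat).
Implicit Types (p q r P R T : qpath Q) (s : seq (arrow Q)) (i j k n : nat).
Local Notation delta := (delta D A).
Hypothesis Hlen : forall n R, Rset R2 n R -> plen R = delta n.
Hypothesis D2 : 2 < D.
Hypothesis A1 : 1 < A.
Hypothesis D2A : D <> 2 * A.

(* An element of R^2 occupies the arrows i, ..., i + D - 1 of s, counted from 0. *)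
Definition rel_at s i : Prop := exists2 r, R2 r & parrows r = take D (drop i s).

Lemma R2_plen r : R2 r -> plen r = D.
Proof. by move=> h; rewrite (Hlen (n := 2)) // /delta /=; lia. Qed.

Lemma rel_at_size s i : rel_at s i -> i + D <= size s.
Proof.
case=> r /R2_plen hr /(congr1 size); rewrite -[LHS]/(plen r) hr size_take_min size_drop.
by lia.
Qed.

Lemma rel_at_take k s i : i + D <= k -> rel_at (take k s) i <-> rel_at s i.
Proof.
move=> h; rewrite /rel_at.
suff -> : take D (drop i (take k s)) = take D (drop i s) by [].
by rewrite -(subnK (_ : i <= k)) -?take_drop ?take_takel //; lia.
Qed.

Lemma rel_at_drop j s i : rel_at (drop j s) i <-> rel_at s (i + j).
Proof. by rewrite /rel_at drop_drop. Qed.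

Lemma rel_at_catl s1 s2 i : rel_at s1 i -> rel_at (s1 ++ s2) i.
Proof.
move=> h; have hs := rel_at_size h.
by apply/(rel_at_take _ hs); rewrite take_size_cat.
Qed.

Lemma rel_at_catr s1 s2 i : rel_at s2 i <-> rel_at (s1 ++ s2) (i + size s1).
Proof. by rewrite -rel_at_drop drop_size_cat. Qed.

Lemma suffix_rel_at q i k s : R2 q -> i <= k <= size s ->
  suffix (parrows q) (drop i (take k s)) -> i + D <= k /\ rel_at s (k - D).
Proof.
move=> Rq h suf; have lq := R2_plen Rq.
have sz : plen q <= size (drop i (take k s)).
  by apply: size_subseq; apply/infixW/suffixW.
rewrite size_drop size_takel // in sz; last by lia.
split; first by lia.
have hk : k <= size s by lia.
exists q => //; move: suf; rewrite suffixE => /eqP <-.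
rewrite drop_drop size_drop size_takel //.
rewrite -/(plen q) lq take_drop; congr (drop _ (take _ _)); lia.
Qed.

Lemma rel_at_suffix q i s j : i <= j -> j + D = size s -> parrows q = take D (drop j s) ->
  suffix (parrows q) (drop i s).
Proof.
move=> hij hj ->; rewrite take_oversize ?size_drop; last by lia.
by rewrite -(subnK hij) -drop_drop suffix_drop.
Qed.

Lemma rel_at0_R2 P : rel_at (parrows P) 0 -> R2 (ptake D P).
Proof.
case=> r Rr; rewrite drop0 => e; suff -> : ptake D P = r by [].
apply/esym/qpath_eq_arrows => //; have := R2_plen Rr; lia.
Qed.

Lemma R3_intro P j : plen P = D + j -> 0 < j < D -> rel_at (parrows P) 0 ->
  rel_at (parrows P) j -> (forall k, 0 < k < j -> ~ rel_at (parrows P) k) -> Rset R2 3 P.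
Proof.
move=> lP hj h0 [q Rq eq] hmin; apply/RsetSSS; exists 1, D; split.
- by lia.
- exact: rel_at0_R2.
- by rewrite /= plen_ptake //; lia.
- exists q; split => //; last by rewrite (R2_plen Rq); lia.
  by apply: (rel_at_suffix _ _ eq); [lia | rewrite -/(plen P); lia].
- move=> k hk q' Rq' /(suffix_rel_at Rq')[|h1 h2]; first by rewrite -/(plen P); lia.
  by case: (hmin _ _ h2); lia.
Qed.

(** The first relation after [i], at [k] say, cuts out an element of R^3 of length [D + (k - i)],
    and all elements of R^3 have length [D + A]. *)
Lemma rel_at_next P i j : rel_at (parrows P) i -> rel_at (parrows P) j -> i < j < i + D ->
  [/\ rel_at (parrows P) (i + A), i + A <= j & A < D].
Proof.
move=> Hi Hj hij.
pose T k := (i < k) && `[< rel_at (parrows P) k >].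
have exT : exists k, T k by exists j; apply/andP; split; [lia | apply/asboolP].
have [k /andP[hik /asboolP Hk] mink] := ex_minnP exT.
have hkj : k <= j by apply: mink; apply/andP; split; [lia | apply/asboolP].
have hsz := rel_at_size Hk; rewrite -/(plen P) in hsz.
pose P' := pdrop i (ptake (k + D) P).
have lP' : plen P' = D + (k - i) by rewrite plen_pdrop plen_ptake; lia.
have rP' m : m + i <= k -> rel_at (parrows P') m <-> rel_at (parrows P) (m + i).
  by move=> h; rewrite rel_at_drop rel_at_take //; lia.
have H3 : Rset R2 3 P'.
  apply: (R3_intro lP'); first by lia.
  - by apply/rP'; rewrite ?add0n //; lia.
  - by apply/rP'; rewrite subnK //; lia.
  - move=> m hm /rP' h; have {}h : rel_at (parrows P) (m + i) by apply: h; lia.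
    have : T (m + i) by apply/andP; split; [lia | apply/asboolP].
    by move/mink; lia.
have := Hlen H3; rewrite lP' {1}/delta /= => eA.
have -> : i + A = k by lia.
by split => //; lia.
Qed.

Lemma rel_at_chain P d i : rel_at (parrows P) i -> rel_at (parrows P) (i + d) -> d < D ->
  A %| d /\ forall k, k * A <= d -> rel_at (parrows P) (i + k * A).
Proof.
have [m] := ubnP d; elim: m d i => // m IH d i hm Hi Hd hd.
have [d0|d0] := posnP d.
  subst d; split=> // -[|k]; rewrite ?mul0n ?addn0 // mulSn; lia.
have [h1 h2 _] := rel_at_next Hi Hd ltac:(lia).
have [|||h3 h4] := IH (d - A) (i + A) _ h1; try lia.
  by rewrite -addnA subnKC //; lia.
split; first by rewrite -(subnK (_ : A <= d)) ?dvdn_addl //; lia.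
case=> [|k]; first by rewrite mul0n addn0.
by rewrite mulSn addnA => h; apply: h4; lia.
Qed.

Lemma R3_elim P : Rset R2 3 P ->
  [/\ rel_at (parrows P) 0, rel_at (parrows P) A & A < D].
Proof.
move=> HP; have lP := Hlen HP; rewrite /delta /= mul1n in lP.
move/RsetSSS: HP => [i [j [hij Hj Hi [q [Rq suf hq]] _]]].
have ej := Hlen Hj; have ei := Hlen Hi; rewrite !plen_ptake /delta /= ?mul1n in ei ej; try lia.
have lq := R2_plen Rq; subst i j.
have [] := @suffix_rel_at q 1 (plen P) (parrows P) Rq; rewrite ?take_size //.
  by rewrite -/(plen P); lia.
move=> _ HA; rewrite (_ : plen P - D = A) in HA; last by lia.
split => //; last by lia.
exists (ptake D P) => //; by rewrite drop0.
Qed.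

(** Lengths fix both cuts; the last relation has length [D], so it starts at
    [delta n.+4 - D = delta n.+2]. *)
Lemma R4_elim n P : Rset R2 n.+4 P ->
  [/\ Rset R2 n.+3 (ptake (delta n.+3) P), delta n.+3 < delta n.+4
    & rel_at (parrows P) (delta n.+2)].
Proof.
move=> HP; have lP := Hlen HP.
move/RsetSSS: HP => [i [j [hij Hj Hi [q [Rq suf hq]] _]]].
have ej := Hlen Hj; have ei := Hlen Hi; rewrite plen_ptake in ei; try lia.
rewrite plen_ptake in ej; try lia.
subst i j; split => //; first by lia.
have [] := @suffix_rel_at q (delta n.+2) (plen P) (parrows P) Rq; rewrite ?take_size //.
  by rewrite -/(plen P); lia.
by move=> _; rewrite lP deltaS4 addKn.
Qed.

(** An element of R^4 has relations at [A] and at [D], and their distance [D - A] must be a multiple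
    of [A]. As [A < D] and [D <> 2 * A], the quotient of [D] by [A] is at least 3. *)
Lemma stacked_dvd n P : Rset R2 n.+4 P -> [/\ A < D, A %| D & 3 * A <= D].
Proof.
elim: n P => [|n IH] P; last by move/R4_elim => [/IH].
move=> /R4_elim[H3 _ HD]; have lP := Hlen H3.
have [_ HA AD] := R3_elim H3.
have {}HA : rel_at (parrows P) A.
  by move: HA; rewrite rel_at_take //; rewrite /delta /=; lia.
rewrite {1}/delta /= mul1n in HD.
have [||dv _] := @rel_at_chain P (D - A) A HA; rewrite ?subnKC //; try lia.
have dvD : A %| D by rewrite -(subnK (ltnW AD)) dvdn_addl.
split => //; case/dvdnP: dvD => -[|[|[|c]]] e; lia.
Qed.

Definition full_rel s : Prop := forall i, i * A + D <= size s -> rel_at s (i * A).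

Lemma full_take k s : full_rel s -> full_rel (take k s).
Proof.
move=> h i hi; have h' : i * A + D <= k by move: hi; rewrite size_take_min; lia.
apply/rel_at_take => //; apply: h; move: hi; rewrite size_take_min; lia.
Qed.

Lemma full_drop k s : A %| k -> full_rel s -> full_rel (drop k s).
Proof.
case/dvdnP => c -> h i; rewrite size_drop => hi.
by apply/rel_at_drop; rewrite -mulnDl; apply: h; lia.
Qed.

(** The prefix one degree lower provides all multiples of [A] but the last few; the last relation
    starts less than [D] after one already known, and [rel_at_chain] fills the gap. *)
Lemma Rset_full n P : Rset R2 n.+4 P -> full_rel (parrows P).
Proof.
elim: n P => [|n IH] P HP i; have [AD dvD _] := stacked_dvd HP;
  rewrite -/(plen P) (Hlen HP); have [HP' hlt Hlast] := R4_elim HP.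
  have [H0 HA _] := R3_elim HP'.
  have {}H0 : rel_at (parrows P) 0.
    by move: H0; rewrite rel_at_take // /delta /=; lia.
  have {}HA : rel_at (parrows P) A.
    by move: HA; rewrite rel_at_take // /delta /=; lia.
  rewrite {1}/delta /= mul1n in Hlast; rewrite /delta /= => hi.
  case: i hi => [|i] hi; first by rewrite mul0n.
  have [||_ h] := @rel_at_chain P (D - A) A HA; rewrite ?subnKC //; try lia.
  by rewrite mulSn; apply: h; lia.
move=> hi; have F := IH _ HP'; have lP' := Hlen HP'.
have [h|h] := leqP (i * A + D) (delta n.+4).
  by have := F i; rewrite -/(plen (ptake _ P)) lP' => /(_ h); rewrite rel_at_take.
rewrite deltaS4 in h; have /dvdnP[c ec] := delta_dvd n dvD.
have H2 : rel_at (parrows P) (delta n.+2).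
  have := F c; rewrite -/(plen (ptake _ P)) lP' -ec deltaS4 addnC => /(_ (leqnn _)).
  by rewrite rel_at_take // addnC.
have st := @delta_step D A n (ltnW AD); have h5 := deltaS4 D A n.+1.
have [||_ ch] := @rel_at_chain P (delta n.+3 - delta n.+2) _ H2; rewrite ?subnKC //; try lia.
have : rel_at (parrows P) (delta n.+2 + (i - c) * A).
  by apply: ch; rewrite mulnBl -ec; lia.
rewrite {1}ec -mulnDl subnKC // leqNgt; apply/negP => hic.
have : i * A <= c * A by rewrite leq_mul2r (ltnW hic) orbT.
by lia.
Qed.

Lemma full_Rset n P : A < D -> A %| D -> plen P = delta n.+2 -> full_rel (parrows P) ->
  Rset R2 n.+2 P.
Proof.
move=> AD dvD.
have [m] := ubnP n; elim: m n P => // m IH n P hm lP F.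
have F0 : D <= plen P -> rel_at (parrows P) 0 by have := F 0; rewrite mul0n.
case: n hm lP => [|[|n]] hm lP.
- have lPD : plen P = D by rewrite lP /delta /=; lia.
  by rewrite -(ptake_plen P) lPD; apply: rel_at0_R2; apply: F0; lia.
- have lPD : plen P = D + A by rewrite lP /delta /=; lia.
  have H0 : rel_at (parrows P) 0 by apply: F0; lia.
  apply: (R3_intro lPD); [lia | done | |].
    by have := F 1; rewrite mul1n -/(plen P); apply; lia.
  by move=> k hk Hk; have [|] := rel_at_next H0 Hk; lia.
have st := @delta_step D A n (ltnW AD); have st' := @delta_step D A n.+1 (ltnW AD).
have e4 := deltaS4 D A n.
apply/RsetSSS; exists (delta n.+2), (delta n.+3); split.
- by lia.
- by apply: IH; [lia | rewrite plen_ptake //; lia | apply: full_take].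
- by apply: IH; [lia | rewrite plen_ptake //; lia | apply: full_take].
- have /dvdnP[c ec] := delta_dvd n dvD.
  have := F c; rewrite -ec -/(plen P) => -[|q Rq eq]; first by lia.
  exists q; split => //; last by rewrite (R2_plen Rq); lia.
  by apply: (rel_at_suffix _ _ eq) => //; rewrite -/(plen P); lia.
(* Minimality is automatic: a relation starting at or after [delta n.+2] cannot end before
   [delta n.+2 + D = plen P]. *)
- move=> k hk q Rq /(suffix_rel_at Rq)[|]; first by rewrite -/(plen P); lia.
  by lia.
Qed.

Lemma Rset_delta_superadd k n T : Rset R2 (k + n) T -> delta k + delta n <= delta (k + n).
Proof.
move=> HT; apply: delta_superadd => //.
  move=> h; have [h4|h4] := ltnP 3 (k + n).
    have e : k + n = (k + n - 4).+4 by lia.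
    by rewrite e in HT; case: (stacked_dvd HT).
  have e : k + n = 3 by lia.
  by rewrite e in HT; case: (R3_elim HT).
move=> h; have e : k + n = (k + n - 4).+4 by lia.
by rewrite e in HT; case: (stacked_dvd HT).
Qed.

(** A window of length [D] starting in [s1] ends within [s2]; every other window lies in [s2 ++ s3],
    where [A %| size s1] keeps the multiples of [A] aligned. *)
Lemma full_rel_glue s1 s2 s3 : A %| size s1 -> D <= size s2 ->
  full_rel (s1 ++ s2) -> full_rel (s2 ++ s3) -> full_rel (s1 ++ s2 ++ s3).
Proof.
move=> /dvdnP[c ec] h2 F1 F2 i; rewrite !size_cat => hi.
have [h|h] := leqP c i.
  have -> : i * A = (i - c) * A + size s1 by rewrite ec -mulnDl subnK.
  apply: (proj1 (rel_at_catr s1 (s2 ++ s3) _)); apply: F2; rewrite size_cat mulnBl -ec.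
  have : c * A <= i * A by rewrite leq_mul2r h orbT.
  by lia.
rewrite catA; apply/rel_at_catl; apply: F1; rewrite size_cat.
have : i * A <= c * A by rewrite leq_mul2r (ltnW h) orbT.
by lia.
Qed.

End Stacked.

(** * Words in Delta *)

Lemma sortedPn (T : Type) (r : rel T) (s : seq T) : ~~ sorted r s ->
  exists s1 x y s2, s = s1 ++ [:: x, y & s2] /\ ~~ r x y.
Proof.
elim: s => [//|x [|y s] IH] //; rewrite /= negb_and => /orP[h|/IH].
  by exists [::], x, y, s.
by case=> s1 [x' [y' [s2 [-> h]]]]; exists (x :: s1), x', y', s2.
Qed.

Section DeltaWords.
Variables (K : fieldType) (Q : quiver) (R2 : set (qpath Q)) (D A : nat).
Local Notation delta := (delta D A).
Local Notation DA := (Delta_arrow R2).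
Local Notation KD := (path_alg K (Delta R2)).
Local Notation rel_at := (rel_at R2 D).
Local Notation full_rel := (full_rel R2 D A).
Implicit Types (p q r P R T : qpath Q) (i j k n : nat).
Implicit Types (a b c x y : DA) (s : seq DA) (w : qpath (Delta R2)).
Hypothesis Hlen : forall n R, Rset R2 n R -> plen R = delta n.
Hypothesis D2 : (2 < D)%N.
Hypothesis A1 : (1 < A)%N.
Hypothesis D2A : D <> (2 * A)%N.

Definition arrpath a : qpath (Delta R2) :=
  @QPath (Delta R2) (ptgt a.2, [:: a]) (introT andP (conj (eqxx _) isT)).

Definition arr a : KD := pbasis K (arrpath a).

(** A product rather than a basis path, so that words can be cut and recombined freely; a
    non-composable word is 0. *)
Definition word s : KD := \prod_(a <- s) arr a.

Lemma word_cat s1 s2 : word (s1 ++ s2) = word s1 * word s2.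
Proof. by rewrite /word big_cat. Qed.

Lemma word_cons a s : word (a :: s) = arr a * word s.
Proof. by rewrite /word big_cons. Qed.

Lemma word2 a b : word [:: a; b] = arr a * arr b.
Proof. by rewrite /word !big_cons big_nil mulr1. Qed.

Lemma pbasis_word w : (0 < plen w)%N -> pbasis K w = word (parrows w).
Proof.
have [n] := ubnP (plen w); elim: n w => // n IH w hn hw.
have [a [s e]] : exists a s, parrows w = a :: s.
  by move: hw; rewrite /plen; case: (parrows w) => // a s _; exists a, s.
have h1 : ptake 1 w = arrpath a.
  by apply: qpath_eq_arrows; rewrite ?plen_ptake // arrows_ptake e /= take0.
have eds : parrows (pdrop 1 w) = s by rewrite arrows_pdrop e /= drop0.
rewrite -(pbasisM K (pcomp_takedrop 1 w)) h1 e word_cons.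
case: s e eds => [|b s] e eds.
  have wE : w = arrpath a by apply: qpath_eq_arrows.
  rewrite /word big_nil mulr1; apply/(etrans (y := pbasis K w)); last by rewrite wE.
  by rewrite -h1 (pbasisM K (pcomp_takedrop 1 w)).
congr (_ * _); rewrite IH ?eds //; first by rewrite plen_pdrop; lia.
by rewrite /plen eds.
Qed.

(** Only the arrows of [Delta_path], hence meaningful for non-composable words too; reversed because
    [f_x f_y] corresponds to [R_y R_x]. *)
Definition wpath s : seq (arrow Q) := flatten (rev [seq parrows a.2 | a <- s]).
Definition wdeg s : nat := sumn [seq a.1 | a <- s].

Lemma wpath_cat s1 s2 : wpath (s1 ++ s2) = wpath s2 ++ wpath s1.
Proof. by rewrite /wpath map_cat rev_cat flatten_cat. Qed.

Lemma wpath1 a : wpath [:: a] = parrows a.2.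
Proof. by rewrite /wpath /= cats0. Qed.

Lemma wpath_cons a s : wpath (a :: s) = wpath s ++ parrows a.2.
Proof. by rewrite -cat1s wpath_cat wpath1. Qed.

Lemma darrow_Rset a : Rset R2 a.1 a.2.
Proof. by case: a => -[n R] /= /andP[_ /asboolP]. Qed.

Lemma darrow_deg a : [\/ a.1 = 1%N, a.1 = 2%N | a.1 = 3%N].
Proof.
case: a => -[n R] /= /andP[h _]; move: h.
by case: n => [|[|[|[|n]]]] //= _; [apply: Or31 | apply: Or32 | apply: Or33].
Qed.

Lemma darrow_plen a : plen a.2 = delta a.1.
Proof. exact: Hlen (darrow_Rset a). Qed.

Lemma darrow_plen_gt0 a : (0 < plen a.2)%N.
Proof. by rewrite darrow_plen; case: (darrow_deg a) => ->; rewrite /delta /=; lia. Qed.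

Lemma darrow_eq a b : a.1 = b.1 -> parrows a.2 = parrows b.2 -> a = b.
Proof.
move=> e1 e2; apply: val_inj => /=.
have e3 : a.2 = b.2 by apply: qpath_eq_arrows => //; apply: darrow_plen_gt0.
by case: (darrow a) (darrow b) e1 e3 => n R [m S] /= -> ->.
Qed.

Lemma wpath_size s s' : [seq a.1 | a <- s] = [seq a.1 | a <- s'] ->
  size (wpath s) = size (wpath s').
Proof.
elim: s s' => [|a s IH] [|b s'] //= [eab es]; rewrite !wpath_cons !size_cat.
by rewrite (IH _ es) -/(plen a.2) -/(plen b.2) !darrow_plen eab.
Qed.

(** The degrees fix the lengths of the factors, hence the places where the path is cut. *)
Lemma wpath_inj s s' : [seq a.1 | a <- s] = [seq a.1 | a <- s'] ->
  wpath s = wpath s' -> s = s'.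
Proof.
elim: s s' => [|a s IH] [|b s'] //= [eab es]; rewrite !wpath_cons => /eqP.
rewrite eqseq_cat; last exact: wpath_size.
by case/andP => /eqP e1 /eqP e2; rewrite (IH _ es e1) (darrow_eq eab e2).
Qed.

Lemma foldl_path s p : is_chain (Q := Delta R2) (psrc p) s -> exists p',
  foldl (fun acc (a : DA) => obind (pcomp a.2) acc) (Some p) s = Some p' /\
  parrows p' = wpath s ++ parrows p.
Proof.
elim: s p => [|a s IH] p /=; first by exists p.
case/andP => /eqP e ch; have [q cq] := pcomp_ex e.
have /pcompP[_ sq aq] := cq; rewrite cq.
have [|p' [-> ap]] := IH q; first by rewrite sq.
by exists p'; split => //; rewrite ap aq wpath_cons catA.
Qed.

Lemma Delta_path_ex w : exists p, Delta_path w = Some p /\ parrows p = wpath (parrows w).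
Proof.
have [|p [h1 h2]] := @foldl_path (parrows w) (vpath (psrc w : vert Q)).
  exact: qpath_chain w.
by exists p; split => //; rewrite h2 cats0.
Qed.

Lemma Delta_path_eq w p : (0 < plen p)%N -> parrows p = wpath (parrows w) ->
  Delta_path w = Some p.
Proof.
move=> hp e; have [p' [-> e']] := Delta_path_ex w.
by congr Some; apply/esym/qpath_eq_arrows => //; rewrite e e'.
Qed.

(* This expresses that f_x f_y <> 0 in Ext; see nonzero_pair_fmul. *)
Definition nonzero_pair x y : Prop :=
  exists2 p, pcomp y.2 x.2 = Some p & Rset R2 (x.1 + y.1) p.

(** For every other pair of degrees, [delta x.1 + delta y.1] differs from [delta (x.1 + y.1)]; from
    total degree 4 on, this rests on the bounds in [H4]. *)
Lemma nonzero_pair_deg x y : nonzero_pair x y ->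
  [\/ x.1 = 2%N /\ y.1 = 2%N, x.1 = 2%N /\ y.1 = 3%N | x.1 = 3%N /\ y.1 = 2%N].
Proof.
case=> p /pcomp_len; rewrite !darrow_plen => lp Hp; have := Hlen Hp; rewrite lp.
have H4 : (4 <= x.1 + y.1)%N -> (A < D)%N /\ (3 * A <= D)%N.
  move=> h; have e : (x.1 + y.1 = (x.1 + y.1 - 4).+4)%N by lia.
  by rewrite e in Hp; case: (stacked_dvd Hlen D2 A1 D2A Hp).
case: (darrow_deg x) H4 => ->; case: (darrow_deg y) => -> => /= H4;
  rewrite /delta /= => e; try (by [apply: Or31 | apply: Or32 | apply: Or33]); exfalso;
  try (have [] := H4 isT); lia.
Qed.

Lemma nonzero_pair_dvd x y : nonzero_pair x y -> [/\ (A < D)%N, (A %| D)%N & (3 * A <= D)%N].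
Proof.
move=> g; have [p _ Hp] := g; have e : (x.1 + y.1 = (x.1 + y.1 - 4).+4)%N.
  by case: (nonzero_pair_deg g) => -[-> ->].
by rewrite e in Hp; apply: (stacked_dvd Hlen D2 A1 D2A Hp).
Qed.

Lemma nonzero_pair_full x y : nonzero_pair x y -> full_rel (parrows y.2 ++ parrows x.2).
Proof.
move=> g; have [p /pcompP[_ _ <-] Hp] := g.
have e : (x.1 + y.1 = (x.1 + y.1 - 4).+4)%N by case: (nonzero_pair_deg g) => -[-> ->].
by rewrite e in Hp; apply: (Rset_full Hlen D2 A1 D2A Hp).
Qed.

(** [H_zero] and [H_swap] describe [H_Delta] by paths of Q instead of products in Ext; [H_DeltaE]
    proves the agreement. *)
Definition H_zero : set KD := [set h | exists w x y,
  [/\ h = pbasis K w, parrows w = [:: x; y] & ~ nonzero_pair x y]].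

Definition H_swap : set KD := [set h | exists w w' x y x' y',
  [/\ h = pbasis K w - pbasis K w', parrows w = [:: x; y] /\ parrows w' = [:: x'; y'],
      [/\ x.1 = 2%N, y.1 = 3%N, x'.1 = 3%N & y'.1 = 2%N], nonzero_pair x y
    & parrows y.2 ++ parrows x.2 = parrows y'.2 ++ parrows x'.2]].

Local Notation M := (ideal_gen (H_zero `|` H_swap)).

Let Mideal : is_ideal M := ideal_gen_is_ideal _.
Let M0 : M 0. Proof. by case: Mideal. Qed.
Let MD (u v : KD) : M u -> M v -> M (u + v).
Proof. by case: Mideal => _ h _ _; apply: h. Qed.
Let Ml (u v : KD) : M v -> M (u * v).
Proof. by case: Mideal => _ _ h _; apply: h. Qed.
Let Mr (u v : KD) : M u -> M (u * v).
Proof. by case: Mideal => _ _ _ h; apply: h. Qed.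
Let MB (u v : KD) : M u -> M v -> M (u - v).
Proof. exact: idealB. Qed.

Lemma arrM_pbasis x y : ptgt y.2 = psrc x.2 ->
  exists2 w, arr x * arr y = pbasis K w & parrows w = [:: x; y].
Proof.
move=> e; have [w cw] : exists w, pcomp (arrpath x) (arrpath y) = Some w.
  by apply: pcomp_ex.
by exists w; [apply: pbasisM cw | case/pcompP: cw].
Qed.

Lemma zero_pair_gen x y : ~ nonzero_pair x y -> M (arr x * arr y).
Proof.
move=> ng; have [e|ne] := eqVneq (ptgt y.2) (psrc x.2).
  have [w -> hw] := arrM_pbasis e.
  by apply: sub_ideal_gen; left; exists w, x, y.
suff -> : arr x * arr y = 0 by [].
rewrite /arr mtermM /term_mul; case c: (pcomp _ _) => [w|] //.
by case/pcompP: c => e; case/eqP: ne.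
Qed.

(** The path, of length [2 * D + A], is cut after [D] arrows instead of [D + A]. Since [A] divides
    [D], the remainder still has relations at its multiples of [A] and so lies in R^3. *)
Lemma swap_pair x y : x.1 = 2%N -> y.1 = 3%N -> nonzero_pair x y -> exists x' y',
  [/\ x'.1 = 3%N, y'.1 = 2%N, wpath [:: x; y] = wpath [:: x'; y']
    & M (arr x * arr y - arr x' * arr y')].
Proof.
move=> hx hy g; have [AD dvD D3A] := nonzero_pair_dvd g; have F := nonzero_pair_full g.
have [p cp Hp] := g; have lp := Hlen Hp; rewrite hx hy /delta /= in lp.
have /pcompP[e _ ap] := cp; rewrite -ap in F.
have H2 : Rset R2 2 (ptake D p).
  apply: (rel_at0_R2 Hlen D2 A1 D2A); have := F 0%N; rewrite mul0n; apply.
  by rewrite -/(plen p) lp; lia.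
have H3 : Rset R2 3 (pdrop D p).
  apply: (full_Rset (n := 1) Hlen D2 A1 D2A) => //.
    by rewrite plen_pdrop lp /delta /=; lia.
  by rewrite arrows_pdrop; apply: full_drop.
have hx' : is_Delta_arrow R2 (3%N, pdrop D p) by apply/andP; split=> //; apply/asboolP.
have hy' : is_Delta_arrow R2 (2%N, ptake D p) by apply/andP; split=> //; apply/asboolP.
pose x' := DeltaArrow hx'; pose y' := DeltaArrow hy'.
have ew : parrows y.2 ++ parrows x.2 = parrows y'.2 ++ parrows x'.2.
  by rewrite -ap /= cat_take_drop.
exists x', y'; split => //; first by rewrite !wpath_cons /= ew.
have [w -> hw] := arrM_pbasis e.
have [|w' -> hw'] := @arrM_pbasis x' y'; first by case/pcompP: (pcomp_takedrop D p).
by apply: sub_ideal_gen; right; exists w, w', x, y, x', y'.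
Qed.

Lemma word_two_c c bs c2 : c.1 = 3%N -> c2.1 = 3%N -> all (fun b => b.1 == 2%N) bs ->
  M (word (c :: bs ++ [:: c2])).
Proof.
move=> hc; elim/last_ind: bs c2 => [|bs b IH] c2 hc2.
  move=> _; rewrite /= word2; apply: zero_pair_gen => /nonzero_pair_deg.
  by rewrite hc hc2 => -[] [].
rewrite all_rcons => /andP[/eqP hb hbs].
rewrite -cats1 -catA /= -cat_cons word_cat word2.
have [g|ng] := pselect (nonzero_pair b c2); last by apply: Ml; apply: zero_pair_gen.
have [x' [y' [hx' hy' _ m]]] := swap_pair hb hc2 g.
rewrite -[arr b * _](subrK (arr x' * arr y')) mulrDr; apply: MD; first exact: Ml.
by rewrite mulrA; apply: Mr; have := IH x' hx' hbs; rewrite -cat_cons word_cat {2}/word big_seq1.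
Qed.

Lemma wpath_size_b s : all (fun b => b.1 == 2%N) s -> size (wpath s) = (size s * D)%N.
Proof.
elim: s => [//|b s IH] /= /andP[/eqP hb /IH h].
by rewrite wpath_cons size_cat h -/(plen b.2) darrow_plen hb /delta /=; lia.
Qed.

(** The pair occupies a segment of [p] starting at a multiple of [A], so this segment is full as
    well and lies in R^5. *)
Lemma full_nonzero_pair p s1 x y s2 : parrows p = wpath (s1 ++ [:: x, y & s2]) ->
  full_rel (parrows p) -> (A %| size (wpath s2))%N -> (A < D)%N -> (A %| D)%N ->
  x.1 = 2%N -> y.1 = 3%N -> nonzero_pair x y.
Proof.
move=> ep F hs2 AD dvD hx hy.
pose P := pdrop (size (wpath s2)) (ptake (size (wpath [:: x, y & s2])) p).
have eP : parrows P = parrows y.2 ++ parrows x.2.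
  rewrite arrows_pdrop arrows_ptake ep wpath_cat take_size_cat // !wpath_cons -catA.
  by rewrite drop_size_cat.
have lP : plen P = delta 5.
  rewrite /plen eP size_cat -/(plen y.2) -/(plen x.2) !darrow_plen hx hy /delta /=; lia.
have sy : y.2 = ptake (plen y.2) P.
  by apply: qpath_eq_arrows; rewrite ?darrow_plen_gt0 // arrows_ptake eP take_size_cat.
have sx : x.2 = pdrop (plen y.2) P.
  by apply: qpath_eq_arrows; rewrite ?darrow_plen_gt0 // arrows_pdrop eP drop_size_cat.
exists P; first by rewrite sx {1}sy pcomp_takedrop.
rewrite hx hy; apply: (full_Rset (n := 3) Hlen D2 A1 D2A) => //.
by rewrite arrows_pdrop arrows_ptake; apply/full_drop => //; apply: full_take.
Qed.

(** Swaps do not change the path, so its fullness guarantees at every stage that the next pair to be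
    swapped is nonzero. *)
Lemma normal_form p bs c bs2 : all (fun b => b.1 == 2%N) bs -> c.1 = 3%N ->
  all (fun b => b.1 == 2%N) bs2 -> parrows p = wpath (bs ++ c :: bs2) ->
  full_rel (parrows p) -> (A < D)%N -> (A %| D)%N ->
  exists c' bs', [/\ c'.1 = 3%N, all (fun b => b.1 == 2%N) bs',
    size bs' = (size bs + size bs2)%N, parrows p = wpath (c' :: bs')
    & M (word (bs ++ c :: bs2) - word (c' :: bs'))].
Proof.
move=> hbs hc hbs2 ep F AD dvD.
elim/last_ind: bs c bs2 hbs hc hbs2 ep => [|bs b IH] c bs2 hbs hc hbs2 ep.
  by exists c, bs2; split => //; rewrite subrr.
move: hbs; rewrite all_rcons => /andP[/eqP hb hbs].
rewrite -cats1 -catA /= in ep *.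
have dv2 : (A %| size (wpath bs2))%N by rewrite wpath_size_b // dvdn_mull.
have g := full_nonzero_pair ep F dv2 AD dvD hb hc.
have [c1 [b1 [hc1 hb1 ew m]]] := swap_pair hb hc g.
have ep1 : parrows p = wpath (bs ++ c1 :: b1 :: bs2).
  rewrite ep (wpath_cat bs (b :: _)) (wpath_cat bs (c1 :: _)); congr (_ ++ _).
  by rewrite (wpath_cat [:: b; c] bs2) ew -wpath_cat.
have [|c' [bs' [h1 h2 h3 h4 h5]]] := IH c1 (b1 :: bs2) hbs hc1 _ ep1.
  by rewrite /= hb1.
exists c', bs'; split => //; first by rewrite h3 size_cat /=; lia.
rewrite -[_ - _](subrKA (word (bs ++ c1 :: b1 :: bs2))); apply: MD => //.
rewrite (word_cat bs (b :: _)) (word_cat bs (c1 :: _)) -mulrBr; apply: Ml.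
rewrite (word_cat [:: b; c] bs2) (word_cat [:: c1; b1] bs2) -mulrBl !word2.
exact: Mr.
Qed.

Definition deg_count k s : nat := count (fun a => a.1 == k) s.

Arguments deg_count : simpl never.

Lemma cnt_cons k a s : deg_count k (a :: s) = ((a.1 == k) + deg_count k s)%N.
Proof. by []. Qed.

Lemma wpath_cnt s :
  size (wpath s) = (deg_count 1 s + deg_count 2 s * D + deg_count 3 s * (D + A))%N.
Proof.
elim: s => [//|a s IH]; rewrite wpath_cons size_cat IH -/(plen a.2) darrow_plen !cnt_cons.
by case: (darrow_deg a) => ->; rewrite /delta /=; lia.
Qed.

Lemma wdeg_cnt s : wdeg s = (deg_count 1 s + deg_count 2 s * 2 + deg_count 3 s * 3)%N.
Proof.
elim: s => [//|a s IH]; rewrite /wdeg /= -/(wdeg s) IH !cnt_cons.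
by case: (darrow_deg a) => ->; rewrite /=; lia.
Qed.

Lemma size_cnt s : size s = (deg_count 1 s + deg_count 2 s + deg_count 3 s)%N.
Proof.
elim: s => [//|a s IH]; rewrite /= IH !cnt_cons.
by case: (darrow_deg a) => ->; rewrite /=; lia.
Qed.

Lemma cnt_cat k s1 s2 : deg_count k (s1 ++ s2) = (deg_count k s1 + deg_count k s2)%N.
Proof. by rewrite /deg_count count_cat. Qed.

Lemma cnt_all2 s : deg_count 1 s = 0%N -> deg_count 3 s = 0%N -> all (fun b => b.1 == 2%N) s.
Proof.
elim: s => [//|a s IH]; rewrite !cnt_cons => h1 h3 /=; rewrite IH; try lia.
by case: (darrow_deg a) h1 h3 => ->.
Qed.

Lemma cnt3_split s : (0 < deg_count 3 s)%N -> exists s1 c s2,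
  [/\ s = s1 ++ c :: s2, c.1 = 3%N & deg_count 3 s1 = 0%N].
Proof.
elim: s => [//|a s IH]; rewrite cnt_cons; case: (eqVneq a.1 3%N) => [e _|ne].
  by exists [::], a, s.
move=> /IH[s1 [c [s2 [-> hc h]]]]; exists (a :: s1), c, s2; split => //.
by rewrite cnt_cons h (negPf ne).
Qed.

Lemma all2_map s : all (fun b => b.1 == 2%N) s -> [seq a.1 | a <- s] = nseq (size s) 2%N.
Proof. by elim: s => [//|a s IH] /= /andP[/eqP -> /IH ->]. Qed.

Let nonzero_pairb : rel DA := fun x y => `[< nonzero_pair x y >].

(** Consecutive pairs share an arrow of Delta whose path has length at least [D], so their full
    paths can be glued. *)
Lemma nonzero_path_full x y s : path nonzero_pairb x (y :: s) ->
  deg_count 1 [:: x, y & s] = 0%N /\ full_rel (wpath [:: x, y & s]).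
Proof.
elim: s x y => [|z s IH] x y.
  rewrite /= andbT => /asboolP g; split; last by rewrite !wpath_cons /=; apply: nonzero_pair_full.
  by rewrite !cnt_cons; case: (nonzero_pair_deg g) => -[-> ->].
move=> h; have /andP[/asboolP g /IH[h1 F]] :
  nonzero_pairb x y && path nonzero_pairb y (z :: s) := h.
have [AD dvD _] := nonzero_pair_dvd g.
rewrite cnt_cons h1; split; first by case: (nonzero_pair_deg g) => -[-> _].
rewrite (wpath_cons x) (wpath_cons y) -catA; apply: (full_rel_glue Hlen D2 A1 D2A);
  last exact: nonzero_pair_full.
- move: h1; rewrite cnt_cons wpath_cnt => ?.
  have -> : deg_count 1 (z :: s) = 0%N by lia.
  by rewrite add0n dvdn_add // dvdn_mull // dvdn_add.
- rewrite -/(plen y.2) darrow_plen.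
  by case: (nonzero_pair_deg g) => -[_ ->]; rewrite /delta /=; lia.
- by rewrite -wpath_cons.
Qed.

Lemma word_monomial s p : s != [::] -> parrows p = wpath s -> ~ Rset R2 (wdeg s) p ->
  M (word s).
Proof.
case: s => [//|x [|y s]] _ ep nR.
  case: nR; rewrite wpath1 in ep; have -> : p = x.2.
    by apply/esym/qpath_eq_arrows => //; apply: darrow_plen_gt0.
  by rewrite /wdeg /= addn0; apply: darrow_Rset.
have [gp|] := boolP (sorted nonzero_pairb [:: x, y & s]); last first.
  move=> /sortedPn[s1 [a [b [s2 [-> /asboolPn ng]]]]].
  rewrite word_cat -[[:: a, b & s2]]/([:: a; b] ++ s2) word_cat word2.
  by apply: Ml; apply: Mr; apply: zero_pair_gen.
have [c1 F] := nonzero_path_full gp.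
(* With at most one factor of degree 3 the length is [delta] of the degree, so the full path would
   be associated, against [nR]. *)
have [h3|h3] := leqP (deg_count 3 [:: x, y & s]) 1.
  case: nR; have /andP[/asboolP g _] : nonzero_pairb x y && path nonzero_pairb y s := gp.
  have [AD dvD _] := nonzero_pair_dvd g.
  have sz := size_cnt [:: x, y & s]; have wd := wdeg_cnt [:: x, y & s].
  have ws := wpath_cnt [:: x, y & s].
  rewrite c1 !add0n in sz wd ws; rewrite /= in sz.
  have [n en] : exists n, wdeg [:: x, y & s] = n.+2.
    by exists (wdeg [:: x, y & s] - 2)%N; lia.
  rewrite en; apply: (full_Rset Hlen D2 A1 D2A) => //; last by rewrite ep.
  by rewrite -en wd /plen ep ws delta_bc //; lia.
(* The first two factors of degree 3 are taken, so that only factors of degree 2 stand between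
   them. *)
have [|s1 [c [s2 [e hc h0]]]] := @cnt3_split [:: x, y & s]; first by lia.
move: (c1) h3; rewrite e !cnt_cat !cnt_cons hc h0 /= => c1' h3.
have [|s3 [c' [s4 [e' hc' h0']]]] := @cnt3_split s2; first by lia.
rewrite e' cnt_cat in c1'.
have hs3 : all (fun b => b.1 == 2%N) s3 by apply: cnt_all2 => //; lia.
have -> : s1 ++ c :: s2 = s1 ++ (c :: s3 ++ [:: c']) ++ s4 by rewrite e' /= -catA.
by rewrite !word_cat; apply: Ml; apply: Mr; apply: word_two_c.
Qed.

Lemma word_binomial s s' p : s != [::] -> s' != [::] ->
  parrows p = wpath s -> parrows p = wpath s' -> wdeg s = wdeg s' ->
  Rset R2 (wdeg s) p -> M (word s - word s').
Proof.
move=> ns ns' e e' ed HR.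
have H4 : (4 <= wdeg s)%N -> (A < D)%N /\ (A %| D)%N /\ (3 * A <= D)%N.
  move=> h; have ew : (wdeg s = (wdeg s - 4).+4)%N by lia.
  by rewrite ew in HR; case: (stacked_dvd Hlen D2 A1 D2A HR).
have lp := Hlen HR.
(* Length and degree leave only the counts of [delta_count]; since the degrees of [s] and [s']
   agree, so do their counts. *)
have H t : parrows p = wpath t -> wdeg s = wdeg t ->
    (deg_count 1 t = 0%N /\ (deg_count 3 t <= 1)%N) \/
    (deg_count 1 t = 1%N /\ deg_count 2 t = 0%N /\ deg_count 3 t = 0%N).
  move=> et edt; apply: (delta_count D2 A1); rewrite -wdeg_cnt -edt.
    by move=> /H4[_ []].
  by rewrite -lp /plen et wpath_cnt.
have same t t' : [seq a.1 | a : DA <- t] = [seq a.1 | a : DA <- t'] ->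
    parrows p = wpath t -> parrows p = wpath t' -> M (word t - word t').
  by move=> h1 h2 h3; rewrite (wpath_inj h1) ?subrr //; rewrite -h2 -h3.
have Hs := H s e erefl; have Hs' := H s' e' ed.
have wd := wdeg_cnt s; have wd' := wdeg_cnt s'; rewrite ed in wd.
have sz := size_cnt s; have sz' := size_cnt s'.
have [h1|h1] := posnP (deg_count 1 s); last first.
  have s1 : size s = 1%N by lia.
  have s1' : size s' = 1%N by lia.
  case: s s1 {ns Hs sz H4 HR lp H} h1 e ed wd => [|a [|]] // _ h1 e ed wd.
  case: s' s1' {ns' Hs' sz'} e' ed wd wd' => [|a' [|]] // _ e' ed wd wd'.
  by apply: same => //; move: ed; rewrite /wdeg /= !addn0 => ->.
have [h3|h3] := posnP (deg_count 3 s).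
  have a2 : all (fun b => b.1 == 2%N) s by apply: cnt_all2.
  have a2' : all (fun b => b.1 == 2%N) s' by apply: cnt_all2; lia.
  by apply: same => //; rewrite !all2_map //; congr nseq; lia.
have [q3 q1' q3'] : [/\ deg_count 3 s = 1, deg_count 1 s' = 0 & deg_count 3 s' = 1]%N by split; lia.
clear Hs Hs' H.
have [s1 [c [s2 [es hc c10]]]] := cnt3_split h3.
have [|s1' [c' [s2' [es' hc' c10']]]] := @cnt3_split s'; first by lia.
have k1 := cnt_cat 1 s1 (c :: s2); have k3 := cnt_cat 3 s1 (c :: s2).
have k1' := cnt_cat 1 s1' (c' :: s2'); have k3' := cnt_cat 3 s1' (c' :: s2').
rewrite -es !cnt_cons hc /= in k1 k3; rewrite -es' !cnt_cons hc' /= in k1' k3'.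
have b1 : all (fun b => b.1 == 2%N) s1 by apply: cnt_all2; lia.
have b2 : all (fun b => b.1 == 2%N) s2 by apply: cnt_all2; lia.
have b1' : all (fun b => b.1 == 2%N) s1' by apply: cnt_all2; lia.
have b2' : all (fun b => b.1 == 2%N) s2' by apply: cnt_all2; lia.
(* Fullness comes from R^4 on; below that, each word is a single factor of degree 3. *)
have [h4|h4] := ltnP (wdeg s) 4.
  have l0 : size s = 1%N by lia.
  have l0' : size s' = 1%N by lia.
  rewrite es size_cat /= in l0; rewrite es' size_cat /= in l0'.
  have n1 : s1 = [::] by apply: size0nil; lia.
  have n2 : s2 = [::] by apply: size0nil; lia.
  have n1' : s1' = [::] by apply: size0nil; lia.
  have n2' : s2' = [::] by apply: size0nil; lia.
  by apply: same => //; rewrite es es' n1 n2 n1' n2' /= hc hc'.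
have [AD [dvD _]] := H4 h4.
have F : full_rel (parrows p).
  have ew : (wdeg s = (wdeg s - 4).+4)%N by lia.
  by rewrite ew in HR; apply: (Rset_full Hlen D2 A1 D2A HR).
have ep := e; have ep' := e'; rewrite es in ep; rewrite es' in ep'.
have [d [t [hd ht st et Mt]]] := normal_form b1 hc b2 ep F AD dvD.
have [d' [t' [hd' ht' st' et' Mt']]] := normal_form b1' hc' b2' ep' F AD dvD.
have ss : size s = size s' by clear -sz sz' wd wd' h1 q1' q3 q3'; lia.
rewrite es es' !size_cat /= in ss.
have edt : d :: t = d' :: t'.
  apply: wpath_inj; last by rewrite -et -et'.
  by rewrite /= hd hd' !all2_map // st st'; congr (_ :: nseq _ _); clear -ss; lia.
rewrite es es' -[_ - _](subrKA (word (d :: t))); apply: MD => //.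
by rewrite edt -opprB; apply: (idealN Mideal).
Qed.

Lemma word2_comp w x y : parrows w = [:: x; y] -> exists p, pcomp y.2 x.2 = Some p.
Proof.
move=> ew; have := qpath_chain w; rewrite ew /= => /and3P[_ /eqP e _].
exact: pcomp_ex.
Qed.

Lemma ideal_gen_H : M = I_Delta R2 K.
Proof.
apply/seteqP; split; apply: ideal_gen_min => //; try exact: ideal_gen_is_ideal.
- move=> h [|].
    case=> w [x [y [-> ew ng]]]; apply: sub_ideal_gen; left; exists w; split=> //.
      by rewrite /plen ew.
    case=> p hp HR; apply: ng; exists p; last first.
      by move: HR; rewrite /Delta_deg ew /= addn0.
    have [p' cp'] := word2_comp ew; suff -> : p = p' by [].
    have /pcompP[_ _ ap] := cp'.
    have dp : Delta_path w = Some p'.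
      apply: Delta_path_eq; last by rewrite ew !wpath_cons /= ap.
      by rewrite (pcomp_len cp'); have := darrow_plen_gt0 x; lia.
    by rewrite dp in hp; case: hp.
  case=> w [w' [x [y [x' [y' [-> [ew ew'] [hx hy hx' hy'] [p cp HR] ea]]]]]].
  apply: sub_ideal_gen; right; exists w, w'; split=> //.
  + by rewrite /plen ew ew'.
  + have /pcompP[_ _ ap] := cp.
    have hp : (0 < plen p)%N.
      by rewrite (pcomp_len cp); have := darrow_plen_gt0 x; lia.
    exists p; apply: Delta_path_eq => //.
      by rewrite ew !wpath_cons /= ap.
    by rewrite ew' !wpath_cons /= -ea ap.
  + by rewrite /Delta_deg ew ew' /= hx hy hx' hy'.
- move=> h [|].
    case=> w [-> hw nR]; rewrite (pbasis_word hw).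
    have [p [dp ep]] := Delta_path_ex w.
    apply: (word_monomial _ ep); first by rewrite -size_eq0 -lt0n.
    by move=> HR; apply: nR; exists p.
  case=> w [w' [-> [hw hw'] [p dp dp'] ed]].
  have [q [dq eq]] := Delta_path_ex w; have [q' [dq' eq']] := Delta_path_ex w'.
  move: dq dq'; rewrite dp dp' => -[e1] [e2]; rewrite -e1 in eq; rewrite -e2 in eq'.
  have nw : parrows w != [::] by rewrite -size_eq0 -lt0n.
  have nw' : parrows w' != [::] by rewrite -size_eq0 -lt0n.
  rewrite (pbasis_word hw) (pbasis_word hw').
  (* If the common path is not associated, each of the two words lies in the ideal by itself. *)
  have [HR|nR] := pselect (Rset R2 (wdeg (parrows w)) p).
    exact: (word_binomial nw nw' eq eq').
  apply: MB; first exact: (word_monomial nw eq).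
  by apply: (word_monomial nw' eq'); rewrite -[wdeg _]ed.
Qed.

Lemma swap_nonzero_pair w x y x' y' : parrows w = [:: x'; y'] ->
  (x'.1 + y'.1 = x.1 + y.1)%N -> nonzero_pair x y ->
  parrows y.2 ++ parrows x.2 = parrows y'.2 ++ parrows x'.2 -> nonzero_pair x' y'.
Proof.
move=> ew ed [p cp HR] ea; have [p' cp'] := word2_comp ew.
exists p' => //; suff -> : p' = p by rewrite ed.
have /pcompP[_ _ ap] := cp; have /pcompP[_ _ ap'] := cp'.
apply: qpath_eq_arrows; first by rewrite ap ap'.
by rewrite (pcomp_len cp'); have := darrow_plen_gt0 x'; lia.
Qed.

(** * Minimality *)

(** For a binomial the witness is the word [bc]: path and degrees fix the other word [c'b'], and by
    its degrees [bc] is not the second word of any binomial. Both words of a binomial are nonzero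
    pairs, hence foreign to [H_zero]. *)
Lemma H_witness h : (H_zero `|` H_swap) h -> exists w,
  [/\ plen w = 2%N, h@_w != 0 & forall h', (H_zero `|` H_swap) h' -> h'@_w != 0 -> h' = h].
Proof.
case=> [[w [x [y [-> ew ng]]]] | ].
  exists w; split; first by rewrite /plen ew.
    by rewrite mcoeff_pbasis eqxx oner_eq0.
  move=> h' [[w' [x' [y' [-> ew' _]]]] /mcoeff_pbasis_neq0 -> //|].
  case=> u [u' [x1 [y1 [x2 [y2 [-> [eu eu'] [hx1 hy1 hx2 hy2] g ea]]]]]].
  rewrite mcoeffB !mcoeff_pbasis; case: (u =P w) => [euw|_].
    by case: ng; move: eu; rewrite euw ew => -[-> ->].
  case: (u' =P w) => [euw|_]; last by rewrite subrr eqxx.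
  have g' : nonzero_pair x2 y2 by apply: (swap_nonzero_pair eu' _ g ea); rewrite hx1 hy1 hx2 hy2.
  by case: ng; move: eu'; rewrite euw ew => -[-> ->].
case=> w [w' [x [y [x' [y' [-> [ew ew'] [hx hy hx' hy'] g ea]]]]]].
exists w; split; first by rewrite /plen ew.
  rewrite mcoeffB !mcoeff_pbasis eqxx; case: (w' =P w) => [e|_].
    by move: ew'; rewrite e ew => -[ex _]; move: hx'; rewrite -ex hx.
  by rewrite subr0 oner_eq0.
move=> h' [[v [x1 [y1 [-> ev ng]]]] /mcoeff_pbasis_neq0 e|].
  by case: ng; move: ev; rewrite e ew => -[<- <-].
case=> u [u' [x1 [y1 [x2 [y2 [-> [eu eu'] [hx1 hy1 hx2 hy2] g' ea']]]]]].
rewrite mcoeffB !mcoeff_pbasis; case: (u' =P w) => [e|_].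
  by move: eu'; rewrite e ew => -[ex _]; move: hx2; rewrite -ex hx.
case: (u =P w) => [e|_]; last by rewrite subrr eqxx.
move=> _; rewrite e; congr (_ - pbasis K _).
move: eu; rewrite e ew => -[ex ey]; rewrite -ex -ey in ea'.
apply: qpath_eq_arrows; last by rewrite /plen eu'.
rewrite eu' ew'; apply: wpath_inj; first by rewrite /= hx' hy' hx2 hy2.
by rewrite !wpath_cons /= -ea -ea'.
Qed.

Lemma H_minimal (U : set KD) :
  U `<=` H_zero `|` H_swap -> ideal_gen U = M -> U = H_zero `|` H_swap.
Proof.
move=> UH eU; apply/seteqP; split=> // h Hh; apply: contrapT => nU.
have [w [lw hw wmin]] := H_witness Hh.
(* If [w], of length 2, is a product with a factor of length at least 2, the other factor is trivial
   and the first is [w] itself; so [J] is an ideal. It contains every generator except [h]. *)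
pose J : set KD := [set z | forall v, z@_v != 0 -> (2 <= plen v)%N /\ v <> w].
have HJ : is_ideal J.
  apply: is_ideal_supp => p q r c H; have lr := pcomp_len c.
  split; first by case: H => -[]; lia.
  move=> e; subst r; case: H => -[h2]; apply.
    have q0 : plen q = 0%N by lia.
    apply: qpath_eq; first by case/pcompP: c => _ ->.
    by case/pcompP: c => _ _ ->; rewrite (size0nil q0) cats0.
  have p0 : plen p = 0%N by lia.
  have /pcompP[e1 e2 e3] := c.
  apply: qpath_eq; last by rewrite e3 (size0nil p0).
  by rewrite -e1 e2 /ptgt (size0nil p0).
have UJ : U `<=` J.
  move=> z Uz v hv; have Hz := UH _ Uz; split; last first.
    by move=> e; rewrite e in hv; apply: nU; rewrite -(wmin _ Hz hv).
  case: Hz hv => [[u [x [y [-> eu _]]]] /mcoeff_pbasis_neq0 <-|].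
    by rewrite /plen eu.
  case=> u [u' [x [y [x' [y' [-> [eu eu'] _ _ _]]]]]].
  rewrite mcoeffB !mcoeff_pbasis; case: (u =P v) => [<- _|_]; first by rewrite /plen eu.
  by case: (u' =P v) => [<- _|_]; [rewrite /plen eu' | rewrite subrr eqxx].
have : J h by apply: (ideal_gen_min HJ UJ); rewrite eU; apply: sub_ideal_gen.
by move/(_ _ hw) => [].
Qed.

End DeltaWords.

(** * The generating set *)

Section Generators.
Variables (K : fieldType) (Q : quiver) (I : ideal (path_alg K Q)).
Variables (R2 : set (qpath Q)) (D A : nat).
Local Notation delta := (delta D A).
Local Notation DA := (Delta_arrow R2).
Implicit Types (x y : DA).
Hypothesis IE : forall z, ideal_set I z <-> forall p, z@_p != 0 -> hasrel R2 (parrows p).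
Hypothesis R2len : forall q, R2 q -> (2 <= plen q)%N.
Hypothesis R2anti : forall q q', R2 q -> R2 q' ->
  infix (parrows q) (parrows q') -> q = q'.
Hypothesis Hlen : forall n R, Rset R2 n R -> plen R = delta n.
Hypothesis D2 : (2 < D)%N.
Hypothesis A1 : (1 < A)%N.
Hypothesis D2A : D <> (2 * A)%N.

Let superadd k n T : Rset R2 (k + n) T -> (delta k + delta n <= delta (k + n))%N.
Proof. exact: (Rset_delta_superadd Hlen D2 A1 D2A). Qed.

Lemma nonzero_pair_fmul x y : nonzero_pair x y <->
  @fmul Q R2 K I x.1 y.1 x.2 y.2 <> @ext0 Q R2 K I (x.1 + y.1)%N.
Proof.
have E := fmul_eq0 IE R2len R2anti (darrow_Rset y) Hlen
  (fun k T => @superadd k y.1 T) (darrow_Rset x).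
split=> [g /E //|ne]; apply: contrapT => ng; apply: ne.
by apply/E.
Qed.

Lemma nonzero_pair_fmulE x y p : pcomp y.2 x.2 = Some p -> Rset R2 (x.1 + y.1) p ->
  @fmul Q R2 K I x.1 y.1 x.2 y.2 =
  [set h | forall z : Pn I R2 (x.1 + y.1), h z = @fn K Q I R2 (x.1 + y.1) p z].
Proof.
move=> cp HR; exact: (fmul_val IE R2len R2anti (darrow_Rset y) Hlen
  (fun k T => @superadd k y.1 T) (darrow_Rset x) cp HR).
Qed.

Lemma Delta_word2 (w : qpath (Delta R2)) u v : Delta_word w [:: u; v] ->
  exists x y, [/\ parrows w = [:: x; y], darrow x = u & darrow y = v].
Proof.
rewrite /Delta_word; case: (parrows w) => [|x [|y [|? ?]]] //= [<- <-].
by exists x, y.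
Qed.

Lemma H_DeltaE : H_Delta R2 I = @H_zero K Q R2 `|` @H_swap K Q R2.
Proof.
have deg := nonzero_pair_deg Hlen D2 A1 D2A.
apply/seteqP; split=> h.
  case=> [[|]|].
  - case=> w [S [R [-> [mn hmn /Delta_word2[x [y [ew ex ey]]]]]]].
    left; exists w, x, y; split=> // /deg; rewrite ex ey /=.
    by move: hmn; rewrite !inE => /or4P[|||/or3P[||]] /eqP -> [] [].
  - case=> w [S [R [-> [[m n] _ /= [/Delta_word2[x [y [ew ex ey]]] f0]]]]].
    left; exists w, x, y; split=> // /nonzero_pair_fmul; apply.
    by rewrite ex ey.
  - case=> w [w' [b [c [c' [b' [-> /Delta_word2[x [y [ew ex ey]]]
      /Delta_word2[x' [y' [ew' ex' ey']]] ne e]]]]]].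
    right; exists w, w', x, y, x', y'.
    have g : nonzero_pair x y by apply/nonzero_pair_fmul; rewrite ex ey.
    have g' : nonzero_pair x' y' by apply/nonzero_pair_fmul; rewrite ex' ey' /= -e.
    split; rewrite ?ex ?ey ?ex' ?ey' //=.
    have [p cp HR] := g; have [p' cp' HR'] := g'.
    have fe := nonzero_pair_fmulE cp HR; have fe' := nonzero_pair_fmulE cp' HR'.
    rewrite ex ey in fe HR cp; rewrite ex' ey' in fe' HR' cp'.
    (* A nonzero product determines its path, so equal products have equal paths. *)
    have : p = p' by apply: (fn_set_inj IE R2len HR); rewrite -fe e fe'.
    by move=> epp; have /pcompP[_ _ <-] := cp; have /pcompP[_ _ <-] := cp'; rewrite epp.
case.
  case=> w [x [y [-> ew ng]]].
  have dw : Delta_word w [:: (x.1, x.2); (y.1, y.2)].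
    by rewrite /Delta_word ew /= -!surjective_pairing.
  have [h22|] := boolP ((x.1, y.1) \in [:: (2, 2); (2, 3); (3, 2)]%N).
    left; right; exists w, x.2, y.2; split=> //.
    exists (x.1, y.1) => //; split=> //.
    by apply: contrapT => /nonzero_pair_fmul.
  move=> nin; left; left; exists w, x.2, y.2; split=> //.
  exists (x.1, y.1) => //; move: nin; rewrite !inE.
  by case: (darrow_deg x) => ->; case: (darrow_deg y) => ->.
case=> w [w' [x [y [x' [y' [-> [ew ew'] [hx hy hx' hy'] g ea]]]]]].
have g' : nonzero_pair x' y'
  by apply: (swap_nonzero_pair Hlen D2 A1 D2A ew' _ g ea); rewrite hx hy hx' hy'.
have pairE (a : DA) k : a.1 = k -> darrow a = (k, a.2).
  by case: (darrow a) => m S /= ->.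
have dw : Delta_word w [:: (2%N, x.2); (3%N, y.2)].
  by rewrite /Delta_word ew /= (pairE _ _ hx) (pairE _ _ hy).
have dw' : Delta_word w' [:: (3%N, x'.2); (2%N, y'.2)].
  by rewrite /Delta_word ew' /= (pairE _ _ hx') (pairE _ _ hy').
right; exists w, w', x.2, y.2, x'.2, y'.2; split=> //.
  by have /nonzero_pair_fmul := g; rewrite hx hy.
have [p cp HR] := g; have [p' cp' HR'] := g'.
have fe := nonzero_pair_fmulE cp HR; have fe' := nonzero_pair_fmulE cp' HR'.
rewrite hx hy in fe; rewrite hx' hy' in fe'; rewrite fe fe'.
suff -> : p = p' by [].
have /pcompP[_ _ ap] := cp; have /pcompP[_ _ ap'] := cp'.
apply: qpath_eq_arrows; first by rewrite ap ap' ea.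
by rewrite (Hlen HR) hx hy /Defs.delta /=; lia.
Qed.

End Generators.

Theorem proposition5p5 (K : fieldType) (V E : finType) (s t : E -> V)
    (I : ideal (path_alg K (Quiver s t))) (R2 : set (qpath (Quiver s t)))
    (D A : nat) :
  admissible I ->
  minimal_generating_set (image R2 (@pbasis K (Quiver s t))) I ->
  stacked I D A ->
  (2 < D)%N -> (1 < A)%N -> D <> (2 * A)%N ->
  minimal_generating_set (H_Delta R2 I) (I_Delta R2 K).
Proof.
move=> adm mgI st D2 A1 D2A; have [genI _] := mgI.
have R2I : image R2 (@pbasis K (Quiver s t)) `<=` I.
  by rewrite -genI; apply: sub_ideal_gen.
have R2len q : R2 q -> (2 <= plen q)%N := admissible_len adm R2I (q := q).
have IE := monomial_idealE R2len genI.
have R2anti q q' : R2 q -> R2 q' -> infix (parrows q) (parrows q') -> q = q' :=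
  minimal_anti R2len mgI (q := q) (q' := q').
have Hlen n R : Rset R2 n R -> plen R = delta D A n :=
  Rset_plen IE R2len R2anti st (n := n) (R := R).
rewrite (H_DeltaE IE R2len R2anti Hlen D2 A1 D2A).
have genH := ideal_gen_H K Hlen D2 A1 D2A.
split=> // T TH eT; apply: (H_minimal Hlen D2 A1 D2A TH).
by rewrite eT genH.
Qed.
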